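(* Let $Q$ be an affine quiver without oriented cycles and $k$ a finite field with $q$ elements. Fix a simple injective $kQ$-module $I$ of defect $\langle\delta,\underline{\dim} I\rangle=1$. Let $n\ge1$ and let $P$ be the indecomposable preprojective module of dimension vector $n\delta-\underline{\dim} I$. Then in the Hall algebra of $kQ$, $$[I][P]=q^{n-1}[P][I]+\frac{1}{q-1}\,\mathfrak c(n),\qquad \mathfrak c(n)=\sum|\mathrm{Aut}\,X|\,[X],$$ where the sum runs over all modules $X=\bigoplus_{i} R_{x_i}(m_i)$ with $\underline{\dim} X=n\delta$ and the points $x_i$ pairwise distinct (at most one summand from each tube).
   Context: The Hall algebra of $kQ$ has basis isomorphism classes $[M]$ of finite-dimensional modules and product $[M][N]=\sum_{[X]}F^X_{MN}[X]$, $F^X_{MN}=|\{Y\subseteq X: X/Y\cong M,\ Y\cong N\}|$. $\delta$ is the minimal positive imaginary root of $Q$ and $\langle-,-\rangle$ the Euler form. The tubes of regular modules are indexed by the closed points $x$ of $\mathbb P^1_k$; $d_x$ is the degree of $x$. For each $x$ there is a unique regular simple module $S_x$ in the tube $x$ admitting an epimorphism onto $I$, and $R_x(m)$ denotes the indecomposable regular module of dimension vector $m\,d_x\,\delta$ in the tube $x$ into which $S_x$ embeds. *)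

(* Defs.v *)
From HB Require Import structures.
From mathcomp Require Import all_boot all_order all_algebra.
Set Implicit Arguments. Unset Strict Implicit. Unset Printing Implicit Defensive.
Import Order.TTheory GRing.Theory Num.Theory.
Local Open Scope ring_scope.

Record quiver := Quiver { qV : finType; qA : finType; qs : qA -> qV; qt : qA -> qV }.

(* Convention: a representation assigns F^(rdim v) (row vectors) to each vertex
   and to an arrow a : s -> t the linear map x |-> x *m rmap a. *)
Record rep (Q : quiver) (F : finFieldType) := Rep {
  rdim : qV Q -> nat;
  rmap : forall a : qA Q, 'M[F]_(rdim (qs a), rdim (qt a)) }.

Section Reps.
Variables (Q : quiver) (F : finFieldType).
Local Notation V := (qV Q).
Local Notation A := (qA Q).
Local Notation rep := (rep Q F).

Definition arrow_rel : rel V := fun u v => [exists a : A, (qs a == u) && (qt a == v)].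
Definition edge_rel : rel V := fun u v => arrow_rel u v || arrow_rel v u.

Definition acyclic : Prop := forall a : A, ~~ connect arrow_rel (qt a) (qs a).
Definition connected_quiver : Prop := forall u v : V, connect edge_rel u v.

Definition euler (x y : V -> int) : int :=
  \sum_(v : V) x v * y v - \sum_(a : A) x (qs a) * y (qt a).
Definition cartan (x y : V -> int) : int := euler x y + euler y x.
Definition evec (v : V) : V -> int := fun w => (w == v)%:R.
Definition ivec (d : V -> nat) : V -> int := fun v => (d v)%:Z.

(* Kac: indecomposable GCM of affine type = there is a positive vector in its kernel *)
Definition affine_quiver : Prop :=
  connected_quiver /\
  exists d : V -> nat, (forall v, (0 < d v)%N) /\ forall v, cartan (ivec d) (evec v) = 0.

(* delta: the minimal positive imaginary root, i.e. the positive generator of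
   the (rank one) radical of the symmetrized Euler form. *)
Definition min_pos_imag_root (delta : V -> nat) : Prop :=
  (forall v, (0 < delta v)%N) /\
  (forall v, cartan (ivec delta) (evec v) = 0) /\
  (forall d : V -> nat, (forall v, cartan (ivec d) (evec v) = 0) ->
     exists k : nat, forall v, d v = (k * delta v)%N).

Definition homT (M N : rep) := forall v : V, 'M[F]_(rdim M v, rdim N v).
Definition is_hom (M N : rep) (f : homT M N) : Prop :=
  forall a : A, rmap M a *m f (qt a) = f (qs a) *m rmap N a.
Definition is_mono (M N : rep) (f : homT M N) : Prop := forall v, row_free (f v).
Definition is_epi (M N : rep) (f : homT M N) : Prop := forall v, row_full (f v).

Definition iso (M N : rep) : Prop :=
  exists (f : homT M N) (g : homT N M), [/\ is_hom f, is_hom g,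
    (forall v, f v *m g v = 1%:M) & (forall v, g v *m f v = 1%:M)].

Definition is_zero (M : rep) : Prop := forall v, rdim M v = 0%N.
Definition zero_rep : rep := @Rep Q F (fun _ => 0%N) (fun a => 0).
Definition dsum (M N : rep) : rep :=
  @Rep Q F (fun v => (rdim M v + rdim N v)%N)
    (fun a => block_mx (rmap M a) 0 0 (rmap N a)).
Definition bigsum (s : seq rep) : rep := foldr dsum zero_rep s.

Definition indecomposable (M : rep) : Prop :=
  ~ is_zero M /\ forall N1 N2 : rep, iso M (dsum N1 N2) -> is_zero N1 \/ is_zero N2.

Definition simple_rep (M : rep) : Prop :=
  ~ is_zero M /\
  forall (N : rep) (f : homT N M), is_hom f -> is_mono f -> is_zero N \/ is_epi f.

Definition injective_rep (M : rep) : Prop :=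
  forall (X Y : rep) (f : homT X Y) (g : homT X M),
    is_hom f -> is_mono f -> is_hom g ->
    exists h : homT Y M, is_hom h /\ forall v, f v *m h v = g v.

Definition defect (delta : V -> nat) (M : rep) : int := euler (ivec delta) (ivec (rdim M)).

Definition preprojective (delta : V -> nat) (M : rep) : Prop :=
  indecomposable M /\ defect delta M < 0.
Definition regular_indec (delta : V -> nat) (M : rep) : Prop :=
  indecomposable M /\ defect delta M = 0.
Definition regular_module (delta : V -> nat) (M : rep) : Prop :=
  exists s : seq rep,
    (forall i, (i < size s)%N -> regular_indec delta (nth zero_rep s i)) /\
    iso M (bigsum s).
Definition regular_simple (delta : V -> nat) (S : rep) : Prop :=
  regular_indec delta S /\
  forall (N : rep) (f : homT N S), is_hom f -> is_mono f -> regular_module delta N ->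
    is_zero N \/ is_epi f.

(* S is "S_x" for the tube x: regular simple admitting an epimorphism onto I *)
Definition special_reg_simple (delta : V -> nat) (I S : rep) : Prop :=
  regular_simple delta S /\ exists f : homT S I, is_hom f /\ is_epi f.
Definition embeds (S R : rep) : Prop := exists f : homT S R, is_hom f /\ is_mono f.

(* R is some R_x(m), m >= 1: indecomposable regular of dimension a positive
   multiple of delta into which the special regular simple S_x of its tube embeds *)
Definition is_Rxm (delta : V -> nat) (I R : rep) : Prop :=
  regular_indec delta R /\
  (exists m : nat, (0 < m)%N /\ forall v, rdim R v = (m * delta v)%N) /\
  exists S, special_reg_simple delta I S /\ embeds S R.

(* X ~ (+)_i R_{x_i}(m_i) with the x_i pairwise distinct and dim X = n delta.
   Two summands lie in the same tube iff they contain a common S_x. *)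
Definition c_form (delta : V -> nat) (I : rep) (n : nat) (X : rep) : Prop :=
  (forall v, rdim X v = (n * delta v)%N) /\
  exists s : seq rep,
    iso X (bigsum s) /\
    (forall i, (i < size s)%N -> is_Rxm delta I (nth zero_rep s i)) /\
    (forall i j, (i < j)%N -> (j < size s)%N ->
       ~ exists S, special_reg_simple delta I S /\
           embeds S (nth zero_rep s i) /\ embeds S (nth zero_rep s j)).

Definition homb (M N : rep) (f : {dffun forall v : V, 'M[F]_(rdim M v, rdim N v)}) : bool :=
  [forall a : A, rmap M a *m f (qt a) == f (qs a) *m rmap N a].

(* F^X_{MN} = #{Y <= X subrepresentation : X/Y ~ M, Y ~ N};
   a subrepresentation is a family of subspaces U_v, stored in canonical form <<U_v>>. *)
Definition hall_number (M N X : rep) : nat :=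
  #|[set U : {dffun forall v : V, 'M[F]_(rdim X v)} |
     [&& [forall v, U v == <<U v>>%MS],
         [exists phi : {dffun forall v : V, 'M[F]_(rdim N v, rdim X v)},
            homb phi && [forall v, row_free (phi v) && (phi v == U v)%MS]] &
         [exists psi : {dffun forall v : V, 'M[F]_(rdim X v, rdim M v)},
            homb psi && [forall v, row_full (psi v) && (kermx (psi v) == U v)%MS]]]]|.

Definition aut_number (X : rep) : nat :=
  #|[set g : {dffun forall v : V, 'M[F]_(rdim X v, rdim X v)} |
      homb g && [forall v, g v \in unitmx]]|.

End Reps.

(* Main.v *)
(* Let i be the vertex carrying I: it is a source with delta_i = 1, and Hom(X, I) is the
   dual of X_i. If Hom(I, X) <> 0, only X = P + I contributes, and there both Hall numbers
   are counted directly. If Hom(I, X) = 0, then F^X_{PI} = 0, and a submodule P of X with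
   quotient I is the kernel of q - 1 maps X -> I.

   Fix one such map f. Away from i, X is a sum of copies of the module M of dimension
   delta - dim I, so X amounts to a Kronecker pencil (A, B) of n x n matrices. With the
   adjugate of A + t B one shows that f generates Hom(X, I) over End X and that End X is
   commutative; hence the maps with kernel P form one free orbit of Aut X. Commutativity
   also forbids two summands of X in one tube, since a common regular simple with a map to I
   would yield noncommuting endomorphisms. Conversely, if X is a sum of R_x(m) from distinct
   tubes, some f is nonzero on every regular simple submodule, and its kernel, having only
   submodules of negative defect and the dimension of P, is isomorphic to P.

   The facts on regular modules come from counting: an elementary dual of Ext^1 turns the
   Euler form into a ratio of cardinalities, which yields the vanishing of Ext in the
   direction of increasing defect, Auslander-Reiten duality between regular simples, and the
   uniqueness of the regular simple submodule of an indecomposable regular module. *)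

Require Import Defs.
From HB Require Import structures.
From mathcomp Require Import all_boot all_order all_algebra.
From mathcomp Require Import zify ring lra.
From Stdlib Require Import Classical.
Set Implicit Arguments. Unset Strict Implicit. Unset Printing Implicit Defensive.
Import Order.TTheory GRing.Theory Num.Theory.
Local Open Scope ring_scope.

(** * Homomorphisms and short exact sequences *)

(** No Auslander-Reiten translate is constructed. A nonzero [p] in the dual of Ext(N, M) acts on
    Hom(N, E) and on Hom(E, M); as soon as both actions are injective, N and M behave numerically
    like a pair with M = tau N, and inequalities between cardinals do the rest. Tubes are not
    constructed either: regular modules are the semistable modules for the defect, regular simple
    modules are the stable ones, and all that is used of a tube is that an indecomposable semistable
    module has only one stable submodule.

    The pencil A + t B may be singular at every rational point of the projective line over a finite
    field, so in general no value of t makes it invertible. This is why the adjugate over F[t]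
    appears: its coefficients are matrices over F, they intertwine A and B, and jointly they replace
    the missing inverse.

    In the formula, q - 1 is the order of Aut I, and q^(n-1) is the number of maps from P to I,
    since P has dimension n - 1 at the vertex of I. *)

Section Hom.
Variables (Q : quiver) (F : finFieldType).
Implicit Types (K M N X Y : rep Q F) (v : qV Q) (a : qA Q).

Record hom M N := Hom {
  hf :> forall v, 'M[F]_(rdim M v, rdim N v);
  homP : @is_hom Q F M N hf }.

Definition mono M N (f : hom M N) := forall v, row_free (f v).
Definition epi M N (f : hom M N) := forall v, row_full (f v).

Lemma homE M N (f : hom M N) a : rmap M a *m f (qt a) = f (qs a) *m rmap N a.
Proof. exact: homP. Qed.

Lemma hid_subproof M : @is_hom Q F M M (fun v => 1%:M).
Proof. by move=> a; rewrite mulmx1 mul1mx. Qed.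
Definition hid M := Hom (hid_subproof M).

Lemma hcomp_subproof M N X (f : hom M N) (g : hom N X) :
  @is_hom Q F M X (fun v => f v *m g v).
Proof. by move=> a; rewrite mulmxA homE -mulmxA homE mulmxA. Qed.
Definition hcomp M N X (f : hom M N) (g : hom N X) := Hom (hcomp_subproof f g).

Lemma hzero_subproof M N : @is_hom Q F M N (fun v => 0).
Proof. by move=> a; rewrite mulmx0 mul0mx. Qed.
Definition hzero M N := Hom (hzero_subproof M N).

Lemma hadd_subproof M N (f g : hom M N) : @is_hom Q F M N (fun v => f v + g v).
Proof. by move=> a; rewrite mulmxDr mulmxDl !homE. Qed.
Definition hadd M N (f g : hom M N) := Hom (hadd_subproof f g).

Lemma hscale_subproof M N c (f : hom M N) : @is_hom Q F M N (fun v => c *: f v).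
Proof. by move=> a; rewrite -scalemxAr -scalemxAl !homE. Qed.
Definition hscale M N c (f : hom M N) := Hom (hscale_subproof c f).

Definition hsub M N (f g : hom M N) := hadd f (hscale (-1) g).
Lemma hsubE M N (f g : hom M N) v : hsub f g v = f v - g v.
Proof. by rewrite /= scaleN1r. Qed.

Definition hnz M N (f : hom M N) := exists v, f v != 0.

Lemma hnzPn M N (f : hom M N) : ~ hnz f -> forall v, f v = 0.
Proof. by move=> nf v; apply/eqP/negPn/negP => fv; apply: nf; exists v. Qed.

Lemma hom_eq M N (f g : hom M N) : ~ hnz (hsub f g) -> forall v, f v = g v.
Proof. by move/hnzPn => e v; apply/eqP; rewrite -subr_eq0 -hsubE e. Qed.

Definition nzero M := ~ is_zero M.
Lemma nzeroP M : nzero M <-> exists v, rdim M v != 0%N.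
Proof.
split=> [nM|[v /eqP nv] zM]; last exact: nv (zM v).
apply: NNPP => nex; apply: nM => v; apply/eqP/negPn/negP => nv.
by apply: nex; exists v.
Qed.

Lemma mono_hid M : mono (hid M). Proof. by move=> v; rewrite /= row_free_unit unitmx1. Qed.
Lemma epi_hid M : epi (hid M). Proof. by move=> v; rewrite /= row_full_unit unitmx1. Qed.

Lemma mx_rows0 m n (x : 'M[F]_(m, n)) : m = 0%N -> x = 0.
Proof. by move=> m0; move: x; rewrite m0; exact: flatmx0. Qed.
Lemma mx_cols0 m n (x : 'M[F]_(m, n)) : n = 0%N -> x = 0.
Proof. by move=> n0; move: x; rewrite n0; exact: thinmx0. Qed.

Lemma hnz_dom M N (f : hom M N) : hnz f -> nzero M.
Proof.
by case=> v fv; apply/nzeroP; exists v; apply: contra fv => /eqP e; rewrite (mx_rows0 (f v) e).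
Qed.

Lemma hnz_cod M N (f : hom M N) : hnz f -> nzero N.
Proof.
by case=> v fv; apply/nzeroP; exists v; apply: contra fv => /eqP e; rewrite (mx_cols0 (f v) e).
Qed.

Lemma free_inj m n p (f : 'M[F]_(m, n)) (x y : 'M[F]_(p, m)) :
  row_free f -> x *m f = y *m f -> x = y.
Proof. by move=> /row_free_inj; apply. Qed.

Lemma full_inj m n p (f : 'M[F]_(m, n)) (x y : 'M[F]_(n, p)) :
  row_full f -> f *m x = f *m y -> x = y.
Proof. by move=> /row_full_inj; apply. Qed.

Lemma row_free0 m n (f : 'M[F]_(m, n)) : row_free f -> f = 0 -> m = 0%N.
Proof. by rewrite /row_free => /eqP h f0; rewrite -h f0 mxrank0. Qed.
Lemma row_full0 m n (f : 'M[F]_(m, n)) : row_full f -> f = 0 -> n = 0%N.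
Proof. by rewrite /row_full => /eqP h f0; rewrite -h f0 mxrank0. Qed.

Lemma mono_hnz M N (f : hom M N) : mono f -> nzero M -> hnz f.
Proof.
move=> mf nM; apply: NNPP => /hnzPn f0; apply: nM => v.
exact: row_free0 (mf v) (f0 v).
Qed.

Lemma epi_hnz M N (f : hom M N) : epi f -> nzero N -> hnz f.
Proof.
move=> mf nM; apply: NNPP => /hnzPn f0; apply: nM => v.
exact: row_full0 (mf v) (f0 v).
Qed.

Lemma mono_comp M N X (f : hom M N) (g : hom N X) : mono f -> mono g -> mono (hcomp f g).
Proof.
move=> mf mg v; apply/row_freeP.
have /row_freeP[f' ff'] := mf v; have /row_freeP[g' gg'] := mg v.
by exists (g' *m f'); rewrite /= mulmxA -(mulmxA (f v)) gg' mulmx1.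
Qed.

Lemma epi_comp M N X (f : hom M N) (g : hom N X) : epi f -> epi g -> epi (hcomp f g).
Proof.
move=> mf mg v; apply/row_fullP.
have /row_fullP[f' ff'] := mf v; have /row_fullP[g' gg'] := mg v.
by exists (g' *m f'); rewrite /= mulmxA -(mulmxA g') ff' mulmx1.
Qed.

Lemma free_mull m n p (f : 'M[F]_(m, n)) (g : 'M[F]_(n, p)) : row_free (f *m g) -> row_free f.
Proof. by case/row_freeP=> h fgh; apply/row_freeP; exists (g *m h); rewrite mulmxA. Qed.
Lemma full_mulr m n p (f : 'M[F]_(m, n)) (g : 'M[F]_(n, p)) : row_full (f *m g) -> row_full g.
Proof. by case/row_fullP=> h fgh; apply/row_fullP; exists (h *m f); rewrite -mulmxA. Qed.

Lemma mono_rank M N (f : hom M N) : mono f -> forall v, \rank (f v) = rdim M v.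
Proof. by move=> mf v; apply/eqP; exact: mf. Qed.
Lemma epi_rank M N (f : hom M N) : epi f -> forall v, \rank (f v) = rdim N v.
Proof. by move=> mf v; apply/eqP; exact: mf. Qed.

Lemma mono_le M N (f : hom M N) : mono f -> forall v, (rdim M v <= rdim N v)%N.
Proof. by move=> mf v; have := rank_leq_col (f v); rewrite (mono_rank mf). Qed.
Lemma epi_le M N (f : hom M N) : epi f -> forall v, (rdim N v <= rdim M v)%N.
Proof. by move=> mf v; have := rank_leq_row (f v); rewrite (epi_rank mf). Qed.

Lemma mono_epi M N (f : hom M N) : mono f -> (forall v, rdim M v = rdim N v) -> epi f.
Proof. by move=> mf e v; rewrite /row_full (mono_rank mf) e. Qed.
Lemma epi_mono M N (f : hom M N) : epi f -> (forall v, rdim M v = rdim N v) -> mono f.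
Proof. by move=> mf e v; rewrite /row_free (epi_rank mf) e. Qed.

Lemma bij_inv M N (f : hom M N) : mono f -> epi f ->
  exists g : hom N M, (forall v, f v *m g v = 1%:M) /\ (forall v, g v *m f v = 1%:M).
Proof.
move=> mf ef.
have h : @is_hom Q F N M (fun v => pinvmx (f v)).
  move=> a; apply: (free_inj (mf _)); rewrite -mulmxA mulVpmx ?ef // mulmx1.
  by rewrite -mulmxA homE mulmxA mulVpmx ?ef // mul1mx.
by exists (Hom h); split=> v /=; rewrite ?mulmxVp ?mulVpmx.
Qed.

Lemma iso_of_bij M N (f : hom M N) : mono f -> epi f -> iso M N.
Proof.
move=> mf ef; have [g [fg gf]] := bij_inv mf ef.
by exists f, g; split=> //; apply: homP.
Qed.

Lemma iso_bij M N : iso M N -> exists f : hom M N, mono f /\ epi f.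
Proof.
case=> f [g [hf hg fg gf]]; exists (@Hom M N f hf); split=> v /=.
  by apply/row_freeP; exists (g v).
by apply/row_fullP; exists (g v).
Qed.

Lemma iso_refl M : iso M M.
Proof. by apply: (@iso_of_bij M M (hid M)); [apply: mono_hid | apply: epi_hid]. Qed.
Lemma iso_sym M N : iso M N -> iso N M.
Proof. by case=> f [g [? ? ? ?]]; exists g, f; split. Qed.
Lemma iso_trans M N X : iso M N -> iso N X -> iso M X.
Proof.
move=> /iso_bij[f [mf ef]] /iso_bij[g [mg eg]].
by apply: (@iso_of_bij _ _ (hcomp f g)); [apply: mono_comp | apply: epi_comp].
Qed.
Lemma iso_rdim M N : iso M N -> forall v, rdim M v = rdim N v.
Proof. by case/iso_bij=> f [mf ef] v; apply: etrans (esym (mono_rank mf v)) (epi_rank ef v). Qed.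

(* A subrepresentation of [X], as the row spaces of a family of square matrices. *)
Definition sfam X (U : forall v, 'M[F]_(rdim X v)) :=
  forall a, (U (qs a) *m rmap X a <= U (qt a))%MS.

Lemma sub_ex X (U : forall v, 'M[F]_(rdim X v)) : sfam U ->
  exists N, exists2 k : hom N X, mono k & forall v, (k v :=: U v)%MS.
Proof.
move=> sU.
pose N : rep Q F := @Rep Q F (fun v => \rank (U v))
  (fun a => row_base (U (qs a)) *m rmap X a *m pinvmx (row_base (U (qt a)))).
have h : @is_hom Q F N X (fun v => row_base (U v)).
  move=> a /=; rewrite mulmxKpV // eq_row_base.
  by apply: submx_trans (sU a); rewrite submxMr // eq_row_base.
exists N, (Hom h) => v /=; first exact: row_base_free.
exact: eq_row_base.
Qed.

Lemma ker_coker m n (U : 'M[F]_(m, n)) : (kermx (col_base (cokermx U)) :=: U)%MS.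
Proof.
apply/eqmxP/andP; split.
  by rewrite submxE -[X in _ *m X]mulmx_base mulmxA mulmx_ker mul0mx.
apply/sub_kermxP; apply: (@free_inj _ _ _ (row_base (cokermx U))).
  exact: row_base_free.
by rewrite -mulmxA mulmx_base mulmx_coker mul0mx.
Qed.

Lemma quo_ex X (U : forall v, 'M[F]_(rdim X v)) : sfam U ->
  exists C, exists2 c : hom X C, epi c & forall v, (kermx (c v) :=: U v)%MS.
Proof.
move=> sU.
have [c full kc] : exists2 c : forall v, 'M[F]_(rdim X v, \rank (cokermx (U v))),
    forall v, row_full (c v) & forall v, (kermx (c v) :=: U v)%MS.
  exists (fun v => col_base (cokermx (U v))) => v; first exact: col_base_full.
  exact: ker_coker.
have [p pc] : exists p : forall v, 'M[F]_(\rank (cokermx (U v)), rdim X v),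
    forall v, p v *m c v = 1%:M.
  by exists (fun v => pinvmx (c v)) => v; rewrite mulVpmx.
have pker v : (1%:M - c v *m p v <= U v)%MS.
  rewrite -kc; apply/sub_kermxP.
  by rewrite mulmxBl mul1mx -mulmxA pc mulmx1 subrr.
pose C : rep Q F := @Rep Q F (fun v => \rank (cokermx (U v)))
  (fun a => p (qs a) *m rmap X a *m c (qt a)).
have h : @is_hom Q F X C c.
  move=> a /=; apply/eqP; rewrite -subr_eq0 !mulmxA -!mulmxBl; apply/eqP.
  rewrite -[X in X - _]mul1mx -mulmxBl; apply/sub_kermxP.
  by rewrite kc; apply: submx_trans (sU a); apply: submxMr.
by exists C, (Hom h) => v /=; [apply: full | apply: kc].
Qed.

Lemma fac_mono N X Y (k : hom N X) (g : hom Y X) : mono k ->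
  (forall v, (g v <= k v)%MS) -> exists g' : hom Y N, forall v, g' v *m k v = g v.
Proof.
move=> mk gk.
have [p pk] : exists p : forall v, 'M[F]_(rdim Y v, rdim N v),
    forall v, p v *m k v = g v.
  by exists (fun v => g v *m pinvmx (k v)) => v; rewrite mulmxKpV.
have h : @is_hom Q F Y N p.
  move=> a; apply: (free_inj (mk (qt a))).
  by rewrite -!mulmxA pk homE -pk homE !mulmxA.
by exists (Hom h).
Qed.

Lemma fac_epi X C Y (c : hom X C) (g : hom X Y) : epi c ->
  (forall v, (kermx (c v) <= kermx (g v))%MS) ->
  exists g' : hom C Y, forall v, c v *m g' v = g v.
Proof.
move=> ec cg.
have [p pc] : exists p : forall v, 'M[F]_(rdim C v, rdim X v),
    forall v, p v *m c v = 1%:M.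
  by exists (fun v => pinvmx (c v)) => v; rewrite mulVpmx.
have E v : c v *m (p v *m g v) = g v.
  apply/eqP; rewrite -subr_eq0 mulmxA -[X in _ - X]mul1mx -mulmxBl; apply/eqP.
  apply/sub_kermxP; apply: submx_trans (cg v); apply/sub_kermxP.
  by rewrite mulmxBl mul1mx -mulmxA pc mulmx1 subrr.
have h : @is_hom Q F C Y (fun v => p v *m g v).
  move=> a; apply: (full_inj (ec (qs a))).
  by rewrite mulmxA -homE -mulmxA E homE mulmxA E.
by exists (Hom h).
Qed.

Lemma sfam_img M X (f : hom M X) : sfam (fun v => <<f v>>%MS).
Proof.
move=> a; rewrite (eqmxMr _ (genmxE _)) genmxE -homE.
exact: submxMl.
Qed.
Lemma sfam_ker X Y (f : hom X Y) : sfam (fun v => kermx (f v)).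
Proof. by move=> a; apply/sub_kermxP; rewrite -mulmxA homE mulmxA mulmx_ker mul0mx. Qed.

Lemma hker_ex X Y (f : hom X Y) :
  exists K, exists2 k : hom K X, mono k & forall v, (k v :=: kermx (f v))%MS.
Proof. by apply: sub_ex; exact: sfam_ker. Qed.

Lemma hcok_ex X Y (f : hom X Y) :
  exists C, exists2 c : hom Y C, epi c & forall v, (kermx (c v) :=: f v)%MS.
Proof.
have [C [c ec ck]] := quo_ex (sfam_img f).
by exists C, c => // v; apply: eqmx_trans (ck v) (genmxE _).
Qed.

Lemma him_ex X Y (f : hom X Y) :
  exists J, exists (e : hom X J) (m : hom J Y),
  [/\ epi e, mono m & forall v, f v = e v *m m v].
Proof.
have [J [m mm mf]] := sub_ex (sfam_img f).
have fm v : (f v <= m v)%MS by rewrite mf genmxE.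
have [e eE] := fac_mono mm fm.
exists J, e, m; split=> // v.
rewrite /row_full -(mxrankMfree _ (mm v)) eE -(mono_rank mm) mf.
by rewrite genmxE.
Qed.

Definition ses K X C (k : hom K X) (c : hom X C) :=
  [/\ mono k, epi c & forall v, (kermx (c v) :=: k v)%MS].

Lemma ses_dim K X C (k : hom K X) (c : hom X C) : ses k c ->
  forall v, rdim X v = (rdim K v + rdim C v)%N.
Proof.
case=> mk ec kc v; rewrite -(mono_rank mk) -(epi_rank ec) -kc mxrank_ker.
by rewrite subnK // rank_leq_row.
Qed.

Lemma ses0 K X C (k : hom K X) (c : hom X C) : ses k c -> forall v, k v *m c v = 0.
Proof. by case=> mk ec kc v; apply/sub_kermxP; rewrite kc. Qed.

Lemma ses_mono K X (k : hom K X) : mono k -> exists C, exists c : hom X C, ses k c.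
Proof. by move=> mk; have [C [c ec ck]] := hcok_ex k; exists C, c; split. Qed.

Lemma ses_epi X C (c : hom X C) : epi c -> exists K, exists k : hom K X, ses k c.
Proof.
move=> ec; have [K [k mk kc]] := hker_ex c; exists K, k; split=> // v.
exact: eqmx_sym (kc v).
Qed.

Lemma ses_fac K X C N (k : hom K X) (c : hom X C) (g : hom N X) : ses k c ->
  (forall v, g v *m c v = 0) -> exists g' : hom N K, forall v, g' v *m k v = g v.
Proof.
case=> mk ec kc g0; apply: fac_mono => // v; rewrite -kc.
exact/sub_kermxP.
Qed.

Lemma ses_cofac K X C N (k : hom K X) (c : hom X C) (g : hom X N) : ses k c ->
  (forall v, k v *m g v = 0) -> exists g' : hom C N, forall v, c v *m g' v = g v.
Proof.
case=> mk ec kc g0; apply: fac_epi => // v; rewrite kc.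
exact/sub_kermxP.
Qed.

Lemma hinl_subproof M N : @is_hom Q F M (dsum M N) (fun v => row_mx 1%:M 0).
Proof. by move=> a /=; rewrite mul_row_block ?mul1mx ?mul0mx ?mulmx0 ?addr0 mul_mx_row mulmx1 mulmx0. Qed.
Definition hinl M N : hom M (dsum M N) := Hom (@hinl_subproof M N).
Lemma hinr_subproof M N : @is_hom Q F N (dsum M N) (fun v => row_mx 0 1%:M).
Proof. by move=> a /=; rewrite mul_row_block ?mul1mx ?mul0mx ?mulmx0 ?add0r mul_mx_row mulmx1 mulmx0. Qed.
Definition hinr M N : hom N (dsum M N) := Hom (@hinr_subproof M N).
Lemma hprl_subproof M N : @is_hom Q F (dsum M N) M (fun v => col_mx 1%:M 0).
Proof. by move=> a /=; rewrite mul_block_col mul_col_mx ?mulmx1 ?mul0mx ?mulmx0 ?addr0 mul1mx. Qed.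
Definition hprl M N : hom (dsum M N) M := Hom (@hprl_subproof M N).
Lemma hprr_subproof M N : @is_hom Q F (dsum M N) N (fun v => col_mx 0 1%:M).
Proof. by move=> a /=; rewrite mul_block_col mul_col_mx ?mulmx1 ?mul0mx ?mulmx0 ?add0r mul1mx. Qed.
Definition hprr M N : hom (dsum M N) N := Hom (@hprr_subproof M N).

Lemma inl_prl M N v : hinl M N v *m hprl M N v = 1%:M.
Proof. by rewrite /= mul_row_col mulmx1 mulmx0 addr0. Qed.
Lemma inr_prr M N v : hinr M N v *m hprr M N v = 1%:M.
Proof. by rewrite /= mul_row_col mulmx1 mulmx0 add0r. Qed.
Lemma inl_prr M N v : hinl M N v *m hprr M N v = 0.
Proof. by rewrite /= mul_row_col mulmx1 mulmx0 addr0. Qed.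
Lemma inr_prl M N v : hinr M N v *m hprl M N v = 0.
Proof. by rewrite /= mul_row_col mul0mx mulmx0 addr0. Qed.
Lemma pr_in M N v : hprl M N v *m hinl M N v + hprr M N v *m hinr M N v = 1%:M.
Proof.
rewrite /= !mul_col_row ?mulmx0 ?mul0mx ?mulmx1 add_block_mx ?addr0 ?add0r.
by rewrite -scalar_mx_block.
Qed.

Lemma ret_dsum S X (i : hom S X) (p : hom X S) : (forall v, i v *m p v = 1%:M) ->
  exists K, exists k : hom K X, [/\ mono k, (forall v, k v *m p v = 0) & iso X (dsum S K)].
Proof.
move=> ip; have [K [k mk kp]] := hker_ex p; exists K, k.
have kp0 v : k v *m p v = 0 by apply/sub_kermxP; rewrite kp.
split=> //; apply: iso_sym.
pose g := hadd (hcomp (hprl S K) i) (hcomp (hprr S K) k).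
have ep : epi p by move=> v; apply/row_fullP; exists (i v).
have sk : ses k p by split=> // v; apply: eqmx_sym.
have gE v : g v = hprl S K v *m i v + hprr S K v *m k v by [].
have mg : mono g.
  move=> v; rewrite -kermx_eq0; apply/eqP.
  set y := kermx _; have y0 : y *m g v = 0 by exact: mulmx_ker.
  have yl : y *m hprl S K v = 0.
    have <- : y *m g v *m p v = y *m hprl S K v.
      by rewrite gE -mulmxA mulmxDl -!mulmxA ip kp0 mulmx0 addr0 mulmx1.
    by rewrite y0 mul0mx.
  have yr : y *m hprr S K v = 0.
    apply: (free_inj (mk v)); rewrite mul0mx -y0 gE mulmxDr.
    by rewrite !(mulmxA y) yl mul0mx add0r.
  by rewrite -[y]mulmx1 -(pr_in S K) mulmxDr !(mulmxA y) yl yr !mul0mx addr0.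
apply: (iso_of_bij mg (mono_epi mg _)) => v.
by rewrite (ses_dim sk) /= addnC.
Qed.

Lemma indec_ret S X (i : hom S X) (p : hom X S) : indecomposable X ->
  (forall v, i v *m p v = 1%:M) -> nzero S -> mono p.
Proof.
move=> [nX ind] ip nS; have [K [k [mk kp sX]]] := ret_dsum ip.
case: (ind _ _ sX) => // zK v.
have dX := iso_rdim sX v; rewrite /= (zK v) addn0 in dX.
have: row_full (p v) by apply/row_fullP; exists (i v).
by rewrite /row_full /row_free => /eqP ->; rewrite dX.
Qed.

End Hom.

(** * Counting over a finite field *)

Section Count.

Lemma card_fiber_le (T U : finType) (f : T -> U) (k : nat) :
  (forall y, (#|[set x | f x == y]| <= k)%N) -> (#|T| <= k * #|f @: [set: T]|)%N.
Proof.
move=> fk; rewrite -cardsT -sum1_card (partition_big_imset f) /=.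
rewrite mulnC -sum_nat_const; apply: leq_sum => y _.
rewrite sum1dep_card; apply: leq_trans (fk y).
by apply/subset_leq_card/subsetP => x; rewrite !inE.
Qed.

(** The counting substitute for right exactness: once the fibres are bounded by the size of a
    kernel, an inequality between cardinals yields surjectivity. *)
Lemma card_fiber_surj (T U : finType) (f : T -> U) (k : nat) :
  (forall y, (#|[set x | f x == y]| <= k)%N) -> (k * #|U| <= #|T|)%N -> (0 < k)%N ->
  forall y, exists x, f x = y.
Proof.
move=> fk kU k0 y; have := leq_trans kU (card_fiber_le fk); rewrite leq_pmul2l // => le.
have eqT : f @: [set: T] = setT by apply/eqP; rewrite eqEcard subsetT cardsT.
have : y \in f @: [set: T] by rewrite eqT inE.
by case/imsetP => x _ ->; exists x.
Qed.

(** [l] plays a nonzero linear form and [s c] the translation by [c] times a vector of value 1, so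
    the kernel of [l] has index #|F|. Stated for a bare finite type because it is applied to
    dependent families of matrices. *)
Lemma card_shift (F : finFieldType) (T : finType) (l : T -> F) (s : F -> T -> T) :
  (forall c x, l (s c x) = l x + c) -> (forall c x, s c (s (- c) x) = x) ->
  (#|F| * #|[set x | l x == 0%R]|)%N = #|T|.
Proof.
move=> ls ss; rewrite -(cardsT F) -(cardsT T) -cardsX.
pose g (p : F * T) := s p.1 p.2.
have sK c x : s (- c) (s c x) = x by rewrite -{2}[c]opprK ss.
have ginj : {in setX [set: F] [set x | l x == 0%R] &, injective g}.
  move=> [c x] [d y]; rewrite !inE /g /= => /eqP lx /eqP ly e.
  have cd : c = d by move: (congr1 l e); rewrite !ls lx ly !add0r.
  by rewrite cd; congr (_, _); rewrite -(sK c x) e cd sK.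
rewrite -(card_in_imset ginj); congr #|pred_of_set _|.
apply/setP => x; rewrite inE; apply/imsetP; exists (l x, s (- l x) x).
  by rewrite !inE ls subrr eqxx.
by rewrite /g /= ss.
Qed.

Lemma fiber_cover (T U V : finType) (f : T -> U) (g : T -> V -> T) :
  (forall x x0, f x = f x0 -> exists t, x = g x0 t) ->
  forall y, (#|[set x | f x == y]| <= #|V|)%N.
Proof.
move=> cov y; case: (pickP (fun x => f x == y)) => [x0 /eqP fx0|n0]; last first.
  by rewrite (_ : [set _ | _] = set0) ?cards0 //; apply/setP => x; rewrite !inE n0.
apply: (@leq_trans #|g x0 @: [set: V]|); last first.
  by apply: leq_trans (leq_imset_card _ _) _; rewrite cardsT.
apply: subset_leq_card; apply/subsetP => x; rewrite inE -fx0 => /eqP/cov[t ->].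
exact: imset_f.
Qed.

(** A bilinear pairing has the same rank on both sides. The zeros of [b] are counted by rows and by
    columns: outside the kernels [H] and [Z] the proportion of zeros is 1/#|F|, inside them every
    entry is zero. *)
Lemma double_count (F : finFieldType) (C D : finType) (b : C -> D -> F)
    (H : {set C}) (Z : {set D}) :
  (forall g, g \in H -> forall p, b g p = 0) ->
  (forall p, p \in Z -> forall g, b g p = 0) ->
  (forall g, g \notin H -> (#|F| * #|[set p | b g p == 0%R]|)%N = #|D|) ->
  (forall p, p \notin Z -> (#|F| * #|[set g | b g p == 0%R]|)%N = #|C|) ->
  (#|H| * #|D| = #|Z| * #|C|)%N.
Proof.
move=> hH hZ nH nZ.
pose S := (\sum_(g : C) \sum_(p : D) (b g p == 0%R))%N.
have S1 : (#|F| * S + #|H| * #|D| = #|F| * #|H| * #|D| + #|C| * #|D|)%N.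
  rewrite /S big_distrr /= (bigID (mem H)) /=.
  rewrite (eq_bigr (fun=> #|F| * #|D|)%N); last first.
    by move=> g gH; rewrite (eq_bigr (fun=> 1%N)) ?sum1_card // => p _; rewrite hH ?eqxx.
  rewrite [X in (_ + X + _)%N](eq_bigr (fun=> #|D|)); last first.
    by move=> g gH; rewrite -(nH g gH) -sum1dep_card [in RHS]big_mkcond.
  rewrite !sum_nat_const -(cardC H) /=.
  have -> : #|[predC H]| = #|[pred x | x \notin H]| by apply: eq_card => x; rewrite !inE.
  by lia.
have S2 : (#|F| * S + #|Z| * #|C| = #|F| * #|Z| * #|C| + #|C| * #|D|)%N.
  rewrite /S exchange_big big_distrr /= (bigID (mem Z)) /=.
  rewrite (eq_bigr (fun=> #|F| * #|C|)%N); last first.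
    by move=> p pZ; rewrite (eq_bigr (fun=> 1%N)) ?sum1_card // => g _; rewrite hZ ?eqxx.
  rewrite [X in (_ + X + _)%N](eq_bigr (fun=> #|C|)); last first.
    by move=> p pZ; rewrite -(nZ p pZ) -sum1dep_card [in RHS]big_mkcond.
  rewrite !sum_nat_const -[#|D|](cardC Z) /=.
  have -> : #|[predC Z]| = #|[pred x | x \notin Z]| by apply: eq_card => x; rewrite !inE.
  by lia.
have q1 : (1 < #|F|)%N := card_finNzRing_gt1 F.
have : ((#|F| - 1) * (#|H| * #|D|) = (#|F| - 1) * (#|Z| * #|C|))%N by nia.
by move/eqP; rewrite eqn_pmul2l ?subn_gt0 // => /eqP.
Qed.

Lemma trace_nondeg (F : finFieldType) m n (A : 'M[F]_(m, n)) :
  (forall B : 'M_(n, m), \tr (A *m B) = 0) -> A = 0.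
Proof.
move=> h; apply/matrixP => i j; rewrite mxE -[RHS](h (delta_mx j i)).
rewrite /mxtrace (bigD1 i) //= big1 => [|k ki].
  rewrite addr0 mxE (bigD1 j) //= big1 => [|k kj]; first by rewrite mxE !eqxx mulr1 addr0.
  by rewrite mxE (negPf kj) mulr0.
by rewrite mxE big1 // => l _; rewrite mxE (negPf ki) andbF mulr0.
Qed.

Lemma card_matfam (F : finFieldType) (T : finType) (m n : T -> nat) :
  #|{: {dffun forall x : T, 'M[F]_(m x, n x)}}| = (#|F| ^ \sum_x m x * n x)%N.
Proof.
rewrite card_dep_ffun foldrE big_image /= expn_sum.
by apply: eq_bigr => x _; rewrite card_mx.
Qed.

End Count.

(** * The dual of Ext^1 and the Euler form *)

Section Dext.
Variables (Q : quiver) (F : finFieldType).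
Implicit Types (K M N : rep Q F) (v : qV Q) (a : qA Q).

(** The bracket is the coboundary of the 0-cochain [g]; [zpair] is its trace pairing with [p]. *)
Definition zpair N M (g : forall v, 'M[F]_(rdim N v, rdim M v))
    (p : forall a, 'M[F]_(rdim M (qt a), rdim N (qs a))) : F :=
  \sum_a \tr ((rmap N a *m g (qt a) - g (qs a) *m rmap M a) *m p a).

(* The dual of Ext(N, M): the linear forms on cocycles vanishing on coboundaries. *)
Record dext N M := Dext {
  df :> forall a, 'M[F]_(rdim M (qt a), rdim N (qs a));
  dP : forall g, zpair g df = 0 }.

Definition dnz N M (p : dext N M) := exists a, p a != 0.
Lemma dnzPn N M (p : dext N M) : ~ dnz p -> forall a, p a = 0.
Proof. by move=> nf v; apply/eqP/negPn/negP => fv; apply: nf; exists v. Qed.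

Lemma dnz_src N M (p : dext N M) : dnz p -> nzero N.
Proof. by case=> a pa; apply/nzeroP; exists (qs a); apply: contra pa => /eqP e; rewrite (mx_cols0 (p a) e). Qed.
Lemma dnz_tgt N M (p : dext N M) : dnz p -> nzero M.
Proof. by case=> a pa; apply/nzeroP; exists (qt a); apply: contra pa => /eqP e; rewrite (mx_rows0 (p a) e). Qed.
Lemma dnz_facr N M K (p : dext N M) (p' : dext K M) (k : hom K N) :
  (forall a, p a = p' a *m k (qs a)) -> dnz p -> dnz p'.
Proof. by move=> pE [a na]; exists a; apply: contra na => /eqP e; rewrite pE e mul0mx. Qed.
Lemma dnz_facl N M C (p : dext N M) (p' : dext N C) (c : hom M C) :
  (forall a, p a = c (qt a) *m p' a) -> dnz p -> dnz p'.
Proof. by move=> pE [a na]; exists a; apply: contra na => /eqP e; rewrite pE e mulmx0. Qed.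

Definition C0 N M := {dffun forall v : qV Q, 'M[F]_(rdim N v, rdim M v)}.
Definition C1 N M := {dffun forall a : qA Q, 'M[F]_(rdim M (qt a), rdim N (qs a))}.
(** [hom] and [dext] are records over dependent functions and cannot be counted directly; [Hm] and
    [Zm] are their finite versions, with conversions [hm], [mh], [zm], [mz]. *)
Definition Hm N M := {f : C0 N M | homb f}.
Definition Zm N M := {p : C1 N M | [forall g : C0 N M, zpair g p == 0]}.

Lemma hom_of_Hm_subproof N M (f : Hm N M) : @is_hom Q F N M (sval f).
Proof. by move=> a; apply/eqP; apply: (forallP (svalP f)). Qed.
Definition hm N M (f : Hm N M) : hom N M := Hom (hom_of_Hm_subproof f).

Lemma Hm_of_hom_subproof N M (f : hom N M) : @homb Q F N M [ffun v => f v].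
Proof. by apply/forallP => a; rewrite !ffunE homE. Qed.
Definition mh N M (f : hom N M) : Hm N M := Sub (_ : C0 N M) (Hm_of_hom_subproof f).

Lemma hmK N M (f : hom N M) v : hm (mh f) v = f v.
Proof. by rewrite /= ffunE. Qed.
Lemma hm_inj N M (f g : Hm N M) : (forall v, hm f v = hm g v) -> f = g.
Proof. by move=> e; apply/val_inj/ffunP => v; apply: e. Qed.
Lemma mh_eq N M (f g : hom N M) : mh f = mh g -> forall v, f v = g v.
Proof. by move=> e v; rewrite -(hmK f) e hmK. Qed.

Lemma zpair_ffun N M (g : forall v, 'M[F]_(rdim N v, rdim M v)) p :
  zpair [ffun v => g v] p = zpair g p.
Proof. by apply: eq_bigr => a _; rewrite !ffunE. Qed.
Lemma zpair_ffunr N M g (p : forall a, 'M[F]_(rdim M (qt a), rdim N (qs a))) :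
  zpair g [ffun a => p a] = zpair g p.
Proof. by apply: eq_bigr => a _; rewrite !ffunE. Qed.

Lemma dext_of_Zm_subproof N M (p : Zm N M) g : zpair g (sval p) = 0.
Proof. by rewrite -zpair_ffun; apply/eqP; apply: (forallP (svalP p) [ffun v => g v]). Qed.
Definition zm N M (p : Zm N M) : dext N M := Dext (dext_of_Zm_subproof p).
Lemma Zm_of_dext_subproof N M (p : dext N M) :
  [forall g : C0 N M, zpair g [ffun a => p a] == 0].
Proof. by apply/forallP => g; rewrite zpair_ffunr dP. Qed.
Definition mz N M (p : dext N M) : Zm N M := Sub (_ : C1 N M) (Zm_of_dext_subproof p).
Lemma zmK N M (p : dext N M) a : zm (mz p) a = p a.
Proof. by rewrite /= ffunE. Qed.
Lemma zm_inj N M (f g : Zm N M) : (forall a, zm f a = zm g a) -> f = g.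
Proof. by move=> e; apply/val_inj/ffunP => v; apply: e. Qed.
Lemma mz_eq N M (f g : dext N M) : mz f = mz g -> forall a, f a = g a.
Proof. by move=> e v; rewrite -(zmK f) e zmK. Qed.

Definition h N M := #|{: Hm N M}|.
Definition z N M := #|{: Zm N M}|.

Lemma hE N M : h N M = #|[set f : C0 N M | homb f]|.
Proof. by rewrite /h card_sig cardsE. Qed.
Lemma zE N M : z N M = #|[set p : C1 N M | [forall g : C0 N M, zpair g p == 0]]|.
Proof. by rewrite /z card_sig cardsE. Qed.

Lemma zpairDl N M (g g' : forall v, 'M[F]_(rdim N v, rdim M v)) p c :
  zpair (fun v => g v + c *: g' v) p = zpair g p + c * zpair g' p.
Proof.
rewrite /zpair big_distrr -big_split /=; apply: eq_bigr => a _.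
rewrite -mxtraceZ -mxtraceD scalemxAl -mulmxDl; congr (\tr (_ *m _)).
by rewrite mulmxDr mulmxDl -scalemxAr -scalemxAl scalerBr opprD addrACA.
Qed.
Lemma zpairDr N M (g : forall v, 'M[F]_(rdim N v, rdim M v)) p p' c :
  zpair g (fun a => p a + c *: p' a) = zpair g p + c * zpair g p'.
Proof.
rewrite /zpair big_distrr -big_split /=; apply: eq_bigr => a _.
by rewrite -mxtraceZ -mxtraceD scalemxAr -mulmxDr.
Qed.

Lemma zpair_hom N M (g : forall v, 'M[F]_(rdim N v, rdim M v)) :
  (forall p, zpair g p = 0) <-> @is_hom Q F N M g.
Proof.
split=> [h0|hg p]; last by rewrite /zpair big1 // => a _; rewrite hg subrr mul0mx mxtrace0.
move=> a; apply/eqP; rewrite -subr_eq0; apply/eqP; apply: trace_nondeg => B.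
(* The test cochain is supported at the arrow [a] with value [B], transported along a = b because
   its type depends on the arrow. *)
have := h0 (fun b => match a =P b with
  | ReflectT e => match e in _ = b return 'M[F]_(rdim M (qt b), rdim N (qs b)) with erefl => B end
  | _ => 0 end).
rewrite /zpair (bigD1 a) //= big1 => [|b /eqP ba].
  by rewrite addr0; case: eqP => // e; rewrite (eq_axiomK e).
by case: eqP => [e|_]; [case: ba | rewrite mulmx0 mxtrace0].
Qed.

(** [h] and [z] count the left and right kernels of [zpair], so [double_count] compares them with
    the two cochain spaces, whose dimensions are the exponents. *)
Lemma euler_card N M :
  (h N M * #|F| ^ (\sum_a rdim N (qs a) * rdim M (qt a)) =
   z N M * #|F| ^ (\sum_v rdim N v * rdim M v))%N.
Proof.
rewrite -(card_matfam F (fun v => rdim N v)).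
have -> : (\sum_a rdim N (qs a) * rdim M (qt a) = \sum_a rdim M (qt a) * rdim N (qs a))%N.
  by apply: eq_bigr => a _; rewrite mulnC.
rewrite -(card_matfam F (fun a => rdim M (qt a))).
rewrite hE zE.
apply: (double_count (b := fun (g : C0 N M) (p : C1 N M) => zpair g p)).
- by move=> g; rewrite inE => /forallP hg p; apply: (zpair_hom _).2 => a; apply/eqP; apply: hg.
- by move=> p; rewrite inE => /forallP hp g; apply/eqP.
- move=> g; rewrite inE => nh.
  have [p0 n0] : exists p, zpair g p <> 0.
    apply: NNPP => nex; move/negP: nh; apply.
    apply/forallP => a; apply/eqP; apply: (zpair_hom _).1 => p.
    by apply: NNPP => np; apply: nex; exists p.
  pose s c (p : C1 N M) : C1 N M := [ffun a => p a + c *: ((zpair g p0)^-1 *: p0 a)].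
  have gp0 : zpair g (fun a => (zpair g p0)^-1 *: p0 a) = 1.
    transitivity (zpair g (fun a => 0 + (zpair g p0)^-1 *: p0 a)).
      by apply: eq_bigr => a _; rewrite add0r.
    rewrite (zpairDr g (fun=> 0)) mulVf ?n0 //; last exact/eqP.
    by rewrite /zpair big1 ?add0r // => a _; rewrite mulmx0 mxtrace0.
  apply: (card_shift (s := s)) => c p; first by rewrite zpair_ffunr zpairDr gp0 mulr1.
  by apply/ffunP => a; rewrite !ffunE scaleNr subrK.
- move=> p; rewrite inE => /forallPn[g0 n0].
  pose s c (g : C0 N M) : C0 N M := [ffun v => g v + c *: ((zpair g0 p)^-1 *: g0 v)].
  have gp0 : zpair (fun v => (zpair g0 p)^-1 *: g0 v) p = 1.
    transitivity (zpair (fun v => 0 + (zpair g0 p)^-1 *: g0 v) p).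
      by apply: eq_bigr => a _; rewrite !add0r.
    rewrite (zpairDl (fun=> 0)) mulVf // /zpair big1 ?add0r // => a _.
    by rewrite mulmx0 mul0mx subr0 mul0mx mxtrace0.
  apply: (card_shift (s := s)) => c g; first by rewrite zpair_ffun zpairDl gp0 mulr1.
  by apply/ffunP => v; rewrite !ffunE scaleNr subrK.
Qed.

End Dext.

Lemma swap_sub (V : zmodType) (x y x0 y0 : V) : x - y = x0 - y0 -> x - x0 = y - y0.
Proof.
move/eqP; rewrite subr_eq => /eqP ->.
by rewrite addrC !addrA addNr add0r addrC.
Qed.

Section Dext2.
Variables (Q : quiver) (F : finFieldType).
Implicit Types (A B C D K M N X Y Z E : rep Q F) (v : qV Q) (a : qA Q).

Lemma dcompr_subproof N M E (p : dext N M) (u : hom N E) g :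
  zpair g (fun a => p a *m u (qs a)) = 0.
Proof.
rewrite -[RHS](dP p (fun v => u v *m g v)); apply: eq_bigr => a _.
rewrite !mulmxA [LHS]mxtrace_mulC !mulmxA; congr (\tr (_ *m _)).
by rewrite mulmxBr !mulmxA homE.
Qed.
(** Dualizing makes Ext(-, M) covariant, so [p] is pushed forward along [u]; in the second argument
    [dcompl] pulls it back. *)
Definition dcompr N M E (p : dext N M) (u : hom N E) : dext E M := Dext (dcompr_subproof p u).

Lemma dcompl_subproof N M E (p : dext N M) (u : hom E M) g :
  zpair g (fun a => u (qt a) *m p a) = 0.
Proof.
rewrite -[RHS](dP p (fun v => g v *m u v)); apply: eq_bigr => a _.
rewrite mulmxA mulmxBl; congr (\tr ((_ - _) *m _)); first by rewrite -mulmxA.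
by rewrite -!mulmxA homE.
Qed.
Definition dcompl N M E (p : dext N M) (u : hom E M) : dext N E := Dext (dcompl_subproof p u).

Lemma dcompr_eq N M E (p : dext N M) (f g : hom N E) :
  (forall a, dcompr p f a = dcompr p g a) -> forall a, p a *m hsub f g (qs a) = 0.
Proof. by move=> e a; rewrite hsubE mulmxBr; apply/eqP; rewrite subr_eq0; apply/eqP/e. Qed.
Lemma dcompl_eq N M E (p : dext N M) (f g : hom E M) :
  (forall a, dcompl p f a = dcompl p g a) -> forall a, hsub f g (qt a) *m p a = 0.
Proof. by move=> e a; rewrite hsubE mulmxBl; apply/eqP; rewrite subr_eq0; apply/eqP/e. Qed.

(** A test cochain on K is extended to N along vertexwise retractions [r] of [k], which need not
    form a morphism: as [p] takes values in the image of [k], the pairing sees only the restriction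
    to K. *)
Lemma dext_ker N M K (p : dext N M) (k : hom K N) : mono k ->
  (forall a, (p a <= k (qs a))%MS) ->
  exists p' : dext K M, forall a, p a = p' a *m k (qs a).
Proof.
move=> mk pk.
have [f fE] : exists f : forall a, 'M[F]_(rdim M (qt a), rdim K (qs a)),
    forall a, p a = f a *m k (qs a).
  by exists (fun a => p a *m pinvmx (k (qs a))) => a; rewrite mulmxKpV.
have [r kr] : exists r : forall v, 'M[F]_(rdim N v, rdim K v), forall v, k v *m r v = 1%:M.
  by exists (fun v => pinvmx (k v)) => v; rewrite mulmxVp.
have fP g : zpair g f = 0.
  rewrite -[RHS](dP p (fun v => r v *m g v)); apply: eq_bigr => a _.
  rewrite fE !mulmxA [RHS]mxtrace_mulC !mulmxA; congr (\tr (_ *m _)).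
  by rewrite mulmxBr !mulmxA -homE kr mul1mx -(mulmxA _ _ (r _)) kr mulmx1.
by exists (Dext fP).
Qed.

Lemma dext_coker N M C (p : dext N M) (c : hom M C) : epi c ->
  (forall a, (kermx (c (qt a)) <= kermx (p a))%MS) ->
  exists p' : dext N C, forall a, p a = c (qt a) *m p' a.
Proof.
move=> ec pc.
have [r rc] : exists r : forall v, 'M[F]_(rdim C v, rdim M v), forall v, r v *m c v = 1%:M.
  by exists (fun v => pinvmx (c v)) => v; rewrite mulVpmx.
have [f fE] : exists f : forall a, 'M[F]_(rdim C (qt a), rdim N (qs a)),
    forall a, p a = c (qt a) *m f a.
  exists (fun a => r (qt a) *m p a) => a.
  apply/eqP; rewrite -subr_eq0 mulmxA -[X in X - _]mul1mx -mulmxBl; apply/eqP.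
  apply/sub_kermxP; apply: submx_trans (pc a); apply/sub_kermxP.
  by rewrite mulmxBl mul1mx -mulmxA rc mulmx1 subrr.
have fP g : zpair g f = 0.
  rewrite -[RHS](dP p (fun v => g v *m r v)); apply: eq_bigr => a _.
  rewrite fE mulmxA [in RHS]mulmxA; congr (\tr (_ *m _)).
  by rewrite mulmxBl -!mulmxA rc mulmx1 homE (mulmxA (r _)) rc mul1mx.
by exists (Dext fP).
Qed.

Lemma dcompr_ker N M E (p : dext N M) (u : hom N E) K (k : hom K N) :
  mono k -> (forall v, (k v :=: kermx (u v))%MS) ->
  (forall a, p a *m u (qs a) = 0) ->
  exists p' : dext K M, forall a, p a = p' a *m k (qs a).
Proof. by move=> mk ku p0; apply: dext_ker => // a; rewrite ku; apply/sub_kermxP. Qed.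

Lemma dcompl_coker N M E (p : dext N M) (u : hom E M) C (c : hom M C) :
  epi c -> (forall v, (kermx (c v) :=: u v)%MS) ->
  (forall a, u (qt a) *m p a = 0) ->
  exists p' : dext N C, forall a, p a = c (qt a) *m p' a.
Proof. by move=> ec cu p0; apply: dext_coker => // a; rewrite cu; apply/sub_kermxP. Qed.

Lemma hh_le N M N' M' (G : hom N M -> hom N' M') :
  (forall f g, (forall v, G f v = G g v) -> forall v, f v = g v) -> (h N M <= h N' M')%N.
Proof.
move=> Gi; apply: (leq_card (fun f => mh (G (hm f)))) => f g /mh_eq e.
exact/hm_inj/Gi.
Qed.
Lemma hz_le N M N' M' (G : hom N M -> dext N' M') :
  (forall f g, (forall a, G f a = G g a) -> forall v, f v = g v) -> (h N M <= z N' M')%N.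
Proof.
move=> Gi; apply: (leq_card (fun f => mz (G (hm f)))) => f g /mz_eq e.
exact/hm_inj/Gi.
Qed.
Lemma zz_le N M N' M' (G : dext N M -> dext N' M') :
  (forall f g, (forall a, G f a = G g a) -> forall a, f a = g a) -> (z N M <= z N' M')%N.
Proof.
move=> Gi; apply: (leq_card (fun f => mz (G (zm f)))) => f g /mz_eq e.
exact/zm_inj/Gi.
Qed.
Lemma hhh_le A B C D N M (G : hom A B -> hom C D -> hom N M) :
  (forall f g f' g', (forall v, G f g v = G f' g' v) ->
     (forall v, f v = f' v) /\ (forall v, g v = g' v)) -> (h A B * h C D <= h N M)%N.
Proof.
move=> Gi; rewrite /h -card_prod.
apply: (leq_card (fun p => mh (G (hm p.1) (hm p.2)))) => -[f g] [f' g'] /mh_eq /Gi /= [e e'].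
by congr (_, _); apply: hm_inj.
Qed.

Lemma h_le_factor M N X (G : hom M N -> hom M X) :
  (forall f g : hom M N, (forall v, f v = g v) -> forall v, G f v = G g v) ->
  (forall f : hom M X, exists f' : hom M N, forall v, G f' v = f v) -> (h M X <= h M N)%N.
Proof.
move=> Gext surj; apply: (@leq_trans #|(fun f => mh (G (hm f))) @: [set: Hm M N]|); last first.
  by apply: leq_trans (leq_imset_card _ _) _; rewrite cardsT.
rewrite /h -cardsT; apply: subset_leq_card; apply/subsetP => g _.
have [f' f'E] := surj (hm g).
apply/imsetP; exists (mh f') => //; apply: hm_inj => v; rewrite hmK -f'E.
by apply: Gext => u; rewrite hmK.
Qed.

Lemma h_gt0 N M : (0 < h N M)%N.
Proof. by apply/card_gt0P; exists (mh (hzero N M)). Qed.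

Lemma h_gt1 N M (f : hom N M) : hnz f -> (1 < h N M)%N.
Proof.
case=> v fv; apply/card_gt1P; exists (mh f), (mh (hzero N M)); split=> //.
by apply: contra fv => /eqP/mh_eq ->.
Qed.
Lemma h_gt1_ex N M : (1 < h N M)%N -> exists f : hom N M, hnz f.
Proof.
case/card_gt1P => f [g [_ _ fg]]; exists (hsub (hm f) (hm g)).
apply: NNPP => /hnzPn e; move/eqP: fg; apply; apply: hm_inj => v.
by apply/eqP; rewrite -subr_eq0 -hsubE e.
Qed.

Lemma dzero_subproof N M (g : forall v, 'M[F]_(rdim N v, rdim M v)) : zpair g (fun=> 0) = 0.
Proof. by rewrite /zpair big1 // => a _; rewrite mulmx0 mxtrace0. Qed.
Definition dzero N M : dext N M := Dext (@dzero_subproof N M).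
Lemma dsub_subproof N M (p q : dext N M) g : zpair g (fun a => p a + -1 *: q a) = 0.
Proof. by rewrite zpairDr !dP mulr0 addr0. Qed.
Definition dsubt N M (p q : dext N M) : dext N M := Dext (dsub_subproof p q).

Lemma z_gt0 N M : (0 < z N M)%N.
Proof. by apply/card_gt0P; exists (mz (dzero N M)). Qed.
Lemma z_gt1 N M (p : dext N M) : dnz p -> (1 < z N M)%N.
Proof.
case=> v fv; apply/card_gt1P; exists (mz p), (mz (dzero N M)); split=> //.
by apply: contra fv => /eqP/mz_eq ->.
Qed.
Lemma z_gt1_ex N M : (1 < z N M)%N -> exists p : dext N M, dnz p.
Proof.
case/card_gt1P => f [g [_ _ fg]]; exists (dsubt (zm f) (zm g)).
apply: NNPP => /dnzPn e; move/eqP: fg; apply; apply: zm_inj => v.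
by apply/eqP; rewrite -subr_eq0 -[X in _ + X]scaleN1r; apply/eqP/e.
Qed.
Lemma z_le1 N M : (forall f : dext N M, ~ dnz f) -> z N M = 1%N.
Proof.
move=> n; apply/eqP; rewrite eqn_leq z_gt0 andbT leqNgt; apply/negP => /z_gt1_ex[f].
exact: n.
Qed.

Definition eu M N : int := euler (ivec (rdim M)) (ivec (rdim N)).
Local Notation q := (#|F|%:R : rat).

Lemma q_gt1 : 1 < q.
Proof. by rewrite ltr1n card_finNzRing_gt1. Qed.
Lemma q_gt0 : 0 < q.
Proof. exact: lt_trans q_gt1. Qed.

Lemma euler_rat N M : (h N M)%:R = (z N M)%:R * q ^ (eu N M) :> rat.
Proof.
have := congr1 (fun n => n%:R : rat) (euler_card N M).
rewrite !natrM !natrX; set A := (\sum_a _)%N; set V := (\sum_v _)%N => e.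
have -> : eu N M = V%:Z - A%:Z.
  rewrite /eu /euler /ivec /A /V !(big_morph _ PoszD (erefl _)).
  by congr (_ - _); apply: eq_bigr => *; rewrite PoszM.
have q0 : q != 0 by rewrite lt0r_neq0 // q_gt0.
by rewrite expfzDr // -invr_expz -!exprnP mulrA -e mulfK // expf_neq0.
Qed.

Lemma eu_ge0 N M : z N M = 1%N -> 0 <= eu N M.
Proof.
move=> z1; have := euler_rat N M; rewrite z1 mul1r => e.
by rewrite -(ler_eXz2l q_gt1) expr0z -e ler1n h_gt0.
Qed.

Lemma eu_addl X A B Y : (forall v, rdim X v = rdim A v + rdim B v)%N ->
  eu X Y = eu A Y + eu B Y.
Proof.
move=> e; rewrite /eu /euler /ivec addrACA -opprD -!big_split /=.
by congr (_ - _); apply: eq_bigr => x _; rewrite e PoszD mulrDl.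
Qed.
Lemma eu_addr X A B Y : (forall v, rdim X v = rdim A v + rdim B v)%N ->
  eu Y X = eu Y A + eu Y B.
Proof.
move=> e; rewrite /eu /euler /ivec addrACA -opprD -!big_split /=.
by congr (_ - _); apply: eq_bigr => x _; rewrite e PoszD mulrDr.
Qed.
Lemma eu_mul_l X Y Z n : (forall v, rdim X v = n * rdim Y v)%N -> eu X Z = n%:Z * eu Y Z.
Proof.
move=> e; rewrite /eu /euler /ivec mulrBr !big_distrr /=.
by congr (_ - _); apply: eq_bigr => x _; rewrite e PoszM mulrA.
Qed.
Lemma eu_mul_r X Y Z n : (forall v, rdim X v = n * rdim Y v)%N -> eu Z X = n%:Z * eu Z Y.
Proof.
move=> e; rewrite /eu /euler /ivec mulrBr !big_distrr /=.
by congr (_ - _); apply: eq_bigr => x _; rewrite e PoszM mulrCA.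
Qed.
Lemma eu_eq X X' Y Y' : rdim X =1 rdim X' -> rdim Y =1 rdim Y' -> eu X Y = eu X' Y'.
Proof.
move=> e e'; rewrite /eu /euler /ivec.
by congr (_ - _); apply: eq_bigr => x _; rewrite e e'.
Qed.

(* If [z C K = 1], counting shows that every cocycle is a coboundary. *)
Lemma dext_split K X C (k : hom K X) (c : hom X C) : ses k c ->
  (forall p : dext C K, ~ dnz p) -> exists s : hom C X, forall v, s v *m c v = 1%:M.
Proof.
move=> S nz; have [mk ec kc] := S.
pose D := {dffun forall a : qA Q, 'M[F]_(rdim C (qs a), rdim K (qt a))}.
pose d (g : C0 C K) : D := [ffun a => rmap C a *m g (qt a) - g (qs a) *m rmap K a].
have dsurj : forall y, exists g, d g = y.
  apply: (@card_fiber_surj _ _ d (h C K)); last exact: h_gt0.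
    apply: (fiber_cover (g := fun (g0 : C0 C K) (t : Hm C K) => [ffun v => g0 v + hm t v] : C0 C K)) => g g0 /ffunP gy.
    have ht : @is_hom Q F C K (fun v => g v - g0 v).
      by move=> a; have := gy a; rewrite !ffunE mulmxBr mulmxBl => /swap_sub.
    by exists (mh (Hom ht)); apply/ffunP => v; rewrite ffunE hmK addrC subrK.
  have := euler_card C K; rewrite (z_le1 nz) mul1n => e.
  rewrite (card_matfam F (fun a => rdim C (qs a))) e.
  by rewrite (card_matfam F (fun v => rdim C v)).
have [s sc] : exists s : forall v, 'M[F]_(rdim C v, rdim X v), forall v, s v *m c v = 1%:M.
  by exists (fun v => pinvmx (c v)) => v; rewrite mulVpmx.
(* [w] measures how far the vertexwise section [s] is from being a morphism; writing it as a
   coboundary corrects [s]. *)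
have [w wE] : exists w : forall a, 'M[F]_(rdim C (qs a), rdim K (qt a)),
    forall a, s (qs a) *m rmap X a - rmap C a *m s (qt a) = w a *m k (qt a).
  exists (fun a => (s (qs a) *m rmap X a - rmap C a *m s (qt a)) *m pinvmx (k (qt a))) => a.
  rewrite mulmxKpV // -kc; apply/sub_kermxP.
  by rewrite mulmxBl -!mulmxA sc mulmx1 homE mulmxA sc mul1mx subrr.
have [g gw] := dsurj [ffun a => w a].
have hs : @is_hom Q F C X (fun v => s v + g v *m k v).
  move=> a; have /ffunP/(_ a) := gw; rewrite !ffunE => gwa.
  have sX : s (qs a) *m rmap X a = rmap C a *m s (qt a) + w a *m k (qt a).
    by rewrite -wE addrC subrK.
  by rewrite mulmxDl sX -(mulmxA (g _)) -homE -gwa mulmxBl mulmxDr !mulmxA -addrA subrK.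
exists (Hom hs) => v /=; rewrite mulmxDl sc -mulmxA (ses0 S) mulmx0 addr0 //.
Qed.

Lemma sec_ret K X C (k : hom K X) (c : hom X C) (s : hom C X) : ses k c ->
  (forall v, s v *m c v = 1%:M) -> exists2 r : hom X K, forall v, k v *m r v = 1%:M & forall v, s v *m r v = 0.
Proof.
move=> S sc; have [mk ec kc] := S.
have [r rE] : exists r : hom X K, forall v, r v *m k v = hsub (hid X) (hcomp c s) v.
  apply: (ses_fac S) => v; rewrite hsubE /= mulmxBl mul1mx -mulmxA sc mulmx1.
  exact: subrr.
exists r => v; apply: (free_inj (mk v)).
  by rewrite -mulmxA rE hsubE /= mulmxBr mulmxA (ses0 S) mul0mx subr0 mulmx1 mul1mx.
by rewrite -mulmxA rE hsubE /= mulmxBr mulmx1 mulmxA sc mul1mx subrr mul0mx.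
Qed.

Lemma res_fiber K X C (k : hom K X) (c : hom X C) Y : ses k c -> forall y : Hm K Y,
  (#|[set x : Hm X Y | mh (hcomp k (hm x)) == y]| <= h C Y)%N.
Proof.
move=> S; apply: (fiber_cover (g := fun f0 t => mh (hadd (hm f0) (hcomp c (hm t))))) => f f0 /mh_eq fy.
have [|t tE] := ses_cofac (g := hsub (hm f) (hm f0)) S.
  by move=> v; rewrite hsubE mulmxBr; apply/eqP; rewrite subr_eq0; apply/eqP/fy.
exists (mh t); apply: hm_inj => v; rewrite hmK.
change (hm f v = hm f0 v + c v *m hm (mh t) v).
by rewrite hmK tE hsubE addrC subrK.
Qed.

Lemma ret_sec K X C (k : hom K X) (c : hom X C) (r : hom X K) : ses k c ->
  (forall v, k v *m r v = 1%:M) -> exists s : hom C X, forall v, s v *m c v = 1%:M.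
Proof.
move=> S kr; have [mk ec kc] := S.
have [s sE] : exists s : hom C X, forall v, c v *m s v = hsub (hid X) (hcomp r k) v.
  apply: (ses_cofac S) => v; rewrite hsubE /= mulmxBr mulmx1 mulmxA kr mul1mx.
  exact: subrr.
exists s => v; apply: (full_inj (ec v)).
by rewrite mulmxA sE hsubE /= mulmxBl -mulmxA (ses0 S) mulmx0 subr0 mulmx1 mul1mx.
Qed.

(** A cocycle [w], concentrated on one arrow where [p] is nonzero, pairs nontrivially with [p]. The
    extension with off-diagonal block [w] cannot split: a section would make [w] a coboundary, on
    which [p] vanishes. *)
Lemma dext_nonsplit N M (p : dext N M) : dnz p ->
  exists X (k : hom M X) (c : hom X N), [/\ ses k c,
    (forall v, rdim X v = rdim M v + rdim N v)%N &
    ~ exists s : hom N X, forall v, s v *m c v = 1%:M].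
Proof.
case=> a0 pa0.
have [W /eqP nW] : exists W : 'M_(_, _), \tr (W *m p a0) <> 0.
  apply: NNPP => nex; move/eqP: pa0; apply; apply: trace_nondeg => W.
  by rewrite mxtrace_mulC; apply: NNPP => nW; apply: nex; exists W.
pose w a : 'M[F]_(rdim N (qs a), rdim M (qt a)) := match a0 =P a with
  | ReflectT e => match e in _ = b return 'M[F]_(rdim N (qs b), rdim M (qt b)) with erefl => W end
  | _ => 0 end.
have wp : \sum_a \tr (w a *m p a) != 0.
  rewrite (bigD1 a0) //= big1 => [|b /eqP ba].
    by rewrite addr0 /w; case: eqP => // e; rewrite (eq_axiomK e).
  by rewrite /w; case: eqP => [e|_]; [case: ba | rewrite mul0mx mxtrace0].
pose X : rep Q F := @Rep Q F (fun v => (rdim M v + rdim N v)%N)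
  (fun a => block_mx (rmap M a) 0 (w a) (rmap N a)).
have hk : @is_hom Q F M X (fun v => row_mx 1%:M 0).
  by move=> a /=; rewrite mul_row_block ?mul1mx ?mul0mx ?addr0 mul_mx_row mulmx1 mulmx0.
have hc : @is_hom Q F X N (fun v => col_mx 0 1%:M).
  by move=> a /=; rewrite mul_block_col mul_col_mx ?mulmx1 ?mul0mx ?mulmx0 ?add0r mul1mx.
exists X, (Hom hk), (Hom hc); split=> //.
  have mk : mono (Hom hk).
    by move=> v; apply/row_freeP; exists (col_mx 1%:M 0); rewrite /= mul_row_col mulmx1 mul0mx addr0.
  have ec : epi (Hom hc).
    by move=> v; apply/row_fullP; exists (row_mx 0 1%:M); rewrite /= mul_row_col mul0mx mulmx1 add0r.
  split=> // v; apply: eqmx_sym; apply/eqmxP.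
  apply/andP; split.
    by apply/sub_kermxP; rewrite /= mul_row_col mul0mx mulmx0 addr0.
  set y := kermx _; have y0 : y *m col_mx 0 1%:M = 0 by exact: mulmx_ker.
  have yr : rsubmx y = 0.
    by rewrite -y0 -[y in RHS]hsubmxK mul_row_col mulmx0 add0r mulmx1.
  rewrite -[y]hsubmxK yr; apply/submxP; exists (lsubmx y).
  by rewrite /= mul_mx_row mulmx1 mulmx0.
case=> s sc; have sr v : rsubmx (s v) = 1%:M.
  by rewrite -(sc v) -[s v in RHS]hsubmxK /= mul_row_col mulmx0 add0r mulmx1.
have wE a : w a = rmap N a *m lsubmx (s (qt a)) - lsubmx (s (qs a)) *m rmap M a.
  have := homE s a; rewrite -[s (qs a)]hsubmxK -[s (qt a)]hsubmxK !sr mul_mx_row mul_row_block.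
  rewrite mul1mx => /eq_row_mx[e _].
  by rewrite !row_mxKl e addrC addKr.
move/eqP: wp; apply; rewrite -[RHS](dP p (fun v => lsubmx (s v))).
by apply: eq_bigr => a _; rewrite -wE.
Qed.

End Dext2.

(** * Defect and stability *)

Section Defect.
Variables (Q : quiver) (F : finFieldType) (delta : qV Q -> nat).
Implicit Types (A B C D K M N S R X Y Z E : rep Q F) (v : qV Q) (a : qA Q).

Definition tdim M := (\sum_v rdim M v)%N.
Definition dfc M := defect delta M.

Lemma ex_max (P : nat -> Prop) b : (exists n, P n) -> (forall n, P n -> (n <= b)%N) ->
  exists2 n, P n & forall m, P m -> (m <= n)%N.
Proof.
elim: b => [|b IH] [n Pn] le; first by exists n => // m /le; rewrite leqn0 => /eqP ->.
case: (classic (P b.+1)) => [Pb|nP]; first by exists b.+1.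
apply: IH; first by exists n.
move=> m Pm; have := le m Pm; rewrite leq_eqVlt => /orP[/eqP e|//].
by case: nP; rewrite -e.
Qed.

Lemma tdim_ses K X C (k : hom K X) (c : hom X C) : ses k c -> tdim X = (tdim K + tdim C)%N.
Proof. by move=> S; rewrite /tdim -big_split; apply: eq_bigr => v _; exact: ses_dim S v. Qed.
Lemma tdim_gt0 M : nzero M -> (0 < tdim M)%N.
Proof.
case/nzeroP => v nv; rewrite lt0n; apply: contra nv.
by rewrite /tdim sum_nat_eq0 => /forallP/(_ v).
Qed.
Lemma tdim_mono K X (k : hom K X) : mono k -> (tdim K <= tdim X)%N.
Proof. by move=> mk; apply: leq_sum => v _; exact: mono_le mk v. Qed.
Lemma tdim_mono_lt K X (k : hom K X) : mono k -> ~ epi k -> (tdim K < tdim X)%N.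
Proof.
move=> mk ek; have [C [c S]] := ses_mono mk; rewrite (tdim_ses S) -addn1 leq_add2l.
apply: tdim_gt0 => zC; apply: ek; apply: (mono_epi mk) => v.
by rewrite (ses_dim S) zC addn0.
Qed.
Lemma tdim_ses_lt K X C (k : hom K X) (c : hom X C) : ses k c -> nzero K -> (tdim C < tdim X)%N.
Proof. by move=> S nK; rewrite (tdim_ses S) -[X in (X < _)%N]add0n ltn_add2r tdim_gt0. Qed.
Lemma tdim_eq M N : (forall v, rdim M v = rdim N v) -> tdim M = tdim N.
Proof. by move=> e; apply: eq_bigr. Qed.

Lemma zero_ses_l K X C (k : hom K X) (c : hom X C) : ses k c -> is_zero K -> mono c.
Proof.
move=> S zK; case: (S) => mk ec kc.
by apply: (epi_mono ec) => v; rewrite (ses_dim S) zK.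
Qed.
Lemma zero_ses_r K X C (k : hom K X) (c : hom X C) : ses k c -> is_zero C -> epi k.
Proof.
move=> S zC; case: (S) => mk ec kc.
by apply: (mono_epi mk) => v; rewrite (ses_dim S) zC addn0.
Qed.

Lemma mono_zero (N : rep Q F) : mono (hzero (zero_rep Q F) N).
Proof. by move=> v; rewrite /row_free mxrank0. Qed.

Lemma not_mono_ker X Y (f : hom X Y) : ~ mono f ->
  exists K (k : hom K X), [/\ mono k, nzero K, (forall v, (k v :=: kermx (f v))%MS) &
   forall v, k v *m f v = 0].
Proof.
move=> nf; have [K [k mk kf]] := hker_ex f; exists K, k.
have kf0 v : k v *m f v = 0 by apply/sub_kermxP; rewrite kf.
split=> // zK; apply: nf => v; rewrite -kermx_eq0 -submx0 -kf.
by rewrite submx0 -mxrank_eq0 (mono_rank mk) zK.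
Qed.

Lemma hnz_ker_tdim X Y (f : hom X Y) K (k : hom K X) : hnz f -> mono k ->
  (forall v, k v *m f v = 0) -> (tdim K < tdim X)%N.
Proof.
move=> [v0 fv] mk kf; apply: (tdim_mono_lt mk) => ek.
by move/eqP: fv; apply; apply: (full_inj (ek v0)); rewrite kf mulmx0.
Qed.

(** [R] is the preimage of N under [c], realized as the kernel of the composite from X to C / N. *)
Lemma preim_ex K X C (k : hom K X) (c : hom X C) N (j : hom N C) : ses k c -> mono j ->
  exists R (r : hom R X) (pi : hom R N) (i : hom K R),
  [/\ ses i pi, mono r, (forall v, r v *m c v = pi v *m j v) &
   forall v, i v *m r v = k v].
Proof.
move=> S mj; have [mk ec kc] := S.
have [D [d Sd]] := ses_mono mj; have [_ ed _] := Sd.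
have [R [r Sr]] := ses_epi (epi_comp ec ed); have [mr _ _] := Sr.
have [pi piE] : exists pi : hom R N, forall v, pi v *m j v = hcomp r c v.
  by apply: (ses_fac Sd) => v /=; rewrite -mulmxA; exact: (ses0 Sr v).
have [i iE] : exists i : hom K R, forall v, i v *m r v = k v.
  by apply: (ses_fac Sr) => v /=; rewrite mulmxA (ses0 S) mul0mx.
have ker v : (kermx (pi v) :=: i v)%MS.
  apply/eqmxP/andP; split.
    set y := kermx _; have : (y *m r v <= k v)%MS.
      rewrite -kc; apply/sub_kermxP; rewrite -mulmxA -[r v *m _]piE mulmxA mulmx_ker.
      exact: mul0mx.
    case/submxP => w; rewrite -iE mulmxA => /(free_inj (mr v)) ->.
    exact: submxMl.
  apply/sub_kermxP; apply: (free_inj (mj v)).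
  by rewrite -mulmxA piE /= mulmxA iE (ses0 S) mul0mx.
have mi : mono i by move=> v; apply: (@free_mull _ _ _ _ _ (r v)); rewrite iE.
exists R, r, pi, i; split=> //; split=> // v.
rewrite /row_full; apply/eqP.
have := mxrank_ker (pi v); rewrite ker (mono_rank mi).
have := ses_dim Sr v; have := ses_dim Sd v; have := ses_dim S v.
by have := rank_leq_row (pi v); lia.
Qed.

Section Rad.
Hypothesis rad : forall v, cartan (ivec delta) (evec v) = 0.

Lemma euler_lin_r (d x : qV Q -> int) : euler d x = \sum_v x v * euler d (evec v).
Proof.
rewrite /euler /evec; under [RHS]eq_bigr => v _ do rewrite mulrBr !big_distrr /=.
rewrite sumrB; congr (_ - _).
  apply: eq_bigr => v _; rewrite (bigD1 v) //= big1 ?addr0 ?eqxx ?mulr1 1?mulrC //.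
  by move=> w /negPf ->; rewrite mulr0 mulr0.
rewrite exchange_big; apply: eq_bigr => a _.
rewrite (bigD1 (qt a)) //= big1 ?addr0 ?eqxx ?mulr1 1?mulrC //.
by move=> w wv; rewrite eq_sym (negPf wv) !mulr0.
Qed.
Lemma euler_lin_l (d x : qV Q -> int) : euler x d = \sum_v x v * euler (evec v) d.
Proof.
rewrite /euler /evec; under [RHS]eq_bigr => v _ do rewrite mulrBr !big_distrr /=.
rewrite sumrB; congr (_ - _).
  apply: eq_bigr => v _; rewrite (bigD1 v) //= big1 ?addr0 ?eqxx ?mul1r //.
  by move=> w /negPf ->; rewrite mul0r mulr0.
rewrite exchange_big; apply: eq_bigr => a _.
rewrite (bigD1 (qs a)) //= big1 ?addr0 ?eqxx ?mul1r //.
by move=> w wv; rewrite eq_sym (negPf wv) mul0r mulr0.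
Qed.

Lemma cartan_rad (x : qV Q -> int) : euler x (ivec delta) = - euler (ivec delta) x.
Proof.
apply/eqP; rewrite -addr_eq0 (euler_lin_l (ivec delta)) (euler_lin_r (ivec delta)).
rewrite -big_split /= big1 // => v _.
by rewrite -mulrDr addrC; have := rad v; rewrite /cartan => ->; rewrite mulr0.
Qed.

(* Only the dimension vector matters: [Erep d] carries [d] as an argument of [eu]. *)
Definition Erep (d : qV Q -> nat) : rep Q F := @Rep Q F d (fun=> 0).

Lemma eu_Erep_l X : eu (Erep delta) X = dfc X. Proof. by []. Qed.
Lemma eu_Erep_r X : eu X (Erep delta) = - dfc X.
Proof. exact: cartan_rad. Qed.

Lemma dfc_ses K X C (k : hom K X) (c : hom X C) : ses k c -> dfc X = dfc K + dfc C.
Proof. by move=> S; rewrite -!eu_Erep_l; apply: eu_addr => v; exact: ses_dim S v. Qed.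
Lemma dfc_eq M N : (forall v, rdim M v = rdim N v) -> dfc M = dfc N.
Proof. by move=> e; rewrite -!eu_Erep_l; apply: eu_eq. Qed.
Lemma dfc_zero M : is_zero M -> dfc M = 0.
Proof.
move=> zM; rewrite /dfc /defect /euler /ivec !big1 ?subr0 // => v _.
  by rewrite zM mulr0.
by rewrite zM mulr0.
Qed.
Lemma dfc_dsum M N : dfc (dsum M N) = dfc M + dfc N.
Proof. by rewrite -!eu_Erep_l; apply: eu_addr. Qed.

Local Notation q := (#|F|%:R : rat).

Lemma hh_zz A B C D : (h A B * h C D)%:R = (z A B * z C D)%:R * q ^ (eu A B + eu C D) :> rat.
Proof.
rewrite !natrM !euler_rat (expfzDr (eu A B)) ?lt0r_neq0 ?q_gt0 //.
by rewrite mulrACA.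
Qed.

Lemma eu_le0 A B C D : (h A B * h C D <= z A B * z C D)%N -> eu A B + eu C D <= 0.
Proof.
rewrite -(ler_nat rat) hh_zz ger_pMr; last by rewrite ltr0n muln_gt0 !z_gt0.
by rewrite -(expr0z q) ler_eXz2l // q_gt1.
Qed.
Lemma eu_eq0 A B C D : eu A B + eu C D = 0 -> (h A B * h C D = z A B * z C D)%N.
Proof.
by move=> e; apply/eqP; rewrite -(eqr_nat rat) hh_zz e expr0z mulr1.
Qed.

(* A minimal pair with nonzero Ext satisfies a numerical form of M = tau N. *)
Lemma dext_min N0 M0 (p : dext N0 M0) : dnz p ->
  exists N M (k : hom N N0) (c : hom M0 M),
  [/\ mono k, epi c, nzero N, nzero M & forall E, eu N E + eu E M <= 0].
Proof.
move: {2}(tdim N0 + tdim M0).+1 (ltnSn (tdim N0 + tdim M0)) => n.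
elim: n N0 M0 p => // n IH N0 M0 p; rewrite ltnS => len np.
(* If a nonzero [u] annihilates [p], then [p] comes from the kernel of [u], which gives a smaller
   pair; the dual case follows below. *)
case: (classic (exists E (u : hom N0 E), hnz u /\ forall a, p a *m u (qs a) = 0)).
  case=> E [u [nu pu]]; have [K [k mk ku]] := hker_ex u.
  have ku0 v : k v *m u v = 0 by apply/sub_kermxP; rewrite ku.
  have [p' pE] := dcompr_ker mk ku pu.
  have np' := dnz_facr pE np.
  have ltK := hnz_ker_tdim nu mk ku0.
  have [|N [M [k' [c [mk' ec nN nM eN]]]]] := IH _ _ p' _ np'.
    by apply: leq_trans len; rewrite ltn_add2r.
  by exists N, M, (hcomp k' k), c; split=> //; apply: mono_comp.
move=> nr.
case: (classic (exists E (u : hom E M0), hnz u /\ forall a, u (qt a) *m p a = 0)).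
  case=> E [u [nu pu]]; have [C [c ec cu]] := hcok_ex u.
  have [p' pE] := dcompl_coker ec cu pu.
  have np' := dnz_facl pE np.
  have [K [k S]] := ses_epi ec.
  have ltC : (tdim C < tdim M0)%N.
    apply: (tdim_ses_lt S) => zK.
    have mc := zero_ses_l S zK; case: nu => v /eqP; apply.
    by apply: (free_inj (mc v)); rewrite mul0mx; apply/sub_kermxP; rewrite cu.
  have [|N [M [k' [c' [mk' ec' nN nM eN]]]]] := IH _ _ p' _ np'.
    by apply: leq_trans len; rewrite ltn_add2l.
  by exists N, M, k', (hcomp c c'); split=> //; apply: epi_comp.
move=> nl.
exists N0, M0, (hid N0), (hid M0).
split; [exact: mono_hid | exact: epi_hid | exact: dnz_src np | exact: dnz_tgt np | ].
(* Both actions on [p] are injective here, so h N0 E <= z E M0 and h E M0 <= z N0 E; multiplying the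
   two gives the bound. *)
move=> E; apply: eu_le0; rewrite [leqRHS]mulnC; apply: leq_mul.
  apply: (hz_le (G := fun u => dcompr p u)) => f g e v.
  apply: (hom_eq _ v) => nf; apply: nr.
  by exists E, (hsub f g); split=> //; exact: dcompr_eq.
apply: (hz_le (G := fun u => dcompl p u)) => f g e v.
apply: (hom_eq _ v) => nf; apply: nl.
by exists E, (hsub f g); split=> //; exact: dcompl_eq.
Qed.

(** A minimal pair tested on a module of dimension [delta] satisfies dfc M1 <= dfc N1, because the
    Euler forms with [delta] on the two sides are opposite. *)
Lemma dext_vanish N M :
  (forall N1 (k : hom N1 N) M1 (c : hom M M1), mono k -> epi c -> nzero N1 -> nzero M1 ->
     dfc N1 < dfc M1) ->
  forall p : dext N M, ~ dnz p.
Proof.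
move=> lt p /dext_min[N1 [M1 [k [c [mk ec nN nM /(_ (Erep delta))]]]]].
rewrite eu_Erep_r eu_Erep_l addrC subr_le0 leNgt => /negP; apply; exact: lt nN nM.
Qed.

(* King stability with respect to the defect; [stab] will be regular simplicity. *)
Definition Fneg X := forall N (k : hom N X), mono k -> nzero N -> dfc N < 0.
Definition semist X := dfc X = 0 /\ forall N (k : hom N X), mono k -> dfc N <= 0.
Definition stab S := [/\ nzero S, dfc S = 0 &
  forall N (k : hom N S), mono k -> nzero N -> ~ epi k -> dfc N < 0].

Lemma dfc_bound X N (k : hom N X) : mono k -> dfc N <= (\sum_v delta v * rdim X v)%N%:Z.
Proof.
move=> mk; rewrite /dfc /defect /euler /ivec.
apply: (@le_trans _ _ (\sum_v (delta v)%:Z * (rdim N v)%:Z)).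
  by rewrite gerBl; apply: sumr_ge0.
rewrite (big_morph _ PoszD (erefl _)); apply: ler_sum => v _.
by rewrite -PoszM lez_nat leq_mul2l (mono_le mk) orbT.
Qed.

Lemma max_sub X : exists N (k : hom N X), mono k /\
  forall N' (k' : hom N' X), mono k' -> dfc N' <= dfc N /\ (dfc N' = dfc N -> (tdim N' <= tdim N)%N).
Proof.
have [||n [N0 [k0 [mk0 d0]]] nmax] := @ex_max
    (fun n => exists N (k : hom N X), mono k /\ dfc N = n%:Z) (\sum_v delta v * rdim X v)%N.
- exists 0%N, (zero_rep Q F), (hzero _ X); split; [exact: mono_zero | exact: dfc_zero].
- by move=> n [N [k [mk dN]]]; rewrite -lez_nat -dN; exact: dfc_bound mk.
have [||m [N [k [mk dN tN]]] mmax] := @ex_max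
    (fun m => exists N (k : hom N X), [/\ mono k, dfc N = n%:Z & tdim N = m]) (tdim X).
- by exists (tdim N0), N0, k0.
- by move=> m [N [k [mk dN <-]]]; exact: tdim_mono mk.
exists N, k; split=> // N' k' mk'; rewrite dN tN; split.
  case: (leP 0 (dfc N')) => [/gez0_abs e|lt]; last by apply: le_trans (ltW lt) _.
  by rewrite -e lez_nat; apply: nmax; exists N', k'; rewrite e.
by move=> e; apply: mmax; exists N', k'.
Qed.

(* The last step of the Harder-Narasimhan filtration with respect to the defect; it splits
   because Ext vanishes against the slopes. *)
Lemma max_split X : exists N (k : hom N X) C (c : hom X C) (s : hom C X),
  [/\ ses k c, forall v, s v *m c v = 1%:M, Fneg C, forall p : dext C N, ~ dnz p &
  forall N' (k' : hom N' X), mono k' -> dfc N' <= dfc N /\ (dfc N' = dfc N -> (tdim N' <= tdim N)%N)].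
Proof.
have [N [k [mk max]]] := max_sub X.
have [C [c S]] := ses_mono mk; have [_ ec kc] := S.
have FC : Fneg C.
  (* The preimage of [N1] in X cannot beat N in defect nor, at equal defect, in dimension. *)
  move=> N1 j mj nN1; have [R [r [pi [i [Sr mr _ _]]]]] := preim_ex S mj.
  have [le ltd] := max R r mr.
  rewrite ltNge le_eqVlt; apply/negP => /orP[/eqP e|lt].
    have := ltd _; rewrite (dfc_ses Sr) -e addr0 (tdim_ses Sr) => /(_ erefl).
    by have := tdim_gt0 nN1; lia.
  by have := le; rewrite (dfc_ses Sr) gerDl leNgt lt.
have van : forall p : dext C N, ~ dnz p.
  apply: dext_vanish => N1 k1 M1 c1 mk1 ec1 nN1 nM1.
  apply: lt_le_trans (FC _ _ mk1 nN1) _.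
  have [K1 [j1 S1]] := ses_epi ec1; have [mj1 _ _] := S1.
  by have [] := max _ _ (mono_comp mj1 mk); rewrite (dfc_ses S1) lerDl.
have [s sc] := dext_split S van.
by exists N, k, C, c, s.
Qed.

(** In an indecomposable module one of the two terms of the split sequence of [max_split]
    vanishes. *)
Lemma indec_max X : indecomposable X ->
  exists N (k : hom N X), [/\ mono k, is_zero N \/ epi k &
  forall N' (k' : hom N' X), mono k' -> dfc N' <= dfc N /\ (dfc N' = dfc N -> (tdim N' <= tdim N)%N)].
Proof.
move=> iX; have [N [k [C [c [s [S sc _ _ max]]]]]] := max_split X.
have [mk ec kc] := S; exists N, k; split=> //.
case: (classic (is_zero C)) => [zC|nC]; first by right; apply: zero_ses_r S zC.
left => v; have mc := indec_ret iX sc nC.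
have := mono_rank mk v; rewrite (_ : k v = 0) ?mxrank0 //.
by apply: (free_inj (mc v)); rewrite (ses0 S) mul0mx.
Qed.

Lemma indec_neg X : indecomposable X -> dfc X < 0 -> Fneg X.
Proof.
move=> iX dX; have [N [k [mk zk max]]] := indec_max iX.
have zN : is_zero N.
  case: zk => // ek; have [] := max _ _ (mono_zero X).
  rewrite dfc_zero // (dfc_eq (N := X)) ?leNgt ?dX // => v.
  by rewrite -(mono_rank mk) (epi_rank ek).
move=> N' k' mk' nN'; have [le ltd] := max _ _ mk'.
move: le ltd; rewrite (dfc_zero zN) le_eqVlt => /orP[/eqP e|//].
move/(_ e); have := tdim_gt0 nN'.
have -> : tdim N = 0%N by rewrite /tdim big1.
by rewrite leqn0 lt0n => /negPf ->.
Qed.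

Lemma indec_reg X : indecomposable X -> dfc X = 0 -> semist X.
Proof.
move=> iX dX; have [N [k [mk zk max]]] := indec_max iX; split=> // N' k' /max[le _].
rewrite (le_trans le) //; case: zk => [/dfc_zero -> //|ek].
by rewrite (dfc_eq (N := X)) ?dX // => v; rewrite -(mono_rank mk) (epi_rank ek).
Qed.

End Rad.
End Defect.

Arguments dfc_eq {Q F delta M N}.
Arguments dfc_zero {Q F delta M}.
Arguments dfc_ses {Q F delta K X C k c}.
Arguments dfc_dsum {Q F delta M N}.

(** * Uniqueness of the regular simple submodule *)

Section Tubes.
Variables (Q : quiver) (F : finFieldType) (delta : qV Q -> nat).
Implicit Types (A B C D K M N S T R X Y Z E J W : rep Q F) (v : qV Q) (a : qA Q).
Hypothesis rad : forall v, cartan (ivec delta) (evec v) = 0.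
Hypothesis pos : forall v, (0 < delta v)%N.
Local Notation dfc := (@dfc Q F delta).
Local Notation semist := (@semist Q F delta).
Local Notation stab := (@stab Q F delta).

Lemma hfac_ex X Y (f : hom X Y) :
  exists K (k : hom K X) J (e : hom X J) (m : hom J Y),
  [/\ ses k e, mono m, (forall v, f v = e v *m m v) & forall v, k v *m f v = 0].
Proof.
have [J [e [m [ee mm fE]]]] := him_ex f; have [K [k S]] := ses_epi ee.
by exists K, k, J, e, m; split=> // v; rewrite fE mulmxA (ses0 S) mul0mx.
Qed.

Lemma hnz_fac X J Y (f : hom X Y) (e : hom X J) (m : hom J Y) :
  (forall v, f v = e v *m m v) -> hnz f -> nzero J.
Proof.
move=> fE [v nv]; apply: (hnz_cod (f := e)); exists v; apply: contra nv => /eqP e0.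
by rewrite fE e0 mul0mx.
Qed.

Lemma stab_semist S : stab S -> semist S.
Proof.
case=> nS dS neg; split=> // N k mk; case: (classic (is_zero N)) => [/dfc_zero -> //|nN].
case: (classic (epi k)) => [ek|nk]; last exact/ltW/neg.
by rewrite (dfc_eq (N := S)) ?dS // => v; rewrite -(mono_rank mk) (epi_rank ek).
Qed.

Lemma semist_sub X N (k : hom N X) : semist X -> mono k -> dfc N = 0 -> semist N.
Proof. by move=> [_ le] mk dN; split=> // N' k' mk'; apply: le (mono_comp mk' mk). Qed.

Lemma semist_quo K X C (k : hom K X) (c : hom X C) : ses k c -> semist X -> dfc K = 0 -> semist C.
Proof.
move=> S [dX le] dK; split=> [|N j mj].
  by have := dfc_ses (delta := delta) S; rewrite dX dK add0r.
have [R [r [pi [i [Sr mr _ _]]]]] := preim_ex S mj.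
by have := le _ _ mr; rewrite (dfc_ses Sr) dK add0r.
Qed.

Lemma semist_ext K X C (k : hom K X) (c : hom X C) : ses k c -> semist K -> semist C -> semist X.
Proof.
move=> S [dK leK] [dC leC]; split=> [|N j mj]; first by rewrite (dfc_ses S) dK dC.
have [L [l [J [e [m [Sl mm fE l0]]]]]] := hfac_ex (hcomp j c).
have [ml _ _] := Sl.
have [j' j'E] : exists j' : hom L K, forall v, j' v *m k v = hcomp l j v.
  by apply: (ses_fac S) => v; rewrite /= -mulmxA; apply: l0.
have mj' : mono j'.
  move=> v; apply: (@free_mull _ _ _ _ _ (k v)); rewrite j'E.
  exact: (mono_comp ml mj).
by rewrite (dfc_ses Sl); have := leK _ _ mj'; have := leC _ _ mm; lia.
Qed.

Lemma semist_dsum X Y : semist X -> semist Y -> semist (dsum X Y).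
Proof.
have S : ses (hinl X Y) (hprr X Y).
  split; [move=> v; apply/row_freeP; exists (hprl X Y v); exact: inl_prl| |move=> v].
    by move=> v; apply/row_fullP; exists (hinr X Y v); exact: inr_prr.
  apply/eqmxP/andP; split; last by apply/sub_kermxP; exact: inl_prr.
  rewrite -[kermx _]mulmx1 -(pr_in X Y) mulmxDr !mulmxA mulmx_ker mul0mx addr0.
  exact: submxMl.
exact: semist_ext S.
Qed.

(** Kernel and image are submodules of semistable modules, so both defects are at most 0, and they
    add up to 0. This makes the semistable modules an abelian category with the stable modules as
    simple objects. *)
Lemma semist_fac X Y (f : hom X Y) K (k : hom K X) J (e : hom X J) (m : hom J Y) :
  semist X -> semist Y -> ses k e -> mono m -> dfc K = 0 /\ dfc J = 0.
Proof.
move=> [dX leX] [dY leY] S mm; have [mk _ _] := S.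
have := dfc_ses (delta := delta) S; have := leX _ _ mk; have := leY _ _ mm.
by rewrite dX; lia.
Qed.

Lemma semist_ker X Y (f : hom X Y) K (k : hom K X) : semist X -> semist Y -> mono k ->
  (forall v, (k v :=: kermx (f v))%MS) -> dfc K = 0.
Proof.
move=> sX sY mk kf; have [K' [k' [J [e [m [S mm fE l0]]]]]] := hfac_ex f.
have [<- _] := semist_fac f sX sY S mm; have [mk' _ k'e] := S.
apply: dfc_eq => v; rewrite -(mono_rank mk) -(mono_rank mk') kf -k'e fE.
by rewrite !mxrank_ker mxrankMfree // mm.
Qed.

Lemma stab_mono S X (f : hom S X) : stab S -> semist X -> hnz f -> mono f.
Proof.
move=> sS sX nf; apply: NNPP => /not_mono_ker[K [k [mk nK kf kf0]]].
have dK := semist_ker (stab_semist sS) sX mk kf.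
case: sS => _ _ /(_ K k mk nK); rewrite dK ltxx => neg.
suff: false by []. apply: neg => ek; case: nf => v /eqP; apply.
by apply: (full_inj (ek v)); rewrite kf0 mulmx0.
Qed.

Lemma stab_bij S T (f : hom S T) : stab S -> stab T -> hnz f -> mono f /\ epi f.
Proof.
move=> sS sT nf; have mf := stab_mono sS (stab_semist sT) nf; split=> //.
apply: NNPP => nef; case: sT => _ _ /(_ _ _ mf _ nef).
by case: (sS) => nS -> _; rewrite ltxx => /(_ nS).
Qed.

Lemma not_stab X : semist X -> nzero X -> ~ stab X ->
  exists N (k : hom N X), [/\ mono k, nzero N, ~ epi k & dfc N = 0].
Proof.
move=> sX nX nst; apply: NNPP => nex; apply: nst; split=> //; first by case: sX.
move=> N k mk nN nek; rewrite lt_neqAle (proj2 sX _ _ mk) andbT.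
by apply/eqP => dN; apply: nex; exists N, k.
Qed.

Lemma stab_ex X : semist X -> nzero X -> exists S (s : hom S X), stab S /\ mono s.
Proof.
move: {2}(tdim X).+1 (ltnSn (tdim X)) => n; elim: n X => // n IH X; rewrite ltnS => len sX nX.
case: (classic (stab X)) => [st|nst]; first by exists X, (hid X); split=> //; exact: mono_hid.
have [N [k [mk nN nek dN]]] := not_stab sX nX nst.
have [S [s [sS ms]]] := IH N (leq_trans (tdim_mono_lt mk nek) len) (semist_sub sX mk dN) nN.
by exists S, (hcomp s k); split=> //; apply: mono_comp.
Qed.

Lemma eu_Erep_mul N k : eu N (@Erep Q F (fun v => k * delta v)%N) = - (k%:Z * dfc N).
Proof. by rewrite (@eu_mul_r _ _ _ (Erep F delta) _ k) // (eu_Erep_r rad) mulrN. Qed.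
Lemma eu_Erep_mul_l N k : eu (@Erep Q F (fun v => k * delta v)%N) N = k%:Z * dfc N.
Proof. exact: (@eu_mul_l _ _ _ (Erep F delta)). Qed.

(* Auslander-Reiten duality M = tau N for stable N, M with Ext(N, M) nonzero:
   both sides have the same Euler characteristic because the difference is a
   nonnegative additive function of dim E that vanishes on delta. *)
Lemma stab_dual N S (p : dext N S) : stab N -> stab S -> dnz p ->
  forall E, h N E = z E S /\ h E S = z N E.
Proof.
move=> sN sS np.
have sS' := stab_semist sS; have sN' := stab_semist sN.
have quoS M1 (c : hom S M1) : epi c -> 0 <= dfc M1.
  move=> ec; have [K [k Sk]] := ses_epi ec; have [mk _ _] := Sk.
  have := dfc_ses (delta := delta) Sk; have := proj2 sS' _ _ mk.
  by case: sS => _ -> _; lia.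
have le1 E : (h N E <= z E S)%N.
  apply: (hz_le (G := fun u => dcompr p u)) => f g e v.
  apply: (hom_eq _ v) => nf.
  (* If two maps act equally on [p], then [p] comes from the kernel K of their difference. Nonzero
     proper submodules of N have negative defect and quotients of S nonnegative defect, so the dual
     of Ext(K, S) vanishes. *)
  have [K [k mk ku]] := hker_ex (hsub f g).
  have [p' pE] := dcompr_ker mk ku (dcompr_eq e).
  have := dnz_facr pE np.
  apply: (dext_vanish rad (delta := delta)) => N1 k1 M1 c mk1 ec nN1 nM1; apply: lt_le_trans (quoS _ _ ec).
  case: sN => _ _; apply; [exact: mono_comp mk1 mk | by [] | ].
  move=> ek; have ek' w : row_full (k w) by apply: full_mulr (ek w).
  case: nf => w /eqP; apply; apply: (full_inj (ek' w)).
  by rewrite mulmx0; apply/sub_kermxP; rewrite ku.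
have le2 E : (h E S <= z N E)%N.
  apply: (hz_le (G := fun u => dcompl p u)) => f g e v.
  apply: (hom_eq _ v) => nf.
  have [C [c ec cu]] := hcok_ex (hsub f g).
  have [p' pE] := dcompl_coker ec cu (dcompl_eq e).
  have := dnz_facl pE np.
  apply: (dext_vanish rad (delta := delta)) => N1 k1 M1 c1 mk1 ec1 nN1 nM1.
  apply: le_lt_trans (proj2 sN' _ _ mk1) _.
  have [K [k Sk]] := ses_epi (epi_comp ec ec1); have [mk _ kc] := Sk.
  have nK : nzero K.
    move=> zK; have mc := zero_ses_l Sk zK; case: nf => w /eqP; apply.
    apply: (free_inj (mc w)); rewrite mul0mx /= mulmxA.
    by rewrite (_ : hsub f g w *m c w = 0) ?mul0mx //; apply/sub_kermxP; rewrite cu.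
  have := dfc_ses (delta := delta) Sk; case: sS => _ -> /(_ K k mk nK) lt.
  suff: dfc K < 0 by lia.
  apply: lt => ek; case/nzeroP: nM1 => w /eqP; apply; apply: (row_full0 (epi_comp ec ec1 w)).
  by apply: (full_inj (ek w)); rewrite mulmx0; exact: (ses0 Sk w).
have leE E : eu N E + eu E S <= 0.
  by apply: eu_le0; rewrite [leqRHS]mulnC; apply: leq_mul.
have eqE E : eu N E + eu E S = 0.
  apply/eqP; rewrite eq_le leE /=.
  pose c := (\sum_v rdim E v)%N.
  have le v : (rdim E v <= c * delta v)%N.
    rewrite -[X in (X <= _)%N]muln1; apply: leq_mul => //.
    by rewrite /c (bigD1 v) //= leq_addr.
  pose E' := @Erep Q F (fun v => c * delta v - rdim E v)%N.
  have dE v : rdim (@Erep Q F (fun v => c * delta v)%N) v = (rdim E v + rdim E' v)%N.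
    by rewrite /= subnKC.
  have := leE E'; have := eu_addr N dE; have := eu_addl S dE.
  rewrite eu_Erep_mul eu_Erep_mul_l; case: sN => _ -> _; case: sS => _ -> _.
  by rewrite !mulr0; lia.
move=> E; have := le1 E; have := le2 E; have := eu_eq0 (eqE E).
have := h_gt0 N E; have := h_gt0 E S; have := z_gt0 N E; have := z_gt0 E S.
by nia.
Qed.

(** Descends along submodules of defect zero until [stab_dual] applies: either [p] survives in the
    quotient by such a submodule, or it comes from the submodule. *)
Lemma dext_stab A S (p : dext A S) : semist A -> stab S -> dnz p ->
  exists N (p' : dext N S), stab N /\ dnz p'.
Proof.
move: {2}(tdim A).+1 (ltnSn (tdim A)) => n; elim: n A p => // n IH A p; rewrite ltnS => len sA sS np.
have nA := dnz_src np.
case: (classic (stab A)) => [st|nst]; first by exists A, p.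
have [N [k [mk nN nek dN]]] := not_stab sA nA nst.
have [C [c Sc]] := ses_mono mk; have [_ ec kc] := Sc.
case: (classic (dnz (dcompr p c))) => [nc|/dnzPn pc].
  apply: (IH C _ _ (semist_quo Sc sA dN) sS nc); exact: leq_trans (tdim_ses_lt Sc nN) len.
have [p' pE] : exists p' : dext N S, forall a, p a = p' a *m k (qs a).
  by apply: dext_ker => // a; rewrite -kc; apply/sub_kermxP; apply: pc.
exact: (IH N p' (leq_trans (tdim_mono_lt mk nek) len) (semist_sub sA mk dN) sS (dnz_facr pE np)).
Qed.

(** What is kept of the long exact sequence: the alternating product of its six cardinals is 1, by
    additivity of the Euler form. *)
Lemma ses_count_r K X C (k : hom K X) (c : hom X C) N : ses k c ->
  (h N X * z N K * z N C = z N X * h N K * h N C)%N.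
Proof.
move=> S; apply/eqP; rewrite -(eqr_nat rat) !natrM !euler_rat.
rewrite (eu_addr N (ses_dim S)) (expfzDr (eu N K)) ?lt0r_neq0 ?q_gt0 //.
by apply/eqP; ring.
Qed.
Lemma ses_count_l K X C (k : hom K X) (c : hom X C) N : ses k c ->
  (h X N * z K N * z C N = z X N * h K N * h C N)%N.
Proof.
move=> S; apply/eqP; rewrite -(eqr_nat rat) !natrM !euler_rat.
rewrite (eu_addl N (ses_dim S)) (expfzDr (eu K N)) ?lt0r_neq0 ?q_gt0 //.
by apply/eqP; ring.
Qed.

(* Since ext(-, S) = hom(N, -), a sequence starting in S splits as soon as
   Hom(N, -) is exact on it. *)
Lemma dual_split S X Y N (s : hom S X) (r : hom X Y) : ses s r ->
  (forall E, h N E = z E S) ->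
  (forall g : hom N Y, exists g' : hom N X, forall v, g' v *m r v = g v) ->
  exists t : hom Y X, forall v, t v *m r v = 1%:M.
Proof.
move=> Ss dual lift; have [ms er kr] := Ss.
have [L LP] : exists L : Hm N Y -> Hm N X, forall g, forall v, hm (L g) v *m r v = hm g v.
  apply: (@fin_all_exists _ (fun=> Hm N X) (fun g g' => forall v, hm g' v *m r v = hm g v)) => g.
  by have [g' g'E] := lift (hm g); exists (mh g') => v; rewrite hmK.
have leN : (h N S * h N Y <= h N X)%N.
  apply: (hhh_le (G := fun f g => hadd (hcomp f s) (hm (L (mh g))))) => f g f' g' e.
  have eg v : g v = g' v.
    have := congr1 (mulmx^~ (r v)) (e v); rewrite /= !mulmxDl -!(mulmxA _ (s v)) !(ses0 Ss).
    by rewrite !mulmx0 !add0r !LP !hmK.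
  split=> // v; have egg : mh g = mh g' by apply: hm_inj => w; rewrite !hmK.
  by have := e v; rewrite /= egg => /addIr/(free_inj (ms v)).
(* Duality rewrites the Ext terms into S as Hom terms out of N, so the surjectivity of Hom(N, X) ->
   Hom(N, Y) becomes a lower bound for Hom(X, S). *)
have leX : (h Y S * h S S <= h X S)%N.
  have := ses_count_l S Ss; rewrite -!dual => eX.
  have := h_gt0 N S; have := h_gt0 N Y; have := h_gt0 N X; move: leN eX.
  set a := h N S; set b := h N Y; set c := h N X; set x := h X S; set u := h S S; set w := h Y S.
  move=> le eX *; rewrite -(leq_pmul2r (m := (a * b)%N)) ?muln_gt0; last by lia.
  rewrite (_ : x * (a * b) = c * (w * u))%N; last by rewrite mulnA eX; lia.
  by rewrite mulnC leq_mul2r le orbT.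
(* Restriction from Hom(X, S) to End S is thus onto, and a preimage of the identity is a retraction
   of [s]. *)
have [f fE] := card_fiber_surj (res_fiber (Y := S) Ss) leX (h_gt0 _ _) (mh (hid S)).
have /mh_eq fs := fE.
by apply: (ret_sec (r := hm f) Ss) => v; rewrite -[RHS](fs v).
Qed.

(** A simple socle among semistable modules: used in both orders, the inclusion says that any two
    stable submodules coincide. *)
Definition unif X := semist X /\
  forall T1 T2 (t1 : hom T1 X) (t2 : hom T2 X), stab T1 -> stab T2 -> mono t1 -> mono t2 ->
    forall v, (t1 v <= t2 v)%MS.

(** Uniseriality within the semistable modules. *)
Definition chain X := forall N1 N2 (k1 : hom N1 X) (k2 : hom N2 X), mono k1 -> mono k2 ->
  dfc N1 = 0 -> dfc N2 = 0 -> (forall v, (k1 v <= k2 v)%MS) \/ (forall v, (k2 v <= k1 v)%MS).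

Lemma unif_fac X T (t : hom T X) N (k : hom N X) : unif X -> stab T -> mono t -> mono k ->
  nzero N -> dfc N = 0 -> exists t' : hom T N, forall v, t' v *m k v = t v.
Proof.
move=> [sX uX] sT mt mk nN dN.
have [S [s [sS ms]]] := stab_ex (semist_sub sX mk dN) nN.
apply: (fac_mono mk) => v.
apply: submx_trans (uX _ _ _ _ sT sS mt (mono_comp ms mk) v) _.
exact: submxMl.
Qed.

Lemma ses_le K X C (k : hom K X) (c : hom X C) v m n (x : 'M_(m, _)) (y : 'M_(n, _)) :
  ses k c -> (k v <= y)%MS -> (x *m c v <= y *m c v)%MS -> (x <= y)%MS.
Proof.
move=> [_ _ kc] ky /submxP[w e].
have : (x - w *m y <= k v)%MS.
  by rewrite -kc; apply/sub_kermxP; rewrite mulmxBl e mulmxA subrr.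
move=> le; rewrite -(subrK (w *m y) x) addmx_sub ?submxMl //.
exact: submx_trans le ky.
Qed.

(** A stable T1 in Y with Ext(T1, T) = 0 would lift to X, so T is dual to every stable submodule of
    Y in the sense of [stab_dual]. Two different ones would give h T1 Y >= h T1 T1 * h T1 T2 with h
    T1 T2 > 1, while counting Hom(T1, -) along T -> X -> Y leaves at most z T1 T = h T1 T1. *)
Lemma unif_quo T X Y (t : hom T X) (c : hom X Y) : unif X -> stab T -> ses t c -> unif Y.
Proof.
move=> uX sT Sc; have [sX eqX] := uX; have [mt ec tc] := Sc.
have sY : semist Y by apply: semist_quo Sc sX _; case: sT.
have noT T1 (b : hom T1 Y) : stab T1 -> mono b -> exists p : dext T1 T, dnz p.
  move=> s1 mb; apply: NNPP => nex.
  have [R [r [pi [i [Sr mr rc ir]]]]] := preim_ex Sc mb.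
  have [|s sE] := dext_split Sr; first by move=> p np; apply: nex; exists p.
  have [w nw] : hnz b by apply: mono_hnz => //; case: s1.
  have ms : mono s by move=> u; apply/row_freeP; exists (pi u).
  have := eqX _ _ _ _ s1 sT (mono_comp ms mr) mt w; rewrite -tc => /sub_kermxP.
  rewrite /= -mulmxA rc mulmxA sE mul1mx => b0.
  by rewrite b0 eqxx in nw.
split=> // T1 T2 b1 b2 s1 s2 mb1 mb2.
have [D [d Sd]] := ses_mono mb2; have [_ ed dk] := Sd.
apply: NNPP => nle.
have nd : hnz (hcomp b1 d).
  apply: NNPP => /hnzPn e; apply: nle => v; rewrite -dk; apply/sub_kermxP; exact: e.
have md : mono (hcomp b1 d).
  by apply: (stab_mono s1 _ nd); apply: semist_quo Sd sY _; case: s2.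
have [p1 np1] := noT _ _ s1 mb1; have [p2 np2] := noT _ _ s2 mb2.
have dual1 := stab_dual s1 sT np1.
have le1 : (h T1 T1 * h T1 T2 <= h T1 Y)%N.
  apply: (hhh_le (G := fun f g => hadd (hcomp f b1) (hcomp g b2))) => f g f' g' e.
  have ef v : f v = f' v.
    apply: (free_inj (md v)); have := congr1 (mulmx^~ (d v)) (e v).
    by rewrite /= !mulmxDl -!mulmxA !(ses0 Sd) !mulmx0 !addr0.
  split=> // v; have := e v; rewrite /= ef => /addrI; exact: (free_inj (mb2 v)).
have gt2 : (1 < h T1 T2)%N by have [-> _] := dual1 T2; apply: z_gt1 np2.
have leX : (h T1 X <= h T1 T)%N.
  apply: (h_le_factor (G := fun f => hcomp f t)) => [f f' e v /=|g]; first by rewrite e.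
  apply: (fac_mono mt) => v; case: (classic (hnz g)) => [ng|/hnzPn ->]; last exact: sub0mx.
  by apply: eqX => //; apply: stab_mono.
have leZ : (z T1 Y <= z T1 X)%N.
  apply: (zz_le (G := fun p => dcompl p c)) => f g e a; exact: (full_inj (ec _) (e a)).
have := ses_count_r T1 Sc; have [eT _] := dual1 T1.
rewrite -eT.
have := z_gt0 T1 Y; have := h_gt0 T1 T1; have := h_gt0 T1 T.
move: le1 gt2 leX leZ.
set a := h T1 T1; set b := h T1 T2; set y := h T1 Y; set x := h T1 X; set u := h T1 T.
set zy := z T1 Y; set zx := z T1 X => le1 gt2 leX leZ u0 a0 zy0 e.
have l1 : (x * a * zy <= u * a * zy)%N by rewrite !leq_mul2r leX !orbT.
have l2 : (zy * u * y <= zx * u * y)%N by rewrite !leq_mul2r leZ !orbT.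
have : (zy * u * y <= zy * u * a)%N by lia.
rewrite leq_pmul2l ?muln_gt0 ?zy0 //.
by nia.
Qed.

(** Nonzero submodules of defect zero all contain the stable submodule T; they are compared in X /
    T, which is uniform again. *)
Lemma unif_chain X : unif X -> chain X.
Proof.
move: {2}(tdim X).+1 (ltnSn (tdim X)) => n; elim: n X => // n IH X; rewrite ltnS => len uX.
move=> N1 N2 k1 k2 mk1 mk2 d1 d2; have [sX eqX] := uX.
have zle N N' (k : hom N X) (k' : hom N' X) : is_zero N -> mono k -> forall v, (k v <= k' v)%MS.
  move=> zN mk v; rewrite (_ : k v = 0) ?sub0mx //; apply/eqP.
  by rewrite -mxrank_eq0 (mono_rank mk) zN.
case: (classic (is_zero N1)) => [z1|n1]; first by left; apply: zle.
case: (classic (is_zero N2)) => [z2|n2]; first by right; apply: zle.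
have [T [t [sT mt]]] := stab_ex sX (fun zX => n1 (fun v => eqP (eq_trans (esym (leqn0 _)) (leq_trans (mono_le mk1 v) (eq_leq (zX v)))))).
have [t1 t1E] := unif_fac uX sT mt mk1 n1 d1.
have [t2 t2E] := unif_fac uX sT mt mk2 n2 d2.
have [Y [c Sc]] := ses_mono mt; have uY := unif_quo uX sT Sc.
have ltY : (tdim Y < n)%N by apply: leq_trans (tdim_ses_lt Sc _) len; case: sT.
have [J1 [e1 [m1 [ee1 mm1 E1]]]] := him_ex (hcomp k1 c).
have [J2 [e2 [m2 [ee2 mm2 E2]]]] := him_ex (hcomp k2 c).
have dJ N J (k : hom N X) (e : hom N J) (m : hom J Y) : mono k -> dfc N = 0 -> epi e -> mono m -> dfc J = 0.
  move=> mk dN ee mm; have [K [l Sl]] := ses_epi ee.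
  by have [] := semist_fac (hcomp k c) (semist_sub sX mk dN) (proj1 uY) Sl mm.
have full_le (N J : rep Q F) (e : hom N J) (m : hom J Y) : epi e -> forall v, (m v <= e v *m m v)%MS.
  by move=> ee v; have /row_fullP[w we] := ee v; rewrite -[m v in X in (X <= _)%MS]mul1mx -we -mulmxA submxMl.
have [le|le] := IH Y ltY uY _ _ m1 m2 mm1 mm2 (dJ _ _ _ _ _ mk1 d1 ee1 mm1) (dJ _ _ _ _ _ mk2 d2 ee2 mm2).
  left=> v; apply: (ses_le Sc); first by rewrite -t2E submxMl.
  have := E1 v; have := E2 v => /= -> ->; apply: submx_trans (submxMl _ _) _.
  exact: submx_trans (le v) (full_le _ _ _ _ ee2 v).
right=> v; apply: (ses_le Sc); first by rewrite -t1E submxMl.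
have := E1 v; have := E2 v => /= -> ->; apply: submx_trans (submxMl _ _) _.
exact: submx_trans (le v) (full_le _ _ _ _ ee1 v).
Qed.

(* A maximal common submodule [D] of [A1] and [A2] extending the given identification
   of socles is all of [A1] or [A2]: otherwise the amalgam of [A1] and [A2] along [D]
   is uniform, and its submodules [A1] and [A2] would be comparable. *)
Lemma unif_amalgam A1 A2 B (b1 : hom B A1) (b2 : hom B A2) :
  unif A1 -> unif A2 -> stab B -> mono b1 -> mono b2 ->
  (exists t : hom A1 A2, forall v, b1 v *m t v = b2 v) \/
  (exists t : hom A2 A1, forall v, b2 v *m t v = b1 v).
Proof.
move=> u1 u2 sB mb1 mb2; have [s1 _] := u1; have [s2 _] := u2.
have [||n [D [d1 [d2 [b [[md1 md2] sD tD [bd1 bd2]]]]]] max] := @ex_max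
   (fun n => exists D (d1 : hom D A1) (d2 : hom D A2) (b : hom B D),
     [/\ mono d1 /\ mono d2, semist D, tdim D = n &
      (forall v, b v *m d1 v = b1 v) /\ (forall v, b v *m d2 v = b2 v)]) (tdim A1).
- exists (tdim B), B, b1, b2, (hid B); split=> //; first exact: stab_semist.
  by split=> v; rewrite /= mul1mx.
- by move=> n [D [d1 [d2 [b [[md1 md2] sD <- _]]]]]; exact: tdim_mono md1.
case: (classic (epi d1)) => [ed1|nd1].
  have [e [de ed]] := bij_inv md1 ed1.
  left; exists (hcomp e d2) => v /=; rewrite -bd1 -mulmxA (mulmxA (d1 v)) de mul1mx.
  exact: bd2.
case: (classic (epi d2)) => [ed2|nd2].
  have [e [de ed]] := bij_inv md2 ed2.
  right; exists (hcomp e d1) => v /=; rewrite -bd2 -mulmxA (mulmxA (d2 v)) de mul1mx.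
  exact: bd1.
pose W := dsum A1 A2.
(* The antidiagonal embedding of D, whose cokernel [Th] is the amalgam. *)
pose d := hsub (hcomp d1 (hinl A1 A2)) (hcomp d2 (hinr A1 A2)).
have dE v : d v = d1 v *m hinl A1 A2 v - d2 v *m hinr A1 A2 v by rewrite /d hsubE.
have dl v : d v *m hprl A1 A2 v = d1 v.
  by rewrite dE mulmxBl -!mulmxA inl_prl inr_prl mulmx1 mulmx0 subr0.
have dr v : d v *m hprr A1 A2 v = - d2 v.
  by rewrite dE mulmxBl -!mulmxA inl_prr inr_prr mulmx1 mulmx0 sub0r.
have md : mono d by move=> v; apply: (@free_mull _ _ _ _ _ (hprl A1 A2 v)); rewrite dl.
have [Th [c Sc]] := ses_mono md; have [_ ec dc] := Sc.
have sW : semist W by apply: semist_dsum.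
have sTh : semist Th by apply: semist_quo Sc sW (proj1 sD).
have inj A A' (u : hom A W) (l : hom W A) (l' : hom W A') : (forall v, u v *m l v = 1%:M) ->
    (forall v, u v *m l' v = 0) -> (forall v, row_free (d v *m l' v)) -> mono (hcomp u c).
  move=> ul ul' fr v; rewrite -kermx_eq0 -submx0; set y := kermx _.
  have : (y *m u v <= d v)%MS by rewrite -dc; apply/sub_kermxP; rewrite -mulmxA mulmx_ker.
  case/submxP=> w e; have w0 : w = 0.
    by apply: (free_inj (fr v)); rewrite mul0mx mulmxA -e -mulmxA ul' mulmx0.
  by rewrite -[y]mulmx1 -(ul v) mulmxA e w0 !mul0mx sub0mx.
have ma1 : mono (hcomp (hinl A1 A2) c).
  apply: (inj _ _ _ (hprl A1 A2) (hprr A1 A2)) => v; rewrite ?inl_prl ?inl_prr //.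
  by rewrite dr /row_free mxrank_opp; exact: md2.
have ma2 : mono (hcomp (hinr A1 A2) c).
  apply: (inj _ _ _ (hprr A1 A2) (hprl A1 A2)) => v; rewrite ?inr_prl ?inr_prr //.
  by rewrite dl; exact: md1.
pose be := hcomp b1 (hcomp (hinl A1 A2) c).
have beE v : be v = b2 v *m (hinr A1 A2 v *m c v).
  apply/eqP; rewrite -subr_eq0 /be /=; apply/eqP.
  change (b1 v *m (hinl A1 A2 v *m c v) - b2 v *m (hinr A1 A2 v *m c v) = 0).
  rewrite !mulmxA -mulmxBl -bd1 -bd2 -!mulmxA -mulmxBr -dE -mulmxA (ses0 Sc).
  exact: mulmx0.
have mbe : mono be by apply: mono_comp.
have key T (t : hom T Th) : stab T -> mono t -> forall v, (be v <= t v)%MS.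
  move=> sT mt; have [R [r [pi [i [Sr mr rc ir]]]]] := preim_ex Sc mt.
  have sR : semist R by apply: semist_ext Sr sD (stab_semist sT).
  have ltR : (n < tdim R)%N.
    by rewrite (tdim_ses Sr) tD -[X in (X < _)%N]addn0 ltn_add2l tdim_gt0 //; case: sT.
  pose r1 := hcomp r (hprl A1 A2); pose r2 := hscale (-1) (hcomp r (hprr A1 A2)).
  have r2E v : r2 v = - (r v *m hprr A1 A2 v) by rewrite /= scaleN1r.
  have rE v : r v = r v *m hprl A1 A2 v *m hinl A1 A2 v + r v *m hprr A1 A2 v *m hinr A1 A2 v.
    by rewrite -!mulmxA -mulmxDr pr_in mulmx1.
  (* The preimage R of T is larger than D, so by maximality it does not embed in both A1 and A2. The
     kernel of one projection then lies in the other summand, where it contains the image of B. *)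
  have : ~ (mono r1 /\ mono r2).
    move=> mr12; have := max (tdim R) _; rewrite leqNgt ltR => mx.
    suff: false by []. apply: mx; exists R, r1, r2, (hcomp b i); split=> //.
    split=> v /=; rewrite ?scaleN1r ?mulmxN -(mulmxA (b v)) (mulmxA (i v)) ir.
      by rewrite dl.
    by rewrite dr mulmxN opprK.
  have fin A (u : hom A W) (l : hom W A) (b' : hom B A) K (k : hom K R) :
      unif A -> mono b' -> mono k -> nzero K -> dfc K = 0 ->
      (forall v, k v *m r v = k v *m r v *m l v *m u v) ->
      (forall v, be v = b' v *m (u v *m c v)) -> forall v, (be v <= t v)%MS.
    move=> uA mb mk nK dK krE bE v.
    have mka : mono (hcomp k (hcomp r l)).
      move=> w; apply: (@free_mull _ _ _ _ _ (u w)); rewrite /= (mulmxA (k w)) -krE.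
      exact: (mono_comp mk mr).
    have [t' t'E] := unif_fac uA sB mb mka nK dK.
    have kt : k v *m r v *m l v *m u v *m c v = k v *m pi v *m t v.
      by rewrite -krE -(mulmxA (k v) (r v)) rc mulmxA.
    by rewrite bE -t'E /= -!mulmxA in kt *; rewrite kt !mulmxA submxMl.
  case/not_and_or => /not_mono_ker[K [k [mk nK kr kr0]]].
    apply: (fin _ _ _ _ _ _ u2 mb2 mk nK (semist_ker sR s1 mk kr)) => [v|v]; last exact: beE.
    by rewrite [in LHS]rE mulmxDr (mulmxA _ _ (hinl _ _ v)) [k v *m _]kr0 mul0mx add0r !mulmxA.
  apply: (fin _ _ _ _ _ _ u1 mb1 mk nK (semist_ker sR s2 mk kr)) => // v.
  have kr0' : k v *m (r v *m hprr A1 A2 v) = 0.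
    by apply/eqP; rewrite -oppr_eq0 -mulmxN -r2E kr0.
  by rewrite [in LHS]rE mulmxDr (mulmxA _ _ (hinr _ _ v)) kr0' mul0mx addr0 !mulmxA.
have uTh : unif Th.
  split=> // T1 T2 t1 t2 sT1 sT2 mt1 mt2.
  have [f fE] := fac_mono mt1 (key _ _ sT1 mt1).
  have [_ ef] : mono f /\ epi f.
    apply: (stab_bij sB sT1); case: (mono_hnz mbe); first by case: sB.
    by move=> v nv; exists v; apply: contra nv => /eqP e; rewrite -fE e mul0mx.
  move=> v; apply: submx_trans (key _ _ sT2 mt2 v); rewrite -fE.
  by have /row_fullP[w wf] := ef v; rewrite -[t1 v in X in (X <= _)%MS]mul1mx -wf -mulmxA submxMl.
(* If A1 lies in A2 inside the amalgam, then A1 = D, against [nd1]; likewise with the roles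
   exchanged. *)
have [le|le] := unif_chain uTh ma1 ma2 (proj1 s1) (proj1 s2).
  case: nd1 => v; have /submxP[w e] := le v.
  have : (hinl A1 A2 v - w *m hinr A1 A2 v <= d v)%MS.
    by rewrite -dc; apply/sub_kermxP; rewrite mulmxBl -mulmxA; apply/eqP; rewrite subr_eq0; apply/eqP.
  case/submxP=> y /(congr1 (mulmx^~ (hprl A1 A2 v))).
  rewrite mulmxBl -!mulmxA inl_prl inr_prl mulmx0 subr0 dl => e'.
  by apply/row_fullP; exists y.
case: nd2 => v; have /submxP[w e] := le v.
have : (hinr A1 A2 v - w *m hinl A1 A2 v <= d v)%MS.
  by rewrite -dc; apply/sub_kermxP; rewrite mulmxBl -mulmxA; apply/eqP; rewrite subr_eq0; apply/eqP.
case/submxP=> y /(congr1 (mulmx^~ (hprr A1 A2 v))).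
rewrite mulmxBl -!mulmxA inl_prr inr_prr mulmx0 subr0 dr => e'.
by apply/row_fullP; exists (- y); rewrite e' mulmxN mulNmx.
Qed.

Lemma iso_biprod X Y Z : iso X (dsum Y Z) ->
  exists (i1 : hom Y X) (i2 : hom Z X) (p1 : hom X Y) (p2 : hom X Z),
  [/\ forall v, i1 v *m p1 v = 1%:M, forall v, i2 v *m p2 v = 1%:M,
      forall v, i1 v *m p2 v = 0, forall v, i2 v *m p1 v = 0 &
      forall v, p1 v *m i1 v + p2 v *m i2 v = 1%:M].
Proof.
move=> [f [g [hf' hg fg gf]]].
pose f' := Hom hf'; pose g' := Hom hg.
exists (hcomp (hinl Y Z) g'), (hcomp (hinr Y Z) g'), (hcomp f' (hprl Y Z)), (hcomp f' (hprr Y Z)).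
have aux v m n (x : 'M_(m, _)) (y : 'M_(_, n)) : x *m g v *m (f v *m y) = x *m y.
  by rewrite -mulmxA (mulmxA (g v)) gf mul1mx.
split=> v; try by rewrite [LHS]aux ?inl_prl ?inr_prr ?inl_prr ?inr_prl.
change (f v *m hprl Y Z v *m (hinl Y Z v *m g v) + f v *m hprr Y Z v *m (hinr Y Z v *m g v) = 1%:M).
rewrite -!(mulmxA (f v)) -mulmxDr !(mulmxA _ _ (g v)) -mulmxDl.
by rewrite pr_in mul1mx fg.
Qed.

Lemma semist_summand X Y Z : semist X -> iso X (dsum Y Z) -> semist Y /\ semist Z.
Proof.
move=> sX iX; have [i1 [i2 [p1 [p2 [e1 e2 _ _ _]]]]] := iso_biprod iX.
have m1 : mono i1 by move=> v; apply/row_freeP; exists (p1 v).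
have m2 : mono i2 by move=> v; apply/row_freeP; exists (p2 v).
have d : dfc Y + dfc Z = 0 by rewrite -dfc_dsum -(dfc_eq (iso_rdim iX)); case: sX.
have d1 := proj2 sX _ _ m1; have d2 := proj2 sX _ _ m2.
by split; [apply: semist_sub sX m1 _ | apply: semist_sub sX m2 _]; lia.
Qed.

Lemma not_indec X : nzero X -> ~ indecomposable X ->
  exists Y Z, [/\ iso X (dsum Y Z), nzero Y & nzero Z].
Proof.
move=> nX nI; apply: NNPP => nex; apply: nI; split=> // Y Z iX.
apply: NNPP => /not_or_and[nY nZ]; apply: nex; by exists Y, Z.
Qed.

(** If B has nonzero components in two uniform summands, [unif_amalgam] extends one component along
    the other by a map [t], and the graph of [t] is a summand containing B. The bound [n] makes room
    for the induction in [indec_unif]. *)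
Lemma stab_summand n Y B (b : hom B Y) :
  (forall X, indecomposable X -> dfc X = 0 -> (tdim X <= n)%N -> unif X) ->
  semist Y -> (tdim Y <= n)%N -> stab B -> mono b ->
  exists A (i : hom A Y) (p : hom Y A) (be : hom B A),
    [/\ forall v, i v *m p v = 1%:M, unif A & forall v, be v *m i v = b v].
Proof.
move=> H; move: {2}(tdim Y).+1 (ltnSn (tdim Y)) => m; elim: m Y b => // m IH Y b.
rewrite ltnS => lem sY leY sB mb.
have nB : nzero B by case: sB.
have nY : nzero Y.
  by apply: (hnz_cod (f := b)); apply: mono_hnz.
case: (classic (indecomposable Y)) => [iY|/(not_indec nY)[Y1 [Y2 [iY n1 n2]]]].
  exists Y, (hid Y), (hid Y), b; split=> [v||v]; rewrite /= ?mulmx1 //.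
  by apply: H; case: sY.
have [sY1 sY2] := semist_summand sY iY.
have [i1 [i2 [p1 [p2 [e1 e2 e12 e21 e]]]]] := iso_biprod iY.
have tY : tdim Y = (tdim Y1 + tdim Y2)%N.
  by rewrite (tdim_eq (iso_rdim iY)) /tdim -big_split.
have t1 := tdim_gt0 n1; have t2 := tdim_gt0 n2.
have bE v : b v = b v *m p1 v *m i1 v + b v *m p2 v *m i2 v.
  by rewrite -!mulmxA -mulmxDr e mulmx1.
have lift Y' (p' : hom Y Y') : semist Y' -> (tdim Y' < tdim Y)%N -> hnz (hcomp b p') ->
    exists A (i : hom A Y') (p : hom Y' A) (be : hom B A),
    [/\ forall v, i v *m p v = 1%:M, unif A & forall v, be v *m i v = hcomp b p' v].
  by move=> sY' lt nb; apply: IH => //; [lia | lia | exact: (stab_mono sB sY' nb)].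
have alone Y' (i' : hom Y' Y) (p' : hom Y Y') : semist Y' -> (tdim Y' < tdim Y)%N ->
    (forall v, i' v *m p' v = 1%:M) -> (forall v, b v = b v *m p' v *m i' v) ->
    exists A (i : hom A Y) (p : hom Y A) (be : hom B A),
      [/\ forall v, i v *m p v = 1%:M, unif A & forall v, be v *m i v = b v].
  move=> sY' lt e' bE'; have nb : hnz (hcomp b p').
    case: (mono_hnz mb nB) => v nv; exists v; apply: contra nv => /eqP b0.
    by rewrite bE' [_ *m p' v]b0 mul0mx.
  have [A [j [q [be [jq u bj]]]]] := lift _ _ sY' lt nb.
  exists A, (hcomp j i'), (hcomp p' q), be; split=> // v /=.
    by rewrite -mulmxA (mulmxA (i' v)) e' mul1mx.
  by rewrite mulmxA bj -bE'.
have lt1 : (tdim Y1 < tdim Y)%N by lia.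
have lt2 : (tdim Y2 < tdim Y)%N by lia.
case: (classic (hnz (hcomp b p1))) => [nz1|/hnzPn b1]; last first.
  apply: (alone _ i2 p2) => // v.
  by rewrite {1}bE [b v *m p1 v]b1 mul0mx add0r.
have [A1 [j1 [q1 [be1 [jq1 u1 bj1]]]]] := lift _ _ sY1 lt1 nz1.
case: (classic (hnz (hcomp b p2))) => [nz2|/hnzPn b2]; last first.
  apply: (alone _ i1 p1) => // v.
  by rewrite {1}bE [b v *m p2 v]b2 mul0mx addr0.
have [A2 [j2 [q2 [be2 [jq2 u2 bj2]]]]] := lift _ _ sY2 lt2 nz2.
have mbe A' Y' (be : hom B A') (j : hom A' Y') (p : hom Y Y') : semist A' -> hnz (hcomp b p) ->
    (forall v, be v *m j v = hcomp b p v) -> mono be.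
  move=> sA [v nv] E; apply: (stab_mono sB sA); exists v; apply: contra nv => /eqP be0.
  by rewrite -E be0 mul0mx.
have mb1 := mbe _ _ _ _ _ (proj1 u1) nz1 bj1.
have mb2 := mbe _ _ _ _ _ (proj1 u2) nz2 bj2.
case: (unif_amalgam u1 u2 sB mb1 mb2) => -[t tE].
  exists A1, (hadd (hcomp j1 i1) (hcomp t (hcomp j2 i2))), (hcomp p1 q1), be1; split=> // v.
    rewrite /= mulmxDl -!mulmxA !(mulmxA (i1 v)) !(mulmxA (i2 v)) e1 e21.
    by rewrite mul1mx mul0mx !mulmx0 addr0.
  by rewrite [RHS]bE /= mulmxDr !mulmxA tE bj1 bj2.
exists A2, (hadd (hcomp j2 i2) (hcomp t (hcomp j1 i1))), (hcomp p2 q2), be2; split=> // v.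
  rewrite /= mulmxDl -!mulmxA !(mulmxA (i1 v)) !(mulmxA (i2 v)) e2 e12.
  by rewrite mul1mx mul0mx !mulmx0 addr0.
by rewrite [RHS]bE /= mulmxDr !mulmxA tE bj1 bj2 addrC.
Qed.

Lemma preim_univ K X C (k : hom K X) (c : hom X C) N (j : hom N C)
    R (r : hom R X) (pi : hom R N) (i : hom K R) M (g : hom M X) (g' : hom M N) :
  ses k c -> ses i pi -> mono r -> (forall v, r v *m c v = pi v *m j v) ->
  (forall v, i v *m r v = k v) -> (forall v, g v *m c v = g' v *m j v) ->
  exists g'' : hom M R, forall v, g'' v *m r v = g v.
Proof.
move=> S Sr mr rc ir gg'; apply: (fac_mono mr) => v.
have [_ epi_pi _] := Sr; apply: (ses_le S); first by rewrite -ir submxMl.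
have /submxP[w wE] : (g' v <= pi v)%MS by rewrite submx_full.
by rewrite gg' wE rc -mulmxA submxMl.
Qed.

(* Choosing [S] in the socle and a second stable submodule [B], a uniform summand [A] of
   [R / S] containing [B] lifts to [R], contradicting indecomposability. *)
Lemma indec_unif R : indecomposable R -> dfc R = 0 -> unif R.
Proof.
move: {2}(tdim R).+1 (ltnSn (tdim R)) => n; elim: n R => // n IH R; rewrite ltnS => len iR dR.
have sR := indec_reg rad iR dR; split=> // B S b s sB sS mb ms.
apply: NNPP => nle.
have [Y [c Sc]] := ses_mono ms; have [_ ec cs] := Sc.
have sY : semist Y by apply: semist_quo Sc sR _; case: sS.
have ltY : (tdim Y < tdim R)%N by apply: (tdim_ses_lt Sc); case: sS.
have nbc : hnz (hcomp b c).
  apply: NNPP => /hnzPn e; apply: nle => v; rewrite -cs; apply/sub_kermxP; exact: e.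
have mbc := stab_mono sB sY nbc.
have small X : indecomposable X -> dfc X = 0 -> (tdim X <= tdim Y)%N -> unif X.
  by move=> iX dX leX; apply: IH => //; apply: leq_ltn_trans leX _; apply: leq_trans ltY len.
have [A [i [p [be [ip uA beE]]]]] := stab_summand small sY (leqnn _) sB mbc.
have mi : mono i by move=> v; apply/row_freeP; exists (p v).
have [RA [k [rho [s' [Ss mk kc s'k]]]]] := preim_ex Sc mi.
have [bA bAk] : exists bA : hom B RA, forall v, bA v *m k v = b v.
  by apply: (preim_univ Sc Ss mk kc s'k (g' := be)) => v; rewrite beE.
have bAr v : bA v *m rho v = be v.
  apply: (free_inj (mi v)); rewrite -mulmxA -kc mulmxA bAk beE //.
have mbe : mono be.
  by move=> v; apply: (@free_mull _ _ _ _ _ (i v)); rewrite beE; exact: mbc.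
have [t tE] : exists t : hom A RA, forall v, t v *m rho v = 1%:M.
  case: (classic (exists q : dext A S, dnz q)) => [[q nq]|nex]; last first.
    by apply: (dext_split Ss) => q nq; apply: nex; exists q.
  have [N [q' [sN nq']]] := dext_stab (proj1 uA) sS nq.
  (* A nonzero map from the stable N to A has the same image as B, the only stable submodule of A,
     and B lifts to [RA] by [bA]; so every map from N to A lifts. *)
  apply: (dual_split Ss (fun E => proj1 (stab_dual sN sS nq' E))) => g.
  case: (classic (hnz g)) => [ng|/hnzPn g0]; last first.
    by exists (hzero N RA) => v; rewrite g0 mul0mx.
  have mg := stab_mono sN (proj1 uA) ng.
  have [g' g'E] : exists g' : hom N B, forall v, g' v *m be v = g v.
    by apply: (fac_mono mbe) => v; apply: (proj2 uA).
  by exists (hcomp g' bA) => v /=; rewrite -mulmxA bAr g'E.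
have nA : nzero A by apply: (hnz_cod (f := be)); apply: mono_hnz => //; case: sB.
(* A is now a retract of R, so the projection is injective although it kills S. *)
have mp : mono (hcomp c p).
  apply: (indec_ret (i := hcomp t k) iR _ nA) => v /=.
  by rewrite mulmxA -(mulmxA (t v)) kc mulmxA tE mul1mx ip.
have nS : nzero S by case: sS.
have [v nv] := mono_hnz ms nS; move/eqP: nv; apply.
by apply: (free_inj (mp v)); rewrite /= mulmxA (ses0 Sc) !mul0mx.
Qed.

End Tubes.

(** * Decompositions and regular modules *)

Section Decomp.
Variables (Q : quiver) (F : finFieldType).
Implicit Types (s : seq (rep Q F)) (A B C M N S R X Y Z E : rep Q F) (v : qV Q) (a : qA Q).

Lemma dsum_iso M N M' N' : iso M M' -> iso N N' -> iso (dsum M N) (dsum M' N').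
Proof.
case=> f [f' [hf hf' ff' f'f]] [g [g' [hg hg' gg' g'g]]].
exists (fun v => block_mx (f v) 0 0 (g v)), (fun v => block_mx (f' v) 0 0 (g' v)).
by split=> v; rewrite /= !mulmx_block !mulmx0 !mul0mx !addr0 !add0r
  ?hf ?hf' ?hg ?hg' ?ff' ?f'f ?gg' ?g'g -?scalar_mx_block.
Qed.

Lemma is_zero_iso X : is_zero X -> iso X (zero_rep Q F).
Proof.
move=> zX; apply: (@iso_of_bij _ _ _ _ (hzero _ _)) => v.
  by rewrite /row_free mxrank0 zX.
by rewrite /row_full mxrank0.
Qed.

Fixpoint allp (P : rep Q F -> Prop) (s : seq (rep Q F)) : Prop :=
  if s is X :: s' then P X /\ allp P s' else True.

Lemma allp_nth (P : rep Q F -> Prop) s :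
  allp P s <-> forall i, (i < size s)%N -> P (nth (zero_rep Q F) s i).
Proof.
elim: s => [|X s IH] //=; split=> [[PX /IH Ps] [|i] //|Ps]; first by rewrite ltnS; apply: Ps.
by split; [apply: (Ps 0%N) | apply/IH => i lt; apply: (Ps i.+1)].
Qed.

Lemma allp_imp (P P' : rep Q F -> Prop) s : (forall X, P X -> P' X) -> allp P s -> allp P' s.
Proof. by move=> PP; elim: s => //= X s IH [/PP ? /IH ?]. Qed.

Lemma indec_summand X : nzero X -> exists Y (i : hom Y X) (p : hom X Y),
  indecomposable Y /\ forall v, i v *m p v = 1%:M.
Proof.
move: {2}(tdim X).+1 (ltnSn (tdim X)) => n; elim: n X => // n IH X; rewrite ltnS => len nX.
case: (classic (indecomposable X)) => [iX|/(not_indec nX)[Y [Z [iX nY nZ]]]].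
  by exists X, (hid X), (hid X); split=> // v; rewrite /= mulmx1.
have [i1 [_ [p1 [_ [ip _ _ _ _]]]]] := iso_biprod iX.
have tX : tdim X = (tdim Y + tdim Z)%N by rewrite (tdim_eq (iso_rdim iX)) /tdim -big_split.
have [|Y1 [i [p [iY1 e]]]] := IH Y _ nY; first by have := tdim_gt0 nZ; lia.
exists Y1, (hcomp i i1), (hcomp p1 p); split=> // v.
by rewrite /= mulmxA -(mulmxA (i v)) ip mulmx1 e.
Qed.

Lemma decomp_ex X : exists s, allp (@indecomposable Q F) s /\ iso X (bigsum s).
Proof.
move: {2}(tdim X).+1 (ltnSn (tdim X)) => n; elim: n X => // n IH X; rewrite ltnS => len.
case: (classic (is_zero X)) => [zX|nX]; first by exists [::]; split=> //; exact: is_zero_iso.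
have [Y [i [p [iY ip]]]] := indec_summand nX; have [K [_ [_ _ iX]]] := ret_dsum ip.
have tX : tdim X = (tdim Y + tdim K)%N by rewrite (tdim_eq (iso_rdim iX)) /tdim -big_split.
have [|s [a iK]] := IH K; first by have := tdim_gt0 (proj1 iY); lia.
exists (Y :: s); split=> //; apply: iso_trans iX _.
by apply: dsum_iso iK; exact: iso_refl.
Qed.

Variable delta : qV Q -> nat.
Hypothesis rad : forall v, cartan (ivec delta) (evec v) = 0.
Local Notation semist := (@semist Q F delta).
Local Notation stab := (@stab Q F delta).

Lemma semist_iso X Y : iso X Y -> semist X -> semist Y.
Proof.
move=> iX [dX le]; split=> [|N k mk]; first by rewrite -(dfc_eq (iso_rdim iX)).
have [f [mf _]] := iso_bij (iso_sym iX).
exact: le (mono_comp mk mf).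
Qed.

Lemma semist_bigsum s : allp semist s -> semist (bigsum s).
Proof.
elim: s => [_|X s IH [sX /IH ss]] /=; last exact: semist_dsum.
split=> [|N k mk]; first exact: dfc_zero.
by rewrite dfc_zero // => v; have := mono_le mk v; rewrite leqn0 => /eqP.
Qed.

Lemma semist_decomp s : semist (bigsum s) -> allp semist s.
Proof.
elim: s => //= X s IH sXs.
by have [sX ss] := semist_summand sXs (iso_refl _); split=> //; exact: IH.
Qed.

Lemma allp_and (P1 P2 : rep Q F -> Prop) s : allp P1 s -> allp P2 s -> allp (fun X => P1 X /\ P2 X) s.
Proof. by elim: s => //= X s IH [? ?] [? ?]; split=> //; exact: IH. Qed.

Lemma semist_regular X : semist X -> regular_module delta X.
Proof.
move=> sX; have [s [si iX]] := decomp_ex X; exists s; split=> //.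
have ss := semist_decomp (semist_iso iX sX).
apply/allp_nth; apply: allp_imp (allp_and si ss) => Y [iY [dY _]]; by split.
Qed.

Lemma regular_semist X : regular_module delta X -> semist X.
Proof.
case=> s [/allp_nth sr iX]; apply: semist_iso (iso_sym iX) _.
apply: semist_bigsum; apply: allp_imp sr => Y [iY dY]; exact: indec_reg.
Qed.

Lemma stab_indec S : stab S -> indecomposable S.
Proof.
move=> sS; have [nS dS neg] := sS; split=> // Y Z iS.
have [[dY _] [dZ _]] := semist_summand (stab_semist sS) iS.
have [i1 [i2 [p1 [p2 [e1 e2 e12 e21 e]]]]] := iso_biprod iS.
have m1 : mono i1 by move=> v; apply/row_freeP; exists (p1 v).
case: (classic (is_zero Y)) => [zY|nY]; first by left.
right; have := neg _ _ m1 nY; rewrite dY ltxx => h0.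
have ei : epi i1 by apply: NNPP => nei; have := h0 nei.
move=> v; apply: (@row_full0 _ _ _ (p2 v)); last by apply: (full_inj (ei v)); rewrite e12 mulmx0.
by apply/row_fullP; exists (i2 v).
Qed.

Lemma stab_regular_simple S : regular_simple delta S <-> stab S.
Proof.
split=> [[[iS dS] simp]|sS].
  have sS := indec_reg rad iS dS; split=> //; first by case: iS.
  move=> N k mk nN nek; rewrite lt_neqAle (proj2 sS _ _ mk) andbT; apply/eqP => dN.
  by case: (simp N k (@homP _ _ _ _ k) mk (semist_regular (semist_sub sS mk dN))).
have [nS dS neg] := sS; split; first by split=> //; exact: stab_indec.
move=> N k hk mk /regular_semist[dN _].
case: (classic (is_zero N)) => [zN|nN]; [by left | right].
apply: NNPP => nek; have := neg N (Hom hk) mk nN nek; by rewrite dN ltxx.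
Qed.

End Decomp.

(** * Modules with only submodules of negative defect *)

Section HomCount.
Variables (Q : quiver) (F : finFieldType).
Implicit Types (A B C K M N S R X Y Z E J : rep Q F) (v : qV Q) (a : qA Q).

Lemma h_ses_l K X C (k : hom K X) (c : hom X C) Y : ses k c -> (h X Y <= h K Y * h C Y)%N.
Proof.
move=> S; apply: leq_trans (card_fiber_le (res_fiber (Y := Y) S)) _.
by rewrite mulnC leq_mul2r max_card orbT.
Qed.

Lemma h_ses_l_lt K X C (k : hom K X) (c : hom X C) Y (f : hom K Y) : ses k c ->
  ~ (exists g : hom X Y, forall v, k v *m g v = f v) -> (h X Y < h K Y * h C Y)%N.
Proof.
move=> S nex; apply: leq_ltn_trans (card_fiber_le (res_fiber (Y := Y) S)) _.
rewrite mulnC ltn_pmul2r ?h_gt0 //.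
apply: (@leq_ltn_trans #|[set~ mh f]|); last by rewrite cardsC1 prednK // h_gt0.
apply: subset_leq_card; apply/subsetP => y /imsetP[g _ ->]; rewrite !inE.
apply/eqP => /mh_eq e; apply: nex; exists (hm g) => v; exact: e.
Qed.

Lemma h_ses_r K X C (k : hom K X) (c : hom X C) Y : ses k c -> (h Y X <= h Y K * h Y C)%N.
Proof.
move=> S; pose r (x : Hm Y X) : Hm Y C := mh (hcomp (hm x) c).
have fib y : (#|[set x | r x == y]| <= h Y K)%N.
  apply: (fiber_cover (g := fun f0 t => mh (hadd (hm f0) (hcomp (hm t) k)))) => f f0 /mh_eq fy.
  have [|t tE] := ses_fac (g := hsub (hm f) (hm f0)) S.
    by move=> v; rewrite hsubE mulmxBl; apply/eqP; rewrite subr_eq0; apply/eqP/fy.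
  exists (mh t); apply: hm_inj => v; rewrite hmK.
  change (hm f v = hm f0 v + hm (mh t) v *m k v).
  by rewrite hmK tE hsubE addrC subrK.
apply: leq_trans (card_fiber_le fib) _.
by rewrite leq_mul2l max_card orbT.
Qed.

(** Every Hom involving X is bounded by the product over the two terms, and one bound is strict: the
    identity of C does not extend to X, since this would split the sequence. The split E reaches the
    full product. *)
Lemma h_nonsplit X E N C (k' : hom C X) (c' : hom X N) (k : hom N E) (c : hom E C) (s : hom C E) :
  ses k c -> (forall v, s v *m c v = 1%:M) -> ses k' c' ->
  ~ (exists t : hom N X, forall v, t v *m c' v = 1%:M) -> (h X X < h E E)%N.
Proof.
move=> S sc S' ns; have [r kr sr] := sec_ret S sc.
have l1 : (h X X <= h X C * h X N)%N by exact: h_ses_r S'.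
have l2 : (h X N <= h C N * h N N)%N by exact: h_ses_l S'.
have l3 : (h X C < h C C * h N C)%N.
  apply: (h_ses_l_lt (f := hid C) S') => -[g gE]; apply: ns.
  by apply: (ret_sec (r := g) S').
have l4 Y : (h C Y * h N Y <= h E Y)%N.
  apply: (hhh_le (G := fun f g => hadd (hcomp c f) (hcomp r g))) => f g f' g' e.
  split=> v.
    have := congr1 (mulmx (s v)) (e v); rewrite /= !mulmxDr !mulmxA sc sr.
    by rewrite !mul1mx !mul0mx !addr0.
  have := congr1 (mulmx (k v)) (e v); rewrite /= !mulmxDr !mulmxA kr (ses0 S).
  by rewrite !mul1mx !mul0mx !add0r.
have l5 : (h E C * h E N <= h E E)%N.
  apply: (hhh_le (G := fun f g => hadd (hcomp f s) (hcomp g k))) => f g f' g' e.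
  split=> v.
    have := congr1 (mulmx^~ (c v)) (e v); rewrite /= !mulmxDl -!mulmxA sc (ses0 S).
    by rewrite !mulmx1 !mulmx0 !addr0.
  have := congr1 (mulmx^~ (r v)) (e v); rewrite /= !mulmxDl -!mulmxA sr kr.
  by rewrite !mulmx1 !mulmx0 !add0r.
apply: leq_trans l5; apply: leq_trans (leq_mul (l4 C) (l4 N)).
apply: leq_ltn_trans l1 _.
apply: (@leq_ltn_trans (h X C * (h C N * h N N))); first by rewrite leq_mul2l l2 orbT.
by rewrite ltn_pmul2r // muln_gt0 !h_gt0.
Qed.

Section Rad.
Variable delta : qV Q -> nat.
Hypothesis rad : forall v, cartan (ivec delta) (evec v) = 0.
Hypothesis pos : forall v, (0 < delta v)%N.
Local Notation dfc := (@dfc Q F delta).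
Local Notation Fneg := (@Fneg Q F delta).

(** A nonzero kernel and a nonzero image would each have defect at most -1, whereas their defects
    add up to -1. *)
Lemma fneg_mono A B (f : hom A B) : Fneg A -> dfc A = -1 -> Fneg B -> hnz f -> mono f.
Proof.
move=> FA dA FB nf; have [K [k [J [e [m [S mm fE kf]]]]]] := hfac_ex f.
have [mk ee _] := S.
have nJ := hnz_fac fE nf.
case: (classic (is_zero K)) => [zK|nK].
  have me := zero_ses_l S zK => v; rewrite fE; exact: (mono_comp me mm).
have := dfc_ses (delta := delta) S; have := FB _ _ mm nJ; have := FA _ _ mk nK.
by rewrite dA; lia.
Qed.

Lemma eu1_h A B : eu A B = 1 -> (1 < h A B)%N.
Proof.
move=> e; rewrite -(ltr_nat rat) euler_rat e expr1z.
by apply: lt_le_trans (q_gt1 F) _; rewrite ler_peMl ?ler1n ?z_gt0 // ltW ?q_gt0.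
Qed.

(** The Euler form depends on dimensions only, so it is 1 on (A, B) and forces a nonzero map; this
    map is injective between modules of equal dimension. *)
Lemma fneg_iso A B : Fneg A -> dfc A = -1 -> Fneg B -> (forall v, rdim A v = rdim B v) ->
  eu A A = 1 -> iso A B.
Proof.
move=> FA dA FB e eA.
have [f nf] : exists f : hom A B, hnz f.
  by apply: h_gt1_ex; apply: eu1_h; rewrite -eA; apply: eu_eq.
have mf := fneg_mono FA dA FB nf.
exact: iso_of_bij mf (mono_epi mf e).
Qed.

(** Nonzero endomorphisms are injective, so End A would act faithfully on a nonzero [p] and give h
    <= z, whereas Euler form 1 means h = q z. *)
Lemma fneg_rigid A : Fneg A -> dfc A = -1 -> eu A A = 1 ->
  (forall p : dext A A, ~ dnz p) /\ h A A = #|F|.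
Proof.
move=> FA dA eA.
have nz : forall p : dext A A, ~ dnz p.
  move=> p [a pa].
  have le : (h A A <= z A A)%N.
    apply: (hz_le (G := fun u => dcompr p u)) => f g e v.
    apply: (hom_eq _ v) => nf.
    have mf := fneg_mono FA dA FA nf.
    by move/eqP: pa; apply; apply: (free_inj (mf (qs a))); rewrite mul0mx dcompr_eq.
  move: le; rewrite -(ler_nat rat) euler_rat eA expr1z.
  by rewrite ger_pMr ?ltr0n ?z_gt0 // leNgt q_gt1.
split=> //; apply/eqP; rewrite -(eqr_nat rat) euler_rat eA expr1z.
by rewrite (z_le1 nz) mul1r.
Qed.

Lemma fneg_comp A B (f : hom A B) : mono f -> Fneg B -> Fneg A.
Proof. by move=> mf FB N k mk; apply: FB (mono_comp mk mf). Qed.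

Hypothesis conn : connected_quiver Q.

Lemma rad_rat v : 2 * (delta v)%:R =
  \sum_a (delta (qs a))%:R * (qt a == v)%:R + \sum_a (qs a == v)%:R * (delta (qt a))%:R :> rat.
Proof.
have e : (delta v)%:Z + (delta v)%:Z = \sum_a (delta (qs a))%:Z * (qt a == v)%:R
      + \sum_a (qs a == v)%:R * (delta (qt a))%:Z :> int.
  have := rad v; rewrite /cartan /euler /ivec /evec.
  rewrite (bigD1 v) //= big1; last by move=> w /negPf ->; rewrite mulr0.
  rewrite [in X in _ + X](bigD1 v) //= (big1 _ (fun w => w != v)); last by move=> w /negPf ->; rewrite mul0r.
  by rewrite eqxx !addr0 mulr1 mul1r; lia.
have := congr1 (fun n : int => n%:~R : rat) e.
rewrite !intrD !mulrz_sumr mulr_natl mulr2n /= => ->.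
by congr (_ + _); apply: eq_bigr => a _; rewrite rmorphM /= rmorph_nat.
Qed.

(** The classical completion of squares along a positive radical vector: the Tits form is
    nonnegative, and it vanishes only where the ratio to [delta] is constant along arrows. *)
Lemma quad_form X : 2 * (eu X X)%:~R = \sum_a (delta (qs a))%:R * (delta (qt a))%:R *
   ((rdim X (qs a))%:R / (delta (qs a))%:R - (rdim X (qt a))%:R / (delta (qt a))%:R) ^+ 2 :> rat.
Proof.
have d0 v : (delta v)%:R != 0 :> rat by rewrite pnatr_eq0 -lt0n.
have E a : (delta (qs a))%:R * (delta (qt a))%:R *
   ((rdim X (qs a))%:R / (delta (qs a))%:R - (rdim X (qt a))%:R / (delta (qt a))%:R) ^+ 2
   = (\sum_v (rdim X v)%:R ^+ 2 / (delta v)%:R * ((delta (qs a))%:R * (qt a == v)%:R) +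
     \sum_v (rdim X v)%:R ^+ 2 / (delta v)%:R * ((qs a == v)%:R * (delta (qt a))%:R)) -
     2 * ((rdim X (qs a))%:R * (rdim X (qt a))%:R) :> rat.
  rewrite (bigD1 (qt a)) //= big1 => [|v /negPf nv]; last by rewrite eq_sym nv mulr0 mulr0.
  rewrite (bigD1 (qs a)) //= big1 => [|v /negPf nv]; last by rewrite eq_sym nv mul0r mulr0.
  rewrite !eqxx mulr1 mul1r !addr0.
  have := d0 (qs a); have := d0 (qt a).
  move: (rdim X _)%:R (rdim X _)%:R (delta _)%:R (delta _)%:R => x y dt ds dt0 ds0.
  by field; rewrite ?dt0 ?ds0.
rewrite (eq_bigr _ (fun a _ => E a)) sumrB big_split /=.
rewrite [X in X + _ - _]exchange_big [X in _ + X - _]exchange_big /= -big_split /=.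
rewrite (eq_bigr (fun v => 2 * (rdim X v)%:R ^+ 2)); last first.
  move=> v _; rewrite -!big_distrr /= -mulrDr -rad_rat; field; exact: d0.
rewrite -!big_distrr /= -mulrBr; congr (2 * _).
rewrite /eu /euler /ivec intrB !mulrz_sumr /=.
by congr (_ - _); apply: eq_bigr => x _; rewrite -PoszM -pmulrn natrM.
Qed.

(** If the form vanished, connectedness would make the ratio to [delta] constant, hence zero because
    it is zero at [i]. *)
Lemma eu_pos X i : rdim X i = 0%N -> nzero X -> 1 <= eu X X.
Proof.
move=> xi nX; rewrite -gtz0_ge1 lt_neqAle; apply/andP; split; last first.
  rewrite -(ler0z rat) -(pmulr_rge0 (x := 2)) // quad_form.
  by apply: sumr_ge0 => a _; rewrite mulr_ge0 ?sqr_ge0 // -natrM ler0n.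
apply/negP => /eqP e; apply: nX.
have d0 v : (delta v)%:R != 0 :> rat by rewrite pnatr_eq0 -lt0n.
have := quad_form X; rewrite -e mulr0 => /esym/eqP.
rewrite psumr_eq0 => [/allP z0|a _]; last by rewrite mulr_ge0 ?sqr_ge0 // -natrM ler0n.
pose u v : rat := (rdim X v)%:R / (delta v)%:R.
have uE a : u (qs a) = u (qt a).
  have := z0 a (mem_index_enum _); rewrite !mulf_eq0 !(negPf (d0 _)) /= orbb subr_eq0.
  by move/eqP.
have u0 v : u v = 0.
  have : connect (@edge_rel Q) i v by exact: conn.
  case/connectP => p; elim: p i xi => [|w p IH] j xj /=; first by move=> _ ->; rewrite /u xj mul0r.
  case/andP => jw pp lst; apply: (IH w) => //.
  have uw : u w = u j.
    case/orP: jw => /existsP[a /andP[/eqP <- /eqP <-]]; [exact/esym/uE | exact: uE].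
  move/eqP: uw; rewrite /u xj mul0r mulf_eq0 invr_eq0 (negPf (d0 _)) orbF pnatr_eq0.
  by move/eqP.
move=> v; have /eqP := u0 v.
by rewrite /u mulf_eq0 invr_eq0 (negPf (d0 _)) orbF pnatr_eq0 => /eqP.
Qed.

Lemma ex_least (P : nat -> Prop) : (exists n, P n) -> exists2 n, P n & forall m, P m -> (n <= m)%N.
Proof.
case=> n Pn; apply: NNPP => nex.
suff: forall k m, (m < k)%N -> ~ P m by move/(_ n.+1 n (ltnSn n)).
elim=> // k IH m lt Pm; apply: nex; exists m => // l Pl.
by rewrite leqNgt; apply/negP => lm; apply: (IH l) => //; apply: leq_trans lm _.
Qed.

(* Gabriel's argument: a representation of dimension [d] with the fewest endomorphisms. *)
Lemma fneg_ex (d : qV Q -> nat) i : d i = 0%N ->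
  eu (Erep F d) (Erep F d) = 1 -> dfc (Erep F d) = -1 ->
  exists M, (forall v, rdim M v = d v) /\ Fneg M.
Proof.
move=> di qd dd.
have [_ [E [dE <-]] min] : exists2 n, (fun n => exists E, (forall v, rdim E v = d v) /\ h E E = n) n
    & forall m, (exists E, (forall v, rdim E v = d v) /\ h E E = m) -> (n <= m)%N.
  by apply: ex_least; exists (h (Erep F d) (Erep F d)), (Erep F d).
exists E; split=> //.
have [N [k [C [c [s [S sc FC zCN max]]]]]] := max_split rad E.
have [mk ec kc] := S.
case: (classic (is_zero N)) => [zN|nN]; first exact: fneg_comp (zero_ses_l S zN) FC.
have dfE : dfc E = -1 by rewrite -dd; exact: dfc_eq.
case: (classic (is_zero C)) => [zC|nC].
  have [] := max _ _ (mono_zero E); rewrite (dfc_zero (M := zero_rep Q F)) //.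
  have -> : dfc N = dfc E by rewrite (dfc_ses S) (dfc_zero zC) addr0.
  by rewrite dfE.
(* A nonsplit extension in the other direction has the same dimension and, by [h_nonsplit], fewer
   endomorphisms, against minimality. *)
have nNC : forall p : dext N C, ~ dnz p.
  move=> p /dext_nonsplit[X [k' [c' [S' dX ns]]]].
  have := h_nonsplit S sc S' ns; rewrite ltnNge min //; exists X; split=> // v.
  by rewrite dX -dE (ses_dim S) addnC.
have Ei : rdim E i = 0%N by rewrite dE.
have := ses_dim S i; rewrite Ei => /esym/eqP; rewrite addn_eq0 => /andP[/eqP Ni /eqP Ci].
(* Both cross terms are nonnegative and both squares at least 1, so the form would be at least 2 on
   E. *)
have := eu_ge0 (z_le1 nNC); have := eu_ge0 (z_le1 zCN); have := eu_pos Ni nN; have := eu_pos Ci nC.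
have : eu E E = 1 by rewrite -qd; apply: eu_eq.
rewrite (eu_addl E (ses_dim S)) (eu_addr N (ses_dim S)) (eu_addr C (ses_dim S)).
by lia.
Qed.

End Rad.
End HomCount.

(** * Spanning families of Hom spaces *)

Section HomBasis.
Variables (Q : quiver) (F : finFieldType).
Implicit Types (M N X : rep Q F) (v : qV Q) (a : qA Q).

Lemma hlin_subproof M X k (w : 'I_k -> hom M X) (c : 'rV[F]_k) :
  @is_hom Q F M X (fun v => \sum_j c 0 j *: w j v).
Proof.
move=> a; rewrite mulmx_sumr mulmx_suml; apply: eq_bigr => j _.
by rewrite -scalemxAr -scalemxAl homE.
Qed.
Definition hlin M X k (w : 'I_k -> hom M X) c := Hom (hlin_subproof w c).

(** Only the cardinality is known: a maximal independent family spans, and comparing powers of #|F|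
    gives its length. *)
Lemma hom_basis M X n : h M X = (#|F| ^ n)%N ->
  exists w : 'I_n -> hom M X, forall f : hom M X, exists c : 'rV[F]_n, forall v, f v = hlin w c v.
Proof.
have q1 := card_finNzRing_gt1 F.
have cr k : #|{: 'rV[F]_k}| = (#|F| ^ k)%N by rewrite card_mx mul1n.
move=> hq; pose P k := exists w : 'I_k -> hom M X,
  forall c : 'rV[F]_k, (forall v, hlin w c v = 0) -> c = 0.
have le k (w : 'I_k -> hom M X) : (forall c : 'rV[F]_k, (forall v, hlin w c v = 0) -> c = 0) -> (k <= n)%N.
  move=> wi; rewrite -(leq_exp2l _ _ q1) -cr -hq.
  apply: (leq_card (fun c => mh (hlin w c))) => c d /mh_eq e.
  apply/eqP; rewrite -subr_eq0; apply/eqP/wi => v.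
  transitivity (hlin w c v - hlin w d v); last by rewrite e subrr.
  by rewrite /= -sumrB; apply: eq_bigr => j _; rewrite !mxE scalerBl.
have [||k [w wi] max] := @ex_max P n.
- by exists 0%N, (fun=> hzero M X) => c _; apply/matrixP => ? [].
- by move=> k [w wi]; exact: le wi.
have span (f : hom M X) : exists c : 'rV[F]_k, forall v, f v = hlin w c v.
  apply: NNPP => nex; have := max k.+1; rewrite ltnn => mx.
  suff: false by []. apply: mx.
  exists (fun j : 'I_k.+1 => if unlift ord0 j is Some j' then w j' else f) => c c0.
  have E v : c 0 ord0 *: f v + hlin w (\row_j c 0 (lift ord0 j)) v = 0.
    rewrite -[RHS](c0 v) /= big_ord_recl unlift_none; congr (_ + _).
    by apply: eq_bigr => j _; rewrite liftK mxE.
  case: (eqVneq (c 0 ord0) 0) => [c00|cn].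
    have /matrixP ci : (\row_j c 0 (lift ord0 j)) = 0 :> 'rV[F]_k.
      by apply: wi => v; have := E v; rewrite c00 scale0r add0r.
    apply/rowP => j; rewrite mxE; case: (unliftP ord0 j) => [j'|] -> //.
    by have := ci 0 j'; rewrite !mxE.
  case: nex; exists (- (c 0 ord0)^-1 *: \row_j c 0 (lift ord0 j)) => v.
  have /eqP := E v; rewrite addr_eq0 => /eqP e.
  rewrite -[LHS](scalerK cn) e scalerN -scaleNr /= scaler_sumr.
  by apply: eq_bigr => j _; rewrite [in RHS]mxE scalerA.
have kn : (n <= k)%N.
  rewrite -(leq_exp2l _ _ q1) -hq -cr.
  apply: (@leq_trans #|(fun c => mh (hlin w c)) @: [set: 'rV[F]_k]|); last first.
    by apply: leq_trans (leq_imset_card _ _) _; rewrite cardsT.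
  rewrite /h -cardsT; apply: subset_leq_card; apply/subsetP => g _.
  have [c cE] := span (hm g); apply/imsetP; exists c => //.
  by apply: hm_inj => v; rewrite hmK cE.
have ek : k = n by apply/eqP; rewrite eqn_leq (le _ _ wi) kn.
by subst k; exists w.
Qed.

End HomBasis.

(** * Modules of dimension n delta - dim I at a source *)

Section Source.
Variables (Q : quiver) (F : finFieldType) (delta : qV Q -> nat).
Implicit Types (C M N R X Y Z E J : rep Q F) (v : qV Q) (a : qA Q).
Hypothesis rad : forall v, cartan (ivec delta) (evec v) = 0.
Hypothesis pos : forall v, (0 < delta v)%N.
Hypothesis conn : connected_quiver Q.
Local Notation dfc := (@dfc Q F delta).
Local Notation Fneg := (@Fneg Q F delta).
Local Notation q := (#|F|%:R : rat).
Variable i : qV Q.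
Hypothesis src : forall a, qt a != i.
Hypothesis di : delta i = 1%N.

Definition is_I (I : rep Q F) := forall v, rdim I v = (v == i).
(** Written additively to avoid truncated subtraction. *)
Definition dim_src n (P : rep Q F) := forall v, (rdim P v + (v == i) = n * delta v)%N.

Lemma eu_I_r X I : is_I I -> eu X I = (rdim X i)%:Z.
Proof.
move=> dI; rewrite /eu /euler /ivec (bigD1 i) //= big1 ?addr0; last first.
  by move=> v nv; rewrite dI (negPf nv) mulr0.
by rewrite dI eqxx mulr1 big1 ?subr0 // => a _; rewrite dI (negPf (src a)) mulr0.
Qed.

Lemma dfc_I I : is_I I -> dfc I = 1.
Proof. by move=> dI; rewrite -eu_Erep_l eu_I_r //= di. Qed.

Lemma dfc_delta n X : (forall v, rdim X v = n * delta v)%N -> dfc X = 0.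
Proof.
move=> dX; rewrite -eu_Erep_l (eu_mul_r (Y := Erep F delta) _ dX).
have := eu_Erep_r rad (Erep F delta); rewrite -eu_Erep_l => e.
suff -> : eu (Erep F delta) (Erep F delta) = 0 by rewrite mulr0.
by move: e; lia.
Qed.

Let E1 := Erep F (fun v => (v == i) : nat).
Let Ed n := Erep F (fun v => (n * delta v)%N).
Lemma E1I : is_I E1. Proof. by []. Qed.

Lemma dim_srcE n P v : dim_src n P -> rdim (Ed n) v = (rdim P v + rdim E1 v)%N.
Proof. by move=> dP; rewrite /= dP. Qed.

Lemma src_i n P : dim_src n P -> (rdim P i).+1 = n.
Proof. by move=> /(_ i); rewrite eqxx di muln1 addn1. Qed.

Lemma src_dfc n P : dim_src n P -> dfc P = -1.
Proof.
move=> dP; have := eu_addr (Erep F delta) (fun v => dim_srcE v dP).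
by rewrite !eu_Erep_l (dfc_I E1I) (@dfc_delta n (Ed n) (fun=> erefl)); lia.
Qed.

Lemma src_eu_l n P X : dim_src n P -> eu X P = - (n%:Z * dfc X) - (rdim X i)%:Z.
Proof.
move=> dP; have := eu_addr X (fun v => dim_srcE v dP).
by rewrite (eu_I_r _ E1I) (eu_Erep_mul rad); lia.
Qed.

Lemma src_eu n P : dim_src n P -> eu P P = 1.
Proof. by move=> dP; rewrite (src_eu_l P dP) (src_dfc dP) -(src_i dP); lia. Qed.

Lemma src_M : exists M, dim_src 1 M /\ Fneg M.
Proof.
pose d v := (delta v - (v == i))%N.
have dd v : (d v + (v == i) = 1 * delta v)%N.
  by rewrite mul1n subnK //; case: (v == i); rewrite ?pos.
have sE : dim_src 1 (Erep F d) by exact: dd.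
have [|M [dM FM]] := fneg_ex rad pos conn (i := i) _ (src_eu sE) (src_dfc sE).
  by rewrite /d eqxx di.
by exists M; split=> // v; rewrite dM.
Qed.

Variables (M : rep Q F).
Hypothesis sM : dim_src 1 M.
Hypothesis FM : Fneg M.

Lemma M_i : rdim M i = 0%N.
Proof. by have := src_i sM => -[]. Qed.
Lemma M_rows m (x : 'M[F]_(rdim M i, m)) : x = 0.
Proof. exact: mx_rows0 M_i. Qed.

Lemma M_dim n P v : dim_src n P -> v != i -> rdim P v = (n * rdim M v)%N.
Proof.
by move=> dP /negPf nv; have := dP v; have := sM v; rewrite nv !addn0 mul1n => -> ->.
Qed.

(** The trace of M in X, at one vertex. *)
Definition gspan X v := (\sum_(f : Hm M X) <<hm f v>>)%MS.
Lemma gspan_sub X (f : hom M X) v : (f v <= gspan X v)%MS.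
Proof. by rewrite /gspan (bigD1 (mh f)) // (submx_trans _ (addsmxSl _ _)) // genmxE hmK. Qed.
Lemma gspan_le X v m (U : 'M[F]_(m, _)) : (forall f : hom M X, f v <= U)%MS -> (gspan X v <= U)%MS.
Proof. by move=> le; apply/sumsmx_subP => f _; rewrite genmxE. Qed.

Lemma gspan_sfam X : sfam (gspan X).
Proof.
move=> a; rewrite sumsmxMr_gen; apply/sumsmx_subP => f _.
by rewrite genmxE (eqmxMr _ (genmxE _)) -homE (submx_trans (submxMl _ _)) // gspan_sub.
Qed.

(* [P], restricted to the vertices other than [i], is a direct sum of copies of [M]:
   with [J] the part generated by [M] and [C] the cokernel, rigidity of [P] gives
   Ext(P', C) = 0, while <P', C> <= 0, so that the epimorphism P' -> C vanishes. *)
Lemma src_gen n P : dim_src n P -> Fneg P ->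
  h M P = (#|F| ^ n)%N /\ forall v, v != i -> row_full (gspan P v).
Proof.
move=> sP FP.
have [zPP hPP] := fneg_rigid FP (src_dfc sP) (src_eu sP).
have [zMM hMM] := fneg_rigid FM (src_dfc sM) (src_eu sM).
have [J [j mj jE]] := sub_ex (@gspan_sfam P).
have facJ (f : hom M P) : exists f' : hom M J, forall v, f' v *m j v = f v.
  by apply: (fac_mono mj) => v; rewrite jE gspan_sub.
(* Each map M -> J carries [p] into the dual of Ext(M, M), which is zero, and the images of these
   maps generate J. *)
have zMJ : forall p : dext M J, ~ dnz p.
  move=> p [a pa]; move/eqP: pa; apply.
  have f0 (f : hom M J) : f (qt a) *m p a = 0.
    exact: (dnzPn (zMM (dcompl p f)) a).
  have : (j (qt a) <= kermx (p a) *m j (qt a))%MS.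
    rewrite jE; apply: gspan_le => f; have [f' <-] := facJ f.
    by apply: submxMr; apply/sub_kermxP.
  case/submxP=> w; rewrite mulmxA -{1}[j _]mul1mx => /(free_inj (mj _)) e.
  by rewrite -[p a]mul1mx e -mulmxA mulmx_ker mulmx0.
have hMJ : (h M P <= h M J)%N.
  apply: (h_le_factor (G := fun f => hcomp f j)) => [f g e v /=|f]; first by rewrite e.
  by have [f' f'E] := facJ f; exists f'.
have euMP : eu M P = n%:Z by rewrite (src_eu_l M sP) (src_dfc sM) M_i; lia.
have euMJ : n%:Z <= eu M J.
  have : (h M P)%:R <= (h M J)%:R :> rat by rewrite ler_nat.
  rewrite !euler_rat (z_le1 zMJ) mul1r euMP => le.
  rewrite -(ler_eXz2l (q_gt1 F)); apply: le_trans le.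
  by rewrite ler_peMl ?ler1n ?z_gt0 // exprz_ge0 // ltW // q_gt0.
(* The vertices other than [i] carry a submodule because no arrow ends at [i]. *)
pose U v : 'M[F]_(rdim P v) := if v == i then 0 else 1%:M.
have sU : sfam U by move=> a; rewrite /U (negPf (src _)) submx1.
have [P' [k mk kE]] := sub_ex sU.
have P'i : rdim P' i = 0%N by rewrite -(mono_rank mk) kE /U eqxx mxrank0.
have kfull v : v != i -> row_full (k v).
  by move=> nv; rewrite -sub1mx kE /U (negPf nv).
have dP' v : rdim P' v = (n * rdim M v)%N.
  case: (eqVneq v i) => [->|nv]; first by rewrite P'i M_i muln0.
  by rewrite -(M_dim sP nv) -(mono_rank mk); apply/eqP; exact: kfull.
have [j' j'E] : exists j' : hom J P', forall v, j' v *m k v = j v.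
  apply: (fac_mono mk) => v; rewrite jE kE /U; case: eqVneq => [->|_]; last exact: submx1.
  by apply: gspan_le => f; rewrite [f i]M_rows sub0mx.
have mj' : mono j' by move=> v; apply: (@free_mull _ _ _ _ _ (k v)); rewrite j'E.
have [C [c Sc]] := ses_mono mj'; have [_ ec _] := Sc.
have zP'P' : forall p : dext P' P', ~ dnz p.
  move=> p [a0 pa]; move/eqP: pa; apply.
  have [r kr rk] : exists2 r : forall v, 'M[F]_(rdim P v, rdim P' v),
      forall v, k v *m r v = 1%:M & forall v, v != i -> r v *m k v = 1%:M.
    exists (fun v => pinvmx (k v)) => v; first by rewrite mulmxVp.
    by move=> nv; rewrite mulVpmx ?kfull.
  (* [r] carries [p] from the dual of Ext(P', P') to that of Ext(P', P). It inverts [k] away from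
     [i], and an arrow leaving [i] contributes nothing because P' vanishes there. *)
  have P0 g : zpair g (fun a => r (qt a) *m p a) = 0.
    rewrite -[RHS](dP p (fun v => g v *m r v)); apply: eq_bigr => a _.
    rewrite mulmxA; congr (\tr (_ *m _)); rewrite mulmxBl -!mulmxA; congr (_ - _).
    case: (eqVneq (qs a) i) => [e|ns].
      by rewrite (mx_rows0 (g (qs a))) ?mul0mx // e P'i.
    congr (_ *m _); rewrite -[rmap P a]mul1mx -(rk _ ns) -!mulmxA (mulmxA (k _)) -homE -!mulmxA kr.
    by rewrite mulmx1.
  have := dnzPn (zPP (dcompr (Dext P0) k)) a0 => /= e.
  have {}e : r (qt a0) *m p a0 = 0 by apply: (free_inj (mk _)); rewrite mul0mx.
  by rewrite -[p a0]mul1mx -(kr (qt a0)) -mulmxA e mulmx0.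
have zP'C : forall p : dext P' C, ~ dnz p.
  move=> p [a pa]; have := dnzPn (zP'P' (dcompl p c)) a => /= e.
  by move/eqP: pa; apply; apply: (full_inj (ec (qt a))); rewrite e mulmx0.
(* The Euler form of M is at least [n] on J and equal to [n] on P'. *)
have eMC : eu M C <= 0.
  have := eu_addr M (ses_dim Sc); rewrite (eu_mul_r M dP') (src_eu sM); lia.
have zC : is_zero C.
  apply: NNPP => nC; have := h_gt1 (epi_hnz ec nC).
  rewrite -(ltr_nat rat) euler_rat (z_le1 zP'C) mul1r ltNge => /negP; apply.
  rewrite -(expr0z q) ler_eXz2l ?q_gt1 // (eu_mul_l C dP').
  by rewrite mulr_ge0_le0.
have ej' := zero_ses_r Sc zC.
have full (m p r : nat) (x : 'M[F]_(m, p)) (y : 'M[F]_(p, r)) :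
    row_full x -> row_full y -> row_full (x *m y).
  move=> /row_fullP[x' x'x] /row_fullP[y' y'y]; apply/row_fullP; exists (y' *m x').
  by rewrite -mulmxA (mulmxA x') x'x mul1mx.
split.
  have eJ : eu M J = n%:Z.
    rewrite -[RHS]mulr1 -(src_eu sM) -(eu_mul_r M dP'); apply: eu_eq => // v.
    by rewrite -(mono_rank mj') (epi_rank ej').
  apply/eqP; rewrite eqn_leq; apply/andP; split.
    apply: leq_trans hMJ _; rewrite -(ler_nat rat) euler_rat (z_le1 zMJ) mul1r eJ.
    by rewrite natrX.
  rewrite -(ler_nat rat) euler_rat euMP natrX -exprnP.
  by rewrite ler_peMl ?ler1n ?z_gt0 // exprn_ge0 // ler0n.
move=> v nv; rewrite -sub1mx -jE sub1mx -j'E.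
exact: full (ej' v) (kfull v nv).
Qed.

End Source.

(** * The Kronecker pencil of a module *)

Section Kronecker.
Variables (Q : quiver) (F : finFieldType) (delta : qV Q -> nat).
Implicit Types (K N Y : rep Q F) (v : qV Q) (a : qA Q).
Hypothesis rad : forall v, cartan (ivec delta) (evec v) = 0.
Hypothesis pos : forall v, (0 < delta v)%N.
Local Notation dfc := (@dfc Q F delta).
Variable i : qV Q.
Hypothesis src : forall a, qt a != i.
Hypothesis di : delta i = 1%N.
Variable (M X : rep Q F).
Hypothesis sM : dim_src delta i 1 M.
Local Notation n := (rdim X i).
Hypothesis dX : forall v, rdim X v = (n * delta v)%N.
Variable w : 'I_n -> hom M X.
Hypothesis wspan : forall f : hom M X, exists c : 'rV[F]_n, forall v, f v = hlin w c v.
Hypothesis gX : forall v, v != i -> row_full (gspan M X v).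

Lemma M_delta v : v != i -> rdim M v = delta v.
Proof. by move=> /negPf nv; have := sM v; rewrite nv addn0 mul1n. Qed.

(* Coordinates: the row vector of [C : 'M_(n, rdim M v)] is sent to sum_j (row j C) w_j. *)
Definition Om v : 'M[F]_(n * rdim M v, rdim X v) :=
  \sum_j lin1_mx (row j \o @vec_mx F n (rdim M v)) *m w j v.

Lemma OmE v (C : 'M[F]_(n, rdim M v)) : mxvec C *m Om v = \sum_j row j C *m w j v.
Proof.
rewrite /Om mulmx_sumr; apply: eq_bigr => j _.
by rewrite mulmxA mul_rV_lin1 /= mxvecK.
Qed.

Lemma Om_full v : v != i -> row_full (Om v).
Proof.
move=> nv; rewrite -sub1mx; apply: submx_trans (_ : (gspan M X v <= _)%MS); first by rewrite sub1mx gX.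
apply: gspan_le => f; have [c ->] := wspan f; apply/row_subP => s.
apply/submxP; exists (mxvec (c^T *m delta_mx 0 s)).
rewrite OmE /= rowE mulmx_sumr; apply: eq_bigr => j _.
rewrite -scalemxAr scalemxAl; congr (_ *m _).
by apply/rowP => x; rewrite !mxE big_ord1 !mxE.
Qed.

Lemma Om_free v : v != i -> row_free (Om v).
Proof.
move=> nv; have := Om_full nv; rewrite /row_full /row_free => /eqP ->.
by rewrite dX M_delta.
Qed.

(** In coordinates, [Tl] is D tensor the identity of M, and [Nr] below is the identity tensor an
    arrow of M; hence they commute. *)
Definition Tl m m' v (D : 'M[F]_(m, m')) : 'M[F]_(m' * rdim M v, m * rdim M v) := lin_mulmx D.
Lemma TlE m m' v (D : 'M[F]_(m, m')) (C : 'M_(m', rdim M v)) : mxvec C *m Tl v D = mxvec (D *m C).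
Proof. by rewrite mul_vec_lin. Qed.

Definition Nr m a : 'M[F]_(m * rdim M (qs a), m * rdim M (qt a)) := lin_mulmxr (rmap M a).
Lemma NrE m a (C : 'M_(m, _)) : mxvec C *m Nr m a = mxvec (C *m rmap M a).
Proof. by rewrite mul_vec_lin. Qed.

Lemma mxvec_inj_r m p r (x y : 'M[F]_(m * p, r)) :
  (forall C : 'M_(m, p), mxvec C *m x = mxvec C *m y) -> x = y.
Proof.
move=> e; apply/row_matrixP => j; rewrite !rowE; have := e (vec_mx (delta_mx 0 j)).
by rewrite !vec_mxK.
Qed.

Lemma Nr_Tl m m' a (D : 'M[F]_(m, m')) : Nr m' a *m Tl (qt a) D = Tl (qs a) D *m Nr m a.
Proof. by apply: mxvec_inj_r => C; rewrite !mulmxA NrE !TlE NrE mulmxA. Qed.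

Lemma Om_map a : Om (qs a) *m rmap X a = Nr n a *m Om (qt a).
Proof.
apply: mxvec_inj_r => C; rewrite !mulmxA NrE !OmE mulmx_suml; apply: eq_bigr => j _.
by rewrite -mulmxA -homE mulmxA row_mul.
Qed.

(** The arrow map of X in the coordinates [Om] at its target, locked against unfolding. *)
Definition Ya a : 'M[F]_(rdim X (qs a), n * rdim M (qt a)) :=
  locked (rmap X a *m pinvmx (Om (qt a))).
Lemma YaE a : Ya a *m Om (qt a) = rmap X a.
Proof. by rewrite /Ya -lock mulmxKpV // submx_full // Om_full. Qed.

Definition Ec p (s : 'I_p) : 'M[F]_(n * p, n) := lin1_mx (trmx \o col s \o @vec_mx F n p).
Lemma EcE p (s : 'I_p) (C : 'M[F]_(n, p)) : mxvec C *m Ec s = (col s C)^T.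
Proof. by rewrite mul_rV_lin1 /= mxvecK. Qed.

Lemma Ec_inj p m (x y : 'M[F]_(m, n * p)) : (forall s : 'I_p, x *m Ec s = y *m Ec s) -> x = y.
Proof.
move=> e; apply/row_matrixP => j; rewrite -[row j x]vec_mxK -[row j y]vec_mxK; congr mxvec.
apply/matrixP => r s; have := congr1 (fun z => row j z 0 r) (e s).
by rewrite /= !row_mul -[row j x]vec_mxK -[row j y]vec_mxK !EcE !vec_mxK !mxE.
Qed.

Lemma Ec_Tl v (s : 'I_(rdim M v)) (D : 'M[F]_n) : Tl v D^T *m Ec s = Ec s *m D.
Proof.
apply: mxvec_inj_r => C; rewrite !mulmxA TlE !EcE -[D in RHS]trmxK -trmx_mul.
by rewrite !colE mulmxA.
Qed.

Definition ca a (s : 'I_(rdim M (qt a))) : 'M[F]_(rdim X (qs a), n) := locked (Ya a *m Ec s).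

(* The identity of [X_i], seen as a matrix indexed by an arbitrary vertex. *)
Definition idl v : 'M[F]_(n, rdim X v) := if v == i then pid_mx n else 0.
Definition idr v : 'M[F]_(rdim X v, n) := if v == i then pid_mx n else 0.
Lemma idl_i : idl i = 1%:M. Proof. by rewrite /idl eqxx pid_mx_1. Qed.
Lemma idr_i : idr i = 1%:M. Proof. by rewrite /idr eqxx pid_mx_1. Qed.
Lemma idr_idl v : v = i -> idr v *m idl v = 1%:M.
Proof. by move=> ->; rewrite idl_i idr_i mulmx1. Qed.
Lemma idl_comm v (g : forall v, 'M[F]_(rdim X v)) : v = i -> g i *m idl v = idl v *m g v.
Proof. by move=> ->; rewrite idl_i mulmx1 mul1mx. Qed.

(* One matrix [Al l] for each arrow leaving [i] and each basis vector of [M] at its target;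
   the radical equation at [i] leaves exactly two of them, the Kronecker pencil of [X]. *)
Definition Lab := {a : qA Q & 'I_(rdim M (qt a))}.
Definition Al (l : Lab) : 'M[F]_n := locked (idl (qs (tag l)) *m ca (tagged l)).

Lemma caE a (s : 'I_(rdim M (qt a))) : ca s = Ya a *m Ec s. Proof. by rewrite /ca -lock. Qed.
Lemma AlE a (s : 'I_(rdim M (qt a))) :
  Al (Tagged (fun a => 'I_(rdim M (qt a))) s) = idl (qs a) *m ca s.
Proof. by rewrite /Al -lock. Qed.
Lemma idl0 v : v != i -> idl v = 0. Proof. by move=> /negPf nv; rewrite /idl nv. Qed.

Lemma card_Lab : #|[set l : Lab | qs (tag l) == i]| = 2.
Proof.
rewrite -sum1dep_card (eq_bigl (fun l : Lab => (qs (tag l) == i) && true)); last by move=> l; rewrite andbT.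
rewrite -(@sig_big_dep _ 0%N _ _ _ (fun a => qs a == i) (fun _ => predT) (fun _ _ => 1%N)) /=.
rewrite (eq_bigr (fun a => delta (qt a))); last first.
  by move=> a _; rewrite sum1_card card_ord M_delta.
have := rad i; rewrite /cartan /euler /ivec /evec.
rewrite (bigD1 i) //= big1; last by move=> v /negPf ->; rewrite mulr0.
rewrite (big1 _ _ (fun a => (delta (qs a))%:Z * _)); last first.
  by move=> a _; rewrite (negPf (src a)) mulr0.
rewrite (bigD1 i) //= (big1 _ (fun w => w != i)); last by move=> v /negPf ->; rewrite mul0r.
rewrite eqxx di (eq_bigr (fun a => if qs a == i then (delta (qt a))%:Z else 0)); last first.
  by move=> a _; case: eqP; rewrite ?mul1r ?mul0r.
rewrite -big_mkcond /=.
by rewrite -(big_morph Posz PoszD (erefl _)); lia.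
Qed.

(** The endomorphism is [CV] at [i] and the transpose of [CW] tensor the identity of M elsewhere;
    the arrows leaving [i] impose exactly the pencil relations. *)
Lemma endo_ex (CV CW : 'M[F]_n) : (forall l : Lab, qs (tag l) = i -> CV *m Al l = Al l *m CW) ->
  exists g : hom X X, g i = CV.
Proof.
move=> comm.
have [r rO] : exists r : forall v, 'M[F]_(rdim X v, n * rdim M v),
    forall v, v != i -> Om v *m r v = 1%:M.
  by exists (fun v => pinvmx (Om v)) => v nv; rewrite mulmxVp // Om_free.
pose g v : 'M[F]_(rdim X v) :=
  if v == i then idr v *m CV *m idl v else r v *m Tl v CW^T *m Om v.
have gO v : v != i -> Om v *m g v = Tl v CW^T *m Om v.
  by move=> nv; rewrite /g (negPf nv) !mulmxA rO // mul1mx.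
have gI v : v = i -> g v = idr v *m CV *m idl v by rewrite /g => /eqP ->.
have hg : @is_hom Q F X X g.
  move=> a; have nt := src a; rewrite -{1}YaE -mulmxA gO //.
  case: (eqVneq (qs a) i) => [e|ns].
    rewrite gI // -[in RHS]YaE !mulmxA; congr (_ *m _); apply: Ec_inj => s.
    rewrite -!mulmxA Ec_Tl (mulmxA (Ya a)) -caE -{1}[ca s]mul1mx -(idr_idl e).
    have := comm (Tagged (fun a => 'I_(rdim M (qt a))) s) e; rewrite AlE => cm.
    by rewrite -!mulmxA (mulmxA _ (ca s)) -cm.
  apply: (full_inj (Om_full ns)).
  rewrite !mulmxA gO // -(mulmxA (Tl _ _)) Om_map !mulmxA -Nr_Tl.
  congr (_ *m _); congr (_ *m _); apply: (free_inj (Om_free nt)).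
  by rewrite -mulmxA YaE Om_map.
by exists (Hom hg); rewrite /= gI // idl_i idr_i mulmx1 mul1mx.
Qed.

(** [CW] is a matrix of the action of [g] on Hom(M, X) in the family [w]. *)
Lemma endo_coef (g : hom X X) : exists CW : 'M[F]_n,
  forall l : Lab, qs (tag l) = i -> g i *m Al l = Al l *m CW.
Proof.
have [c cE] : exists c : 'I_n -> 'rV[F]_n, forall j v, hcomp (w j) g v = hlin w (c j) v.
  by apply: (fin_all_exists (P := fun j c => forall v, hcomp (w j) g v = hlin w c v)) => j; apply: wspan.
pose CW := \matrix_(j, k) c j 0 k; exists CW => -[a s] /= e.
have gO v : Om v *m g v = Tl v CW^T *m Om v.
  apply: mxvec_inj_r => C; rewrite !mulmxA OmE TlE OmE mulmx_suml.
  under eq_bigr => j _ do rewrite -mulmxA [w j v *m g v](cE j v) /= mulmx_sumr.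
  rewrite exchange_big /=; apply: eq_bigr => k _.
  under eq_bigr => j _ do rewrite -scalemxAr scalemxAl.
  rewrite -mulmx_suml; congr (_ *m _).
  by apply/rowP => x; rewrite summxE !mxE; apply: eq_bigr => j _; rewrite !mxE.
rewrite AlE mulmxA (idl_comm _ e) -!mulmxA; congr (_ *m _).
rewrite caE -mulmxA -Ec_Tl !mulmxA; congr (_ *m _).
apply: (free_inj (Om_free (src _))).
by rewrite -!mulmxA YaE -gO (mulmxA (Ya _)) YaE homE.
Qed.

(** The submodule is U at [i] and W tensor M elsewhere. Each dimension at [i] contributes 1 to the
    defect, each copy of M contributes -1. *)
Lemma sub_of_pencil r (U : 'M[F]_n) (W : 'M[F]_(r, n)) : row_free W ->
  (forall l : Lab, qs (tag l) = i -> (U *m Al l <= W)%MS) ->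
  exists K (k : hom K X), [/\ mono k, (k i :=: U)%MS & dfc K = (\rank U)%:Z - r%:Z].
Proof.
move=> fW UW.
pose L v := Tl v W^T *m Om v.
pose G v : 'M[F]_(rdim X v) := (<<U *m idl v>> + <<L v>>)%MS.
have U0 v : v != i -> U *m idl v = 0 by move=> nv; rewrite idl0 // mulmx0.
have Mi : rdim M i = 0%N by have := src_i di sM => -[].
have L0 : L i = 0 by apply: mx_rows0; rewrite Mi muln0.
have sG : sfam G.
  move=> a; have nt := src a; rewrite /G addsmxMr addsmx_sub !(eqmxMr _ (genmxE _)).
  apply/andP; split; last first.
    apply: submx_trans (addsmxSr _ _); rewrite genmxE /L -mulmxA Om_map mulmxA -Nr_Tl -mulmxA.
    exact: submxMl.
  case: (eqVneq (qs a) i) => [e|ns]; last by rewrite U0 // mul0mx sub0mx.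
  apply: submx_trans (addsmxSr _ _); rewrite genmxE -YaE mulmxA.
  apply/row_subP => x; rewrite row_mul; set y := row x _.
  have /submxP[Z ZE] : ((vec_mx y)^T <= W)%MS.
    apply/row_subP => s; rewrite -tr_col -EcE vec_mxK /y -row_mul -!mulmxA -caE -AlE.
    exact: submx_trans (row_sub _ _) (UW (Tagged (fun a => 'I_(rdim M (qt a))) s) e).
  rewrite -[y]vec_mxK -[vec_mx y]trmxK ZE trmx_mul -TlE -mulmxA.
  exact: submxMl.
have [K [k mk kG]] := sub_ex sG; exists K, k.
have Gi : (G i :=: U)%MS.
  rewrite /G L0 idl_i mulmx1; apply: eqmx_trans (addsmx_idPl _) (genmxE _).
  by rewrite genmxE sub0mx.
split=> //; first exact: eqmx_trans (kG i) Gi.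
have fL v : v != i -> row_free (L v).
  move=> nv; apply/row_freeP; have /row_freeP[O' OO'] := Om_free nv.
  have /row_freeP[W' WW'] := fW; exists (O' *m Tl v W'^T).
  rewrite mulmxA -(mulmxA _ (Om v)) OO' mulmx1; apply: mxvec_inj_r => C.
  by rewrite mulmxA !TlE mulmxA -trmx_mul WW' trmx1 mul1mx mulmx1.
have dK v : rdim K v = (r * rdim M v + \rank U * (v == i))%N.
  rewrite -(mono_rank mk) kG; case: (eqVneq v i) => [->|nv].
    by rewrite Gi Mi muln0 muln1.
  rewrite muln0 addn0 /G U0 //; apply: etrans (_ : \rank (L v) = _); last exact/eqP/fL.
  apply: eqmx_rank; apply/eqmxP; apply: eqmx_trans (genmxE _).
  by apply/addsmx_idPr; rewrite !genmxE sub0mx.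
pose K1 := Erep F (fun v => (r * rdim M v)%N).
pose K2 := Erep F (fun v => (\rank U * (v == i))%N).
have := eu_addr (Erep F delta) (dK : forall v, rdim K v = (rdim K1 v + rdim K2 v)%N).
rewrite (eu_mul_r (X := K1) (Y := M) _ (fun=> erefl)).
rewrite (eu_mul_r (X := K2) (Y := Erep F (fun v => (v == i) : nat)) _ (fun=> erefl)).
have dE1 : dfc (Erep F (fun v => (v == i) : nat)) = 1 by apply: (dfc_I src di).
rewrite !eu_Erep_l (src_dfc rad src di sM) dE1; lia.
Qed.

(** A nonzero vector of X_i annihilated by all arrows would span a copy of I in X. *)
Lemma out_inj (I : rep Q F) : is_I i I -> (forall f : hom I X, ~ hnz f) ->
  forall x : 'rV[F]_n, (forall l : Lab, qs (tag l) = i -> x *m Al l = 0) -> x = 0.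
Proof.
move=> dI nI x x0.
have y0 a : qs a = i -> x *m idl (qs a) *m rmap X a = 0.
  move=> e; rewrite -YaE mulmxA.
  have -> : x *m idl (qs a) *m Ya a = 0; last by rewrite mul0mx.
  apply: Ec_inj => s; rewrite mul0mx -!mulmxA -caE -AlE.
  exact: (x0 (Tagged (fun a => 'I_(rdim M (qt a))) s) e).
have hf : @is_hom Q F I X (fun v => \matrix_(_, c) (x *m idl v) 0 c).
  move=> a; transitivity (0 : 'M[F]_(rdim I (qs a), rdim X (qt a))).
    apply/matrixP => r c; rewrite !mxE big1 // => s; have := ltn_ord s.
    by rewrite {2}dI (negPf (src a)).
  case: (eqVneq (qs a) i) => [e|ns]; apply/matrixP => r c.
    transitivity ((x *m idl (qs a) *m rmap X a) 0 c); first by rewrite y0 ?mxE.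
    by rewrite [LHS]mxE [RHS]mxE; apply: eq_bigr => s _; rewrite [in RHS]mxE.
  by have := ltn_ord r; rewrite {2}dI (negPf ns).
have /hnzPn/(_ i)/matrixP f0 := nI (Hom hf).
apply/rowP => c; have r0 : 'I_(rdim I i) by rewrite dI eqxx; exact: ord0.
by have := f0 r0 c; rewrite /= mxE idl_i mulmx1 => ->; rewrite !mxE.
Qed.

Lemma pencil_ex : exists A B : 'M[F]_n,
  [/\ forall CV CW, CV *m A = A *m CW -> CV *m B = B *m CW -> exists g : hom X X, g i = CV,
      forall g : hom X X, exists CW, g i *m A = A *m CW /\ g i *m B = B *m CW,
      forall r (U : 'M[F]_n) (W : 'M[F]_(r, n)), row_free W ->
        (U *m A <= W)%MS -> (U *m B <= W)%MS ->
        exists K (k : hom K X), [/\ mono k, (k i :=: U)%MS & dfc K = (\rank U)%:Z - r%:Z] &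
      forall I : rep Q F, is_I i I -> (forall f : hom I X, ~ hnz f) ->
        forall x : 'rV[F]_n, x *m A = 0 -> x *m B = 0 -> x = 0].
Proof.
have /cards2P[l0 [l1 [_ E]]] : #|[set l : Lab | qs (tag l) == i]| == 2 by rewrite card_Lab.
have cs (P : Lab -> Prop) : P l0 -> P l1 -> forall l : Lab, qs (tag l) = i -> P l.
  move=> P0 P1 l e; have : l \in [set l : Lab | qs (tag l) == i] by rewrite inE e eqxx.
  by rewrite E !inE => /orP[] /eqP ->.
have e0 : qs (tag l0) = i.
  by apply/eqP; have := set21 l0 l1; rewrite -E inE.
have e1 : qs (tag l1) = i.
  by apply/eqP; have := set22 l0 l1; rewrite -E inE.
exists (Al l0), (Al l1); split.
- by move=> CV CW c0 c1; apply: (endo_ex (CW := CW)); apply: cs.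
- by move=> g; have [CW cw] := endo_coef g; exists CW; split; apply: cw.
- by move=> r U W fW W0 W1; apply: sub_of_pencil fW _; apply: cs.
- by move=> I dI nI x x0 x1; apply: (out_inj dI nI); apply: cs.
Qed.

End Kronecker.

(** * Matrix pencils over F[t] *)

Section PolyPencil.
Variable (F : fieldType).

Definition cf m p j (D : 'M[{poly F}]_(m, p)) : 'M[F]_(m, p) := map_mx (coefp j) D.
Definition Pm m p (A : 'M[F]_(m, p)) : 'M[{poly F}]_(m, p) := map_mx polyC A.

Lemma cfMl m n p j (A : 'M[F]_(m, n)) (D : 'M_(n, p)) : cf j (Pm A *m D) = A *m cf j D.
Proof.
apply/matrixP => x y; rewrite !mxE /= coef_sum; apply: eq_bigr => k _.
by rewrite !mxE coefCM.
Qed.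
Lemma cfMr m n p j (A : 'M[F]_(n, p)) (D : 'M_(m, n)) : cf j (D *m Pm A) = cf j D *m A.
Proof.
apply/matrixP => x y; rewrite !mxE /= coef_sum; apply: eq_bigr => k _.
by rewrite !mxE coefMC.
Qed.
Lemma cfD m p j (D D' : 'M[{poly F}]_(m, p)) : cf j (D + D') = cf j D + cf j D'.
Proof. by apply/matrixP => x y; rewrite !mxE /= coefD. Qed.
Lemma cfXS m p j (D : 'M[{poly F}]_(m, p)) : cf j.+1 ('X *: D) = cf j D.
Proof. by apply/matrixP => x y; rewrite !mxE /= coefXM. Qed.
Lemma cfX0 m p (D : 'M[{poly F}]_(m, p)) : cf 0 ('X *: D) = 0.
Proof. by apply/matrixP => x y; rewrite !mxE /= coefXM. Qed.
Lemma cfZC m p j (c : {poly F}) (A : 'M[F]_(m, p)) : cf j (c *: Pm A) = c`_j *: A.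
Proof. by apply/matrixP => x y; rewrite !mxE /= coefMC. Qed.
Lemma cf_inj m p (D D' : 'M[{poly F}]_(m, p)) : (forall j, cf j D = cf j D') -> D = D'.
Proof.
move=> e; apply/matrixP => x y; apply/polyP => j.
by have /matrixP/(_ x y) := e j; rewrite !mxE.
Qed.
Lemma cf_bound m p (D : 'M[{poly F}]_(m, p)) : exists N, forall j, (N <= j)%N -> cf j D = 0.
Proof.
exists (\max_x \max_y size (D x y)) => j le; apply/matrixP => x y; rewrite !mxE /=.
apply: nth_default; apply: leq_trans le.
by apply: leq_trans (leq_bigmax_cond (F := fun x => \max_y size (D x y))%N x _); rewrite // (leq_bigmax_cond (F := fun y => size (D x y))).
Qed.
Lemma Pm0 m p (A : 'M[F]_(m, p)) : Pm A = 0 -> A = 0.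
Proof.
by move=> e; apply/matrixP => x y; have /matrixP/(_ x y) := e; rewrite !mxE => /eqP; rewrite polyC_eq0 => /eqP.
Qed.

Variables (n : nat) (A B : 'M[F]_n).
Definition Pt := Pm A + 'X *: Pm B.

(* The coefficients of a polynomial solution [v] of [v (A + t B) = p(t) w] span a
   subspace whose image under the pencil is small. *)
Lemma pencil_span (v : 'rV[{poly F}]_n) (w : 'rV[F]_n) (p : {poly F}) :
  v != 0 -> v *m Pt = p *: Pm w ->
  exists r (U : 'M[F]_n) (W : 'M[F]_(r, n)),
  [/\ row_free W, (U *m A <= W)%MS, (U *m B <= W)%MS,
      forall m (y : 'M[F]_(n, m)), (forall j, cf j v *m y = 0) -> U *m y = 0 &
      (0 < \rank U)%N /\ (r < \rank U + \rank w)%N].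
Proof.
move=> nv e; have [N vN] := cf_bound v.
pose U := (\sum_(j < N) <<cf j v>>)%MS.
have vU j : (cf j v <= U)%MS.
  case: (ltnP j N) => [lt|/vN ->]; last exact: sub0mx.
  rewrite /U (bigD1 (Ordinal lt)) //= (submx_trans _ (addsmxSl _ _)) // genmxE.
  exact: submx_refl.
have E j : cf j (v *m Pt) = cf j v *m A + cf j ('X *: (v *m Pm B)).
  by rewrite /Pt mulmxDr cfD cfMr -scalemxAr.
have E0 : cf 0 v *m A = p`_0 *: w.
  by have := E 0%N; rewrite e cfZC cfX0 addr0.
have ES j : cf j.+1 v *m A + cf j v *m B = p`_j.+1 *: w.
  by have := E j.+1; rewrite e cfZC cfXS cfMr.
have exl : exists l, cf l v != 0.
  apply: NNPP => nex; move/eqP: nv; apply; apply: cf_inj => j.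
  have -> : cf j (0 : 'rV[{poly F}]_n) = 0 by apply/matrixP => x y; rewrite !mxE /= coef0.
  by apply/eqP/negPn/negP => nj; apply: nex; exists j.
have [l nl lmin] := ex_minnP exl.
have lw : (cf l v *m A <= w)%MS.
  case: l nl lmin => [|l] nl lmin; first by rewrite E0 scalemx_sub.
  have := ES l; have -> : cf l v = 0.
    by apply/eqP/negPn/negP => /lmin; rewrite ltnn.
  by rewrite mul0mx addr0 => ->; rewrite scalemx_sub.
pose S := (U *m A + w)%MS.
exists (\rank S), U, (row_base S).
have lU : (0 < \rank (U :&: kermx (A *m cokermx w)))%N.
  rewrite lt0n mxrank_eq0; apply: contra nl => /eqP e0.
  rewrite -submx0 -e0 sub_capmx vU; apply/sub_kermxP.
  by rewrite mulmxA; apply/eqP; rewrite -submxE.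
split; rewrite ?row_base_free ?eq_row_base ?addsmxSl //.
- rewrite /U sumsmxMr; apply/sumsmx_subP => j _; rewrite (eqmxMr _ (genmxE _)).
  have -> : cf j v *m B = p`_j.+1 *: w - cf j.+1 v *m A by rewrite -ES addrC addKr.
  rewrite addmx_sub ?scalemx_sub ?addsmxSr // eqmx_opp.
  by apply: submx_trans (addsmxSl _ _); apply: submxMr.
- move=> m y y0; apply/sub_kermxP/sumsmx_subP => j _; rewrite genmxE.
  exact/sub_kermxP.
split; first by apply: leq_trans lU (mxrankS (capmxSl _ _)).
have e1 := mxrank_mul_ker S (cokermx w); have e2 := mxrank_mul_ker U (A *m cokermx w).
have e3 : (\rank (S :&: kermx (cokermx w)) <= \rank w)%N.
  apply: leq_trans (mxrankS (capmxSr _ _)) _.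
  by rewrite mxrank_ker mxrank_coker subKn // rank_leq_col.
have e4 : \rank (S *m cokermx w) = \rank (U *m (A *m cokermx w)).
  rewrite /S addsmxMr mulmx_coker; apply: eqmx_rank; apply/eqmxP.
  by rewrite mulmxA; apply/addsmx_idPl; rewrite sub0mx.
by move: lU e1 e2 e3; rewrite e4; lia.
Qed.

(** Substituting A = Pt - t B turns both sides into the same expression, as the product of [Pt] with
    its adjugate is the same scalar in either order. *)
Lemma adj_coef j : A *m cf j (\adj Pt) *m B = B *m cf j (\adj Pt) *m A.
Proof.
rewrite -!cfMl -!cfMr; congr (cf j _).
have := mul_mx_adj Pt; have := mul_adj_mx Pt.
move: (\adj Pt) (\det Pt) => D p; rewrite /Pt mulmxDl mulmxDr => e1 e2.
have -> : Pm A *m D = p%:M - 'X *: Pm B *m D by rewrite -e2 addrK.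
rewrite -!mulmxA; have -> : D *m Pm A = p%:M - D *m ('X *: Pm B) by rewrite -e1 addrK.
rewrite mulmxBl mulmxBr mul_scalar_mx mul_mx_scalar; congr (_ - _).
move: (Pm A) (Pm B) => PA PB.
by rewrite -scalemxAl -scalemxAl -scalemxAr -scalemxAr mulmxA.
Qed.

(** The relations say G Pt = Pt H; multiplying by the adjugate on both sides gives the claim up to
    the determinant, which cancels over F[t]. *)
Lemma adj_comm j (G H : 'M[F]_n) : \det Pt != 0 -> G *m A = A *m H -> G *m B = B *m H ->
  cf j (\adj Pt) *m G = H *m cf j (\adj Pt).
Proof.
move=> nd GA GB; rewrite -cfMl -cfMr; congr (cf j _).
have e : Pm G *m Pt = Pt *m Pm H.
  rewrite /Pt mulmxDr mulmxDl -scalemxAr -scalemxAl -!map_mxM /=.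
  by rewrite GA GB.
have := mul_mx_adj Pt; have := mul_adj_mx Pt; move: nd.
move: (\adj Pt) (\det Pt) => D p nd e1 e2; apply: (scalemx_inj nd).
by rewrite -mul_mx_scalar -e2 -mul_scalar_mx -e1 -!mulmxA (mulmxA (Pm G)) e !mulmxA.
Qed.

End PolyPencil.

(** * The vertex of a simple injective module *)

Section Vertex.
Variables (Q : quiver) (F : finFieldType) (delta : qV Q -> nat).
Implicit Types (J N X : rep Q F) (v : qV Q) (a : qA Q).
Hypothesis acyc : acyclic Q.

(* The socle: among the support vertices, pick one reaching the fewest vertices. *)
Lemma simple_vertex J : simple_rep J -> exists i, is_I i J.
Proof.
case=> nJ sJ; have [v0 v0J] : exists v, (0 < rdim J v)%N by case/nzeroP: nJ => v; rewrite -lt0n; exists v.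
case: (@arg_minnP _ v0 (fun v => 0 < rdim J v)%N (fun v => #|[set w | connect (@arrow_rel Q) v w]|) v0J) => v vJ vmin.
have out a : qs a = v -> rdim J (qt a) = 0%N.
  move=> av; apply/eqP; rewrite -leqn0 leqNgt; apply/negP => /vmin; rewrite leqNgt => /negP; apply.
  have va : connect (@arrow_rel Q) v (qt a) by apply: connect1; apply/existsP; exists a; rewrite av !eqxx.
  apply: proper_card; apply/properP; split.
    by apply/subsetP => w; rewrite !inE; exact: connect_trans.
  by exists v; rewrite inE ?connect0 // -av; exact: acyc.
pose N := @Rep Q F (fun w => (w == v) : nat) (fun a => 0).
pose f : homT N J := fun w => pid_mx 1.
have fh : is_hom f.
  move=> a; rewrite mul0mx; apply/esym/matrixP => x y.
  have av : qs a = v by apply/eqP/negPn/negP => /negPf nv; have := leq_ltn_trans (leq0n _) (ltn_ord x); rewrite /N /= nv.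
  by have := ltn_ord y; rewrite {2}(out a av).
have fm : is_mono f.
  move=> w; case: (eqVneq w v) => [->|/negPf nw].
    by rewrite /row_free /f rank_pid_mx /= ?eqxx.
  by rewrite /row_free eqn_leq rank_leq_row; apply: leq_trans (leq0n _); rewrite /= nw.
exists v => w; case: (sJ _ _ fh fm) => [/(_ v)|ef]; first by rewrite /= eqxx.
have := ef w; rewrite /row_full => /eqP e; have := fm w.
by rewrite /row_free e => /eqP.
Qed.

Lemma injective_z1 J N : injective_rep J -> z N J = 1%N.
Proof.
move=> iJ; apply: z_le1 => p /dext_nonsplit[X [k [c [S _ ns]]]]; apply: ns; have [mk _ _] := S.
have [r [hr rE]] := iJ _ _ _ _ (homP k) mk (homP (hid J)).
exact: (ret_sec (r := Hom hr) S).
Qed.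

(** For an arrow ending at [i], the simple module N at its source has negative Euler form against J,
    but injectivity kills Ext(N, J) and makes this form nonnegative. *)
Lemma injective_source J i : injective_rep J -> is_I i J -> forall a, qt a != i.
Proof.
move=> iJ dJ a; apply/negP => /eqP ai.
pose N := Erep F (fun v => (v == qs a) : nat).
have z1 : z N J = 1%N := injective_z1 N iJ.
have e : eu N J < 0.
  have ns : qs a != i.
    by apply/eqP => e; have := acyc a; rewrite e ai connect0.
  rewrite /eu /euler (bigD1 i) //= big1; last first.
    by move=> v vi; rewrite /ivec dJ (negPf vi) mulr0.
  rewrite {1}/ivec /= eq_sym (negPf ns) mul0r addr0 sub0r oppr_lt0 (bigD1 a) //=.
  rewrite /ivec /= dJ ai !eqxx mulr1 ltr_pwDl //; apply: sumr_ge0 => b _.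
  by rewrite -PoszM.
by have := eu_ge0 z1; rewrite leNgt e.
Qed.

Lemma defect_source J i : (forall a, qt a != i) -> is_I i J -> dfc delta J = 1 -> delta i = 1%N.
Proof. by move=> src dJ; rewrite -eu_Erep_l (eu_I_r src) //= => -[]. Qed.

End Vertex.

(** * Summands and the trace of M *)

Section Summands.
Variables (Q : quiver) (F : finFieldType).
Implicit Types (N X Y : rep Q F) (v : qV Q).

Lemma bigsum_proj (s : seq (rep Q F)) :
  exists (u : forall j, hom (nth (zero_rep Q F) s j) (bigsum s))
         (p : forall j, hom (bigsum s) (nth (zero_rep Q F) s j)),
  [/\ forall j, (j < size s)%N -> forall v, u j v *m p j v = 1%:M,
      forall j l, j <> l -> forall v, u j v *m p l v = 0 &
      forall Y (g : hom Y (bigsum s)), hnz g -> exists2 j, (j < size s)%N & hnz (hcomp g (p j))].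
Proof.
elim: s => [|X s [u [p [up1 up0 gp]]]].
  exists (fun j => hzero _ _), (fun j => hzero _ _); split=> // [j l _ v|Y g [v]].
    by rewrite mulmx0.
  by case/eqP; apply/matrixP => x [].
pose u' j : hom (nth (zero_rep Q F) (X :: s) j) (bigsum (X :: s)) :=
  match j with 0 => hinl X (bigsum s) | j.+1 => hcomp (u j) (hinr X (bigsum s)) end.
pose p' j : hom (bigsum (X :: s)) (nth (zero_rep Q F) (X :: s) j) :=
  match j with 0 => hprl X (bigsum s) | j.+1 => hcomp (hprr X (bigsum s)) (p j) end.
exists u', p'; split=> [[|j]|[|j] [|l]|Y g [v nv]] //.
- by move=> _ v; exact: inl_prl.
- move=> lt v; change (u j v *m hinr X (bigsum s) v *m (hprr X (bigsum s) v *m p j v) = 1%:M).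
  by rewrite mulmxA -(mulmxA (u j v)) inr_prr mulmx1 up1.
- move=> _ v; change (hinl X (bigsum s) v *m (hprr X (bigsum s) v *m p l v) = 0).
  by rewrite mulmxA inl_prr mul0mx.
- move=> _ v; change (u j v *m hinr X (bigsum s) v *m hprl X (bigsum s) v = 0).
  by rewrite -mulmxA inr_prl mulmx0.
- move=> ne v; change (u j v *m hinr X (bigsum s) v *m (hprr X (bigsum s) v *m p l v) = 0).
  by rewrite mulmxA -(mulmxA (u j v)) inr_prr mulmx1 up0 // => e; case: ne; rewrite e.
case: (classic (hnz (hcomp g (hprl X (bigsum s))))) => [nl|/hnzPn l0]; first by exists 0%N.
case: (classic (hnz (hcomp g (hprr X (bigsum s))))) => [/gp[j lt nj]|/hnzPn r0].
  exists j.+1 => //; case: nj => w nw; exists w.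
  by change (g w *m (hprr X (bigsum s) w *m p j w) != 0); rewrite mulmxA.
case/eqP: nv; rewrite -[g v]mulmx1 -pr_in mulmxDr !mulmxA.
by have /= -> := l0 v; have /= -> := r0 v; rewrite !mul0mx addr0.
Qed.

Lemma gspan_rank M Y s v : h M Y = (#|F| ^ s)%N -> (\rank (gspan M Y v) <= s * rdim M v)%N.
Proof.
move=> /hom_basis[w wE].
apply: leq_trans (_ : \rank (\sum_(j < s) <<w j v>>)%MS <= _)%N.
  apply/mxrankS/gspan_le => g; have [c ->] := wE g.
  rewrite /hlin; apply: summx_sub => j _; apply: scalemx_sub.
  by rewrite (sumsmx_sup j) // genmxE.
apply: leq_trans (_ : \sum_(j < s) \rank (w j v) <= _)%N; last first.
  apply: leq_trans (_ : \sum_(j < s) rdim M v <= _)%N; first by apply: leq_sum => j _; exact: rank_leq_row.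
  by rewrite sum_nat_const card_ord.
elim/big_ind2: _ => [|A1 n1 A2 n2 le1 le2|j _]; rewrite ?mxrank0 ?mxrank_gen //.
by apply: leq_trans (mxrank_adds_leqif _ _) (leq_add le1 le2).
Qed.

Lemma gspan_epi M X Y (p : hom X Y) v : epi p -> row_full (gspan M X v) -> row_full (gspan M Y v).
Proof.
move=> ep gX; rewrite -sub1mx; have /row_fullP[p' p'p] := ep v; rewrite -p'p.
apply: submx_trans (submxMr _ (_ : (p' <= 1%:M)%MS)) _; first exact: submx1.
apply: submx_trans (submxMr _ (_ : (1%:M <= gspan M X v)%MS)) _; first by rewrite sub1mx.
rewrite submxE -mulmxA; apply/eqP/sub_kermxP; apply: gspan_le => u.
by apply/sub_kermxP; rewrite mulmxA; apply/eqP; rewrite -submxE; exact: (gspan_sub (hcomp u p) v).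
Qed.

End Summands.

Lemma is_I_epi (Q : quiver) (F : finFieldType) i (X I : rep Q F) (f : hom X I) :
  is_I i I -> hnz f -> epi f.
Proof.
move=> dI [v nv] w; rewrite /row_full eqn_leq rank_leq_col /=; 
apply: leq_trans (_ : (w == i) <= _)%N; first by rewrite dI.
case: (eqVneq w i) => [->|] //; rewrite lt0n mxrank_eq0.
case: (eqVneq v i) nv => [<- //|ni /eqP[]].
by apply: mx_cols0; rewrite dI (negPf ni).
Qed.

Lemma eu_dsum_r (Q : quiver) (F : finFieldType) (Y A B : rep Q F) : eu Y (dsum A B) = eu Y A + eu Y B.
Proof. exact: eu_addr. Qed.

Lemma mul_mid (F : finFieldType) m n p q r (A : 'M[F]_(m, n)) (B : 'M_(n, p)) (C : 'M_(p, q)) (D : 'M_(q, r)) :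
  A *m B *m (C *m D) = A *m (B *m C) *m D.
Proof. by rewrite !mulmxA. Qed.

Lemma iso_homs (Q : quiver) (F : finFieldType) (X Y : rep Q F) : iso X Y ->
  exists (x : hom X Y) (y : hom Y X), (forall v, x v *m y v = 1%:M) /\ forall v, y v *m x v = 1%:M.
Proof. by case=> x [y [hx hy xy yx]]; exists (Hom hx), (Hom hy). Qed.

(** * Modules with a preprojective kernel over I *)

Section Cyclic.
Variables (Q : quiver) (F : finFieldType) (delta : qV Q -> nat).
Implicit Types (J N Y : rep Q F) (v : qV Q) (a : qA Q).
Hypothesis rad : forall v, cartan (ivec delta) (evec v) = 0.
Hypothesis pos : forall v, (0 < delta v)%N.
Hypothesis conn : connected_quiver Q.
Local Notation dfc := (@dfc Q F delta).
Local Notation Fneg := (@Fneg Q F delta).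
Local Notation semist := (@semist Q F delta).
Local Notation stab := (@stab Q F delta).
Variable i : qV Q.
Hypothesis src : forall a, qt a != i.
Hypothesis di : delta i = 1%N.

Lemma ent_mul n m p (y : 'rV[F]_n) (TC : 'M[F]_(n, p)) (phi : 'cV[F]_p) (T : 'M[F]_(n, m)) (C : 'M[F]_(m, p)) :
  TC = T *m C -> (y *m T *m C *m phi) 0 0 = \sum_l y 0 l * (TC *m phi) l 0.
Proof. by move=> ->; rewrite -[y *m T *m C]mulmxA -mulmxA mxE. Qed.

Lemma comm_push n (G H A C : 'M[F]_n) : G *m A = A *m H -> C *m G = H *m C ->
  A *m C *m G = G *m (A *m C).
Proof. by move=> GA CG; rewrite -mulmxA CG !mulmxA GA. Qed.

Lemma semist_fneg0 X Y (f : hom X Y) : semist X -> Fneg Y -> ~ hnz f.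
Proof.
move=> [dX leX] FY nf; have [K [k [J [e [m [S mm fE _]]]]]] := hfac_ex f.
have [mk _ _] := S; have nJ := hnz_fac fE nf.
have := dfc_ses (delta := delta) S; have := leX _ _ mk; have := FY _ _ mm nJ.
by rewrite dX; lia.
Qed.

Lemma dext_fneg_semist M Y : Fneg M -> semist Y -> forall p : dext M Y, ~ dnz p.
Proof.
move=> FM [dY leY]; apply: (dext_vanish rad) => N1 k M1 c mk ec nN nM.
have [K [l Sl]] := ses_epi ec; have [ml _ _] := Sl.
have := FM _ _ mk nN; have := leY _ _ ml; have := dfc_ses (delta := delta) Sl; rewrite dY; lia.
Qed.

(** Ext(M, Y) = 0, so the Euler form [s] is the dimension of Hom(M, Y), and [s] copies of M generate
    Y away from [i]. *)
Lemma fneg_semist_le M Y : dim_src delta i 1 M -> Fneg M -> semist Y ->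
  (forall v, v != i -> row_full (gspan M Y v)) ->
  exists2 s : nat, eu M Y = s & forall v, v != i -> (rdim Y v <= s * delta v)%N.
Proof.
move=> sM FM sY gY.
have z1 : z M Y = 1%N by apply: z_le1; exact: dext_fneg_semist.
have e := euler_rat M Y; rewrite z1 mul1r in e.
have es := gez0_abs (eu_ge0 z1); move: (`|eu M Y|%N) es => s es; exists s => // v nv.
have hq : h M Y = (#|F| ^ s)%N by apply/eqP; rewrite -(eqr_nat rat) e -es natrX.
have /eqP <- := gY v nv; apply: leq_trans (gspan_rank v hq) _.
by have := sM v; rewrite (negPf nv) addn0 mul1n => ->.
Qed.

Variables (X I K : rep Q F) (k : hom K X) (f : hom X I).
Hypothesis dI : is_I i I.
Hypothesis Sf : ses k f.
Hypothesis FK : Fneg K.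
Hypothesis noI : forall g : hom I X, ~ hnz g.
Hypothesis dX : forall v, rdim X v = (rdim X i * delta v)%N.
Local Notation n := (rdim X i).

Lemma I_cols m v (x : 'M[F]_(m, rdim I v)) : v != i -> x = 0.
Proof. by move=> /negPf nv; apply: mx_cols0; rewrite dI nv. Qed.

(** A submodule N meets K trivially or in defect at most -1, and its image in I adds at most 1.
    Positive defect would force N to be a copy of I, which [noI] excludes. *)
Lemma cyc_semist : semist X.
Proof.
have [mk ef kf] := Sf; split=> [|N j mj]; first exact: (dfc_delta rad di dX).
have [L [l [J [e [m [Sl mm fE l0]]]]]] := hfac_ex (hcomp j f).
have [ml ee _] := Sl.
have [l' l'E] : exists l' : hom L K, forall v, l' v *m k v = hcomp l j v.
  by apply: (ses_fac Sf) => v; rewrite /= -mulmxA; exact: l0.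
have ml' : mono l'.
  by move=> v; apply: (@free_mull _ _ _ _ _ (k v)); rewrite l'E; exact: (mono_comp ml mj).
have leJ v : (rdim J v <= (v == i))%N by rewrite -dI; exact: mono_le mm v.
case: (classic (is_zero J)) => [zJ|nJ].
  rewrite (dfc_ses Sl) (dfc_zero zJ) addr0.
  by case: (classic (is_zero L)) => [/dfc_zero -> //|nL]; apply/ltW/(FK ml' nL).
have IJ : is_I i J.
  move=> v; have := leJ v; case: eqVneq => [->|_]; last by rewrite leqn0 => /eqP.
  case e0: (rdim J i) => [|[|u]] // _; case: nJ => u; have := leJ u.
  by case: eqVneq => [-> _|_]; [exact: e0 | rewrite leqn0 => /eqP].
case: (classic (is_zero L)) => [zL|nL].
  have mh := zero_ses_l Sl zL; have [g [_ ge]] := bij_inv mh ee.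
  have mIJ v : rdim J v = rdim I v by rewrite IJ dI.
  have [m' [mm' m'm]] := bij_inv mm (mono_epi mm mIJ).
  case: (noI (g := hcomp m' (hcomp g j))).
  have nI : nzero I by apply/nzeroP; exists i; rewrite dI eqxx.
  apply: mono_hnz nI; apply: mono_comp => [v|].
    by apply/row_freeP; exists (m v).
  by apply: mono_comp mj => v; apply/row_freeP; exists (e v).
by rewrite (dfc_ses Sl) (dfc_I src di IJ); have := FK ml' nL; lia.
Qed.

Lemma cyc_dim : dim_src delta i n K.
Proof. by move=> v; rewrite -dI -dX (ses_dim Sf). Qed.

Lemma hom_K N (g : hom N X) : (forall v, g v *m f v = 0) ->
  exists g' : hom N K, forall v, g' v *m k v = g v.
Proof. exact: ses_fac Sf. Qed.

Lemma hom_I0 N (g : hom N X) : g i *m f i = 0 -> forall v, g v *m f v = 0.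
Proof.
by move=> e v; case: (eqVneq v i) => [->|nv] //; rewrite (I_cols (f v) nv) mulmx0.
Qed.

Lemma cyc_gspan M : dim_src delta i 1 M -> Fneg M -> forall v, v != i -> row_full (gspan M X v).
Proof.
move=> sM FM v nv; have [mk ef kf] := Sf.
have [hMK gK] := src_gen rad src di sM FM cyc_dim FK.
rewrite -sub1mx; apply: submx_trans (_ : (k v <= _)%MS).
  by rewrite -kf; apply/sub_kermxP; exact: I_cols.
have -> : k v = 1%:M *m k v by rewrite mul1mx.
apply: submx_trans (submxMr _ (_ : (1%:M <= gspan M K v)%MS)) _; first by rewrite sub1mx gK.
rewrite submxE -mulmxA; apply/eqP/sub_kermxP; apply: gspan_le => u.
by apply/sub_kermxP; rewrite mulmxA; apply/eqP; rewrite -submxE; exact: (gspan_sub (hcomp u k) v).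
Qed.

(* With D the adjugate of A + t B, the matrices A D_j and B D_j (D_j the coefficient of t^j)
   are central endomorphisms of [X], and their composites with [f] span Hom(X, I). *)
Lemma cyc_key : forall g : hom X I, exists g' : hom X X, (forall v, g' v *m f v = g v) /\
  forall g'' : hom X X, g'' i *m g' i = g' i *m g'' i.
Proof.
have [mk ef kf] := Sf; have sX := cyc_semist.
have [M [sM FM]] := src_M F rad pos conn src di.
have [hMK gK] := src_gen rad src di sM FM cyc_dim FK.
have Mi : rdim M i = 0%N by have := src_i di sM => -[].
have M0 (g : hom M X) v : g v *m f v = 0.
  by apply: hom_I0; exact: mx_rows0 Mi.
have hMX : h M X = (#|F| ^ n)%N.
  rewrite -hMK; apply/eqP; rewrite eqn_leq; apply/andP; split.
    apply: (h_le_factor (G := fun g => hcomp g k)) => [u u' e v /=|g]; first by rewrite e.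
    exact: hom_K (M0 g).
  apply: (hh_le (G := fun g => hcomp g k)) => u u' e v; exact: (free_inj (mk v) (e v)).
have gX := cyc_gspan sM FM.
have [w wspan] := hom_basis hMX.
have [A [B [K1 K2 K3 K4]]] := pencil_ex rad src di sM dX wspan gX.
pose D := \adj (Pt A B); pose p := \det (Pt A B).
(* A singular pencil would send some U into a space of smaller rank, which gives a submodule of
   positive defect. *)
have p0 : p != 0.
  apply/negP => /det0P[v nv v0].
  have v0' : v *m Pt A B = 0 *: Pm (0 : 'rV[F]_n) by rewrite v0 scale0r.
  have [r [U [W [fW UA UB _ [U0 lt]]]]] := pencil_span nv v0'.
  rewrite mxrank0 addn0 in lt.
  have [N [u [mu uU dN]]] := K3 _ _ _ fW UA UB.
  have := proj2 sX _ _ mu; rewrite dN; lia.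
(* [E] identifies I_i with F; the dimension of I at [i] is 1 only by a propositional equality. *)
have [E EE] : exists E : 'M[F]_(rdim I i, 1), exists E', E *m E' = 1%:M /\ E' *m E = 1%:M.
  exists (const_mx 1), (const_mx 1); split; apply/matrixP => x y; rewrite !mxE.
    rewrite big_ord1 !mxE mulr1 (_ : x = y) ?eqxx //.
    have e : rdim I i = 1%N by rewrite dI eqxx.
    have z0 (z : 'I_(rdim I i)) : nat_of_ord z = 0%N.
      by have := ltn_ord z; rewrite {2}e ltnS leqn0 => /eqP.
    by apply: val_inj; rewrite /= !z0.
  rewrite (eq_bigr (fun=> 1)); last by move=> z _; rewrite !mxE mulr1.
  by rewrite sumr_const card_ord dI !ord1 !eqxx.
case: EE => E' [EE' E'E].
have [phi phiE] : exists phi, phi = f i *m E by exists (f i *m E).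
(* For nonzero [x] the coefficients of x D would span, at [i], a submodule inside the kernel K, of
   defect at least 0 because [x] has rank at most 1. *)
have spanphi (x : 'rV[F]_n) : (forall j, x *m cf j D *m phi = 0) -> x = 0.
  move=> x0; apply/eqP/negPn/negP => nx.
  pose v := Pm x *m D.
  have vP : v *m Pt A B = p *: Pm x.
    by rewrite /v -mulmxA mul_adj_mx mul_mx_scalar.
  have nv : v != 0.
    apply: contra nx => /eqP v0; apply/eqP/Pm0; apply: (scalemx_inj p0).
    by rewrite -vP v0 mul0mx scaler0.
  have [r [U [W [fW UA UB Uy [U0 lt]]]]] := pencil_span nv vP.
  have Uphi : U *m phi = 0 by apply: Uy => j; rewrite /v cfMl x0.
  have Uf : U *m f i = 0.
    by rewrite -[f i]mulmx1 -EE' mulmxA -phiE mulmxA Uphi mul0mx.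
  have [N [u [mu uU dN]]] := K3 _ _ _ fW UA UB.
  have uf : u i *m f i = 0.
    by apply/sub_kermxP; rewrite uU; apply/sub_kermxP.
  have [u' u'E] := hom_K (hom_I0 uf).
  have mu' : mono u' by move=> y; apply: (@free_mull _ _ _ _ _ (k y)); rewrite u'E; exact: mu.
  have nN : nzero N.
    by apply/nzeroP; exists i; rewrite -(mono_rank mu) uU -lt0n.
  have := FK mu' nN; rewrite dN; have := rank_leq_row x; lia.
have [N DN] := cf_bound D.
pose c1 (j : 'I_N) := B *m cf j D; pose c2 (j : 'I_N) := A *m cf j D.
(* The columns of G are the vectors B D_j phi and A D_j phi. If [y] annihilates them all, [spanphi]
   gives y B = y A = 0, so y = 0 as I does not map to X; hence they span the column space. *)
pose G := row_mx (\matrix_(r < n, j < N) (c1 j *m phi) r 0) (\matrix_(r < n, j < N) (c2 j *m phi) r 0).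
have fG : row_free G.
  rewrite -kermx_eq0; apply/eqP/row_matrixP => r; rewrite row0; set y := row r _.
  have yG : y *m G = 0 by apply/sub_kermxP; rewrite /y row_sub.
  have /eq_row_mx[y1 y2] : row_mx (y *m \matrix_(r < n, j < N) (c1 j *m phi) r 0)
      (y *m \matrix_(r < n, j < N) (c2 j *m phi) r 0) = row_mx 0 0.
    by rewrite -mul_mx_row row_mx0.
  have yc (c : 'I_N -> 'M[F]_n) (T : 'M[F]_n) : (forall j, c j = T *m cf j D) ->
      y *m (\matrix_(r < n, j < N) (c j *m phi) r 0) = 0 -> y *m T = 0.
    move=> cE e; apply: spanphi => j; case: (ltnP j N) => [lt|/DN ->]; last by rewrite mulmx0 mul0mx.
    apply/matrixP => z0 z1; rewrite !ord1.
    have /rowP/(_ (Ordinal lt)) := e; rewrite mxE [RHS]mxE => e0; rewrite [RHS]mxE.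
    rewrite (ent_mul y phi (erefl (T *m cf j D))) -[RHS]e0; apply: eq_bigr => l _.
    by rewrite [X in _ = _ * X]mxE cE.
  apply: (K4 I dI noI); first exact: yc y2.
  exact: yc y1.
have /row_freeP[G' GG'] := fG.
have onto (y : 'cV[F]_n) : exists2 CV : 'M[F]_n, CV *m phi = y &
    (exists g : hom X X, g i = CV) /\ forall g : hom X X, g i *m CV = CV *m g i.
  have [z zE] : exists z : 'cV_(N + N), z = G' *m y by exists (G' *m y).
  pose CV := \sum_(j < N) usubmx z j 0 *: c1 j + \sum_(j < N) dsubmx z j 0 *: c2 j.
  pose CW := \sum_(j < N) usubmx z j 0 *: (cf j D *m B) + \sum_(j < N) dsubmx z j 0 *: (cf j D *m A).
  exists CV.
    have <- : G *m z = y by rewrite zE mulmxA GG' mul1mx.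
    rewrite -[z in RHS]vsubmxK /G mul_row_col /CV mulmxDl; congr (_ + _).
      rewrite mulmx_suml; apply/colP => r; rewrite summxE mxE; apply: eq_bigr => j _.
      by rewrite -scalemxAl !mxE mulrC.
    rewrite mulmx_suml; apply/colP => r; rewrite summxE mxE; apply: eq_bigr => j _.
    by rewrite -scalemxAl !mxE mulrC.
  split.
    apply: (K1 CV CW); rewrite /CV /CW mulmxDl mulmxDr !mulmx_suml !mulmx_sumr; congr (_ + _);
      apply: eq_bigr => j _; rewrite -scalemxAl -scalemxAr /c1 /c2; congr (_ *: _).
    - exact: etrans (esym (adj_coef _ _ j)) (esym (mulmxA _ _ _)).
    - exact: (esym (mulmxA _ _ _)).
    - exact: (esym (mulmxA _ _ _)).
    - exact: etrans (adj_coef _ _ j) (esym (mulmxA _ _ _)).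
  move=> g; have [H [gA gB]] := K2 g.
  have gD j := adj_comm j p0 gA gB.
  rewrite /CV mulmxDl mulmxDr !mulmx_suml !mulmx_sumr; congr (_ + _);
    apply: eq_bigr => j _; rewrite -scalemxAl -scalemxAr /c1 /c2; congr (_ *: _).
    exact: esym (comm_push gB (gD j)).
  exact: esym (comm_push gA (gD j)).
move=> g; have [CV CVphi [[g' g'i] comm]] := onto (g i *m E); exists g'; split.
  move=> v; case: (eqVneq v i) => [->|nv]; last by rewrite (I_cols (g v) nv) (I_cols (g' v *m f v) nv).
  rewrite -[LHS]mulmx1 -[RHS]mulmx1 -EE' !mulmxA; congr (_ *m _).
  by rewrite g'i -mulmxA -phiE.
by move=> g''; rewrite g'i comm.
Qed.

(** The difference takes values in K, which receives no nonzero map from a semistable module. *)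
Lemma cyc_eq S (g g' : hom S X) : semist S -> (forall v, g v *m f v = g' v *m f v) ->
  forall v, g v = g' v.
Proof.
move=> sS e v; have [|u uE] := ses_fac (g := hsub g g') Sf.
  by move=> x; rewrite hsubE mulmxBl e subrr.
by apply/eqP; rewrite -subr_eq0 -hsubE -uE (hnzPn (semist_fneg0 (f := u) sS FK)) mul0mx.
Qed.

Lemma endo_eq (g g' : hom X X) : (forall v, g v *m f v = g' v *m f v) -> forall v, g v = g' v.
Proof. exact: cyc_eq cyc_semist. Qed.

Lemma endo_onto (g : hom X I) : exists g' : hom X X, forall v, g' v *m f v = g v.
Proof. by have [g' [g'E _]] := cyc_key g; exists g'. Qed.

Lemma endo_comm (g g' : hom X X) : g i *m g' i = g' i *m g i.
Proof.
have [u [uE comm]] := cyc_key (hcomp g' f).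
by have <- := endo_eq uE i; rewrite comm.
Qed.

Hypothesis injI : injective_rep I.

(** Away from [i] the two summands are bounded by multiples [s] and [t] of [delta] with s + t = n,
    so the bounds are attained; the dimension at [i] then follows from defect 0. *)
Lemma summand_dim R (u : hom R X) (p : hom X R) : (forall v, u v *m p v = 1%:M) ->
  forall v, rdim R v = (rdim R i * delta v)%N.
Proof.
move=> up; have [C [c [mc cp iX]]] := ret_dsum up.
have [M [sM FM]] := src_M F rad pos conn src di.
have gX := cyc_gspan sM FM.
have [sR sC] := semist_summand cyc_semist iX.
have [i1 [i2 [p1 [p2 [e1 e2 _ _ _]]]]] := iso_biprod iX.
have ep1 : epi p1 by move=> v; apply/row_fullP; exists (i1 v).
have ep2 : epi p2 by move=> v; apply/row_fullP; exists (i2 v).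
have [s es Rs] := fneg_semist_le sM FM sR (fun v nv => gspan_epi ep1 (gX v nv)).
have [t et Ct] := fneg_semist_le sM FM sC (fun v nv => gspan_epi ep2 (gX v nv)).
have dXs := iso_rdim iX.
have est : (s + t = n)%N.
  have := eu_addr M dXs; rewrite es et => e.
  have := eu_Erep_mul rad M n; rewrite (src_dfc rad src di sM) mulrN1 opprK.
  by rewrite -(@eu_eq _ _ M M X (Erep F (fun v => n * delta v)%N) (frefl _) dX) e -PoszD => -[].
have Rv v : v != i -> rdim R v = (s * delta v)%N.
  move=> nv; have := Rs v nv; have := Ct v nv; have := dXs v; rewrite dX -est /=; nia.
have Ri : rdim R i = s.
  case: sR => dR _.
  have e : eu (Erep F delta) (dsum R (Erep F (fun v => s * rdim I v)%N)) =
      eu (Erep F delta) (dsum (Erep F (fun v => s * delta v)%N) (Erep F (fun v => rdim R i * rdim I v)%N)).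
    apply: eu_eq => // v /=; rewrite dI; case: (eqVneq v i) => [->|nv]; first by rewrite di; lia.
    by rewrite !muln0 !addn0 Rv.
  have d0 : dfc (Erep F delta) = 0.
    by have := eu_Erep_r rad (Erep F delta); rewrite eu_Erep_l; lia.
  have eI m : eu (Erep F delta) (Erep F (fun v => m * rdim I v)%N) = m%:Z * eu (Erep F delta) I.
    exact: eu_mul_r.
  move: e; rewrite !eu_dsum_r.
  rewrite (eu_Erep_mul rad) d0 (eI s) (eI (rdim R i)).
  by rewrite !eu_Erep_l dR (dfc_I src di dI); lia.
by move=> v; case: (eqVneq v i) => [->|nv]; [rewrite di muln1 | rewrite Rv // Ri].
Qed.

Lemma stab_special S (u : hom S X) : stab S -> mono u -> special_reg_simple delta I S.
Proof.
move=> sS mu; split; first by apply/(stab_regular_simple rad).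
have nf : hnz (hcomp u f).
  apply: NNPP => /hnzPn uf0; have [g gE] := ses_fac Sf uf0.
  have [nS dS _] := sS; have mg : mono g.
    by move=> v; apply: (@free_mull _ _ _ _ _ (k v)); rewrite gE.
  by have := FK mg nS; rewrite dS.
exists (hcomp u f); split; first exact: homP.
exact: is_I_epi dI nf.
Qed.

Lemma cyc_c_form : c_form delta I n X.
Proof.
split=> //; have [s [Is iX]] := decomp_ex X; exists s; split=> //.
have ss : allp semist s by apply: semist_decomp; exact: semist_iso iX cyc_semist.
have [x [y [xy yx]]] := iso_homs iX.
have [u [p [up up0 _]]] := bigsum_proj s.
pose w j := hcomp (u j) y; pose r j := hcomp x (p j).
have wr j : (j < size s)%N -> forall v, w j v *m r j v = 1%:M.
  by move=> lt v; rewrite /= mulmxA -(mulmxA (u j v)) yx mulmx1 up.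
have wr0 j l : j <> l -> forall v, w j v *m r l v = 0.
  by move=> ne v; rewrite /= mulmxA -(mulmxA (u j v)) yx mulmx1 up0.
have mw j : (j < size s)%N -> mono (w j).
  by move=> lt v; apply/row_freeP; exists (r j v); exact: wr.
have Ij j : (j < size s)%N -> indecomposable (nth (zero_rep Q F) s j) by move: j; exact/allp_nth.
have sj j : (j < size s)%N -> semist (nth (zero_rep Q F) s j) by move: j; exact/allp_nth.
split=> [j lt|j l jl lt].
  split; first by split; [exact: Ij | case: (sj j lt)].
  split.
    exists (rdim (nth (zero_rep Q F) s j) i); split; last exact: summand_dim (wr j lt).
    rewrite lt0n; apply/eqP => e0; case: (Ij j lt) => nz _; apply: nz => v.
    by rewrite (summand_dim (wr j lt)) e0.
  have [S [b [sS mb]]] := stab_ex (sj j lt) (proj1 (Ij j lt)).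
  exists S; split; last by exists b; split; [exact: homP|].
  apply: (stab_special (u := hcomp b (w j)) sS); exact: mono_comp mb (mw j lt).
case=> S [sp [[bj [hj mj]] [bl [hl ml]]]].
pose b1 : hom S _ := Hom hj; pose b2 : hom S _ := Hom hl.
have ltj : (j < size s)%N := ltn_trans jl lt.
have sS : stab S by apply/(stab_regular_simple rad); case: sp.
pose u1 := hcomp b1 (w j); pose u2 := hcomp b2 (w l).
(* Injectivity of I extends the maps on S to the summands. The endomorphisms obtained satisfy u1 g =
   u2, u2 g' = u1 and u1 g' = 0, so commutativity gives u1 = u1 g g' = u1 g' g = 0 at [i]. *)
have [e1 [he1 e1E]] := injI hj mj (homP (hcomp u2 f)).
have [e2 [he2 e2E]] := injI hl ml (homP (hcomp u1 f)).
have njl : j <> l by move=> e; rewrite e ltnn in jl.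
have [g gE] := endo_onto (hcomp (r j) (Hom he1)).
have [g' g'E] := endo_onto (hcomp (r l) (Hom he2)).
have ssS := stab_semist sS.
have a1 v : (hcomp u1 g) v = u2 v.
  apply: cyc_eq => // z; apply: etrans (esym (mulmxA _ _ _)) _; rewrite gE.
  apply: etrans (mul_mid (b1 z) (w j z) (r j z) (e1 z)) _; rewrite wr // mulmx1; exact: e1E.
have a2 v : (hcomp u2 g') v = u1 v.
  apply: cyc_eq => // z; apply: etrans (esym (mulmxA _ _ _)) _; rewrite g'E.
  apply: etrans (mul_mid (b2 z) (w l z) (r l z) (e2 z)) _; rewrite wr // mulmx1; exact: e2E.
have a3 v : (hcomp u1 g') v = hzero S X v.
  apply: cyc_eq => // z; apply: etrans (esym (mulmxA _ _ _)) _; rewrite g'E.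
  apply: etrans (mul_mid (b1 z) (w j z) (r l z) (e2 z)) _; rewrite wr0 //.
  by rewrite mulmx0 !mul0mx.
have comm := endo_comm g g'.
have u10 : u1 i = 0.
  rewrite -a2; apply: etrans (congr1 (mulmx^~ (g' i)) (esym (a1 i))) _.
  apply: etrans (esym (mulmxA (u1 i) (g i) (g' i))) _; rewrite comm mulmxA.
  by apply: etrans (congr1 (mulmx^~ (g i)) (a3 i)) _; rewrite mul0mx.
have mu1 : mono u1 by apply: mono_comp (mw j ltj).
have [_ [q [hq q_epi]]] := sp.
have := epi_le (f := Hom hq) q_epi i; rewrite dI eqxx lt0n -(mono_rank mu1) u10 mxrank0.
by [].
Qed.

End Cyclic.

Lemma is_I_mono (Q : quiver) (F : finFieldType) i (X I : rep Q F) (f : hom I X) :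
  is_I i I -> hnz f -> mono f.
Proof.
move=> dI [v nv] w; rewrite /row_free eqn_leq rank_leq_row /=.
apply: leq_trans (_ : (w == i) <= _)%N; first by rewrite dI.
case: (eqVneq w i) => [->|] //; rewrite lt0n mxrank_eq0.
case: (eqVneq v i) nv => [<- //|ni /eqP[]].
by apply: mx_rows0; rewrite dI (negPf ni).
Qed.

(** * Sums of R_x(m) from distinct tubes *)

Section ClaimB.
Variables (Q : quiver) (F : finFieldType) (delta : qV Q -> nat).
Implicit Types (N S R T : rep Q F) (v : qV Q) (a : qA Q).
Hypothesis rad : forall v, cartan (ivec delta) (evec v) = 0.
Hypothesis pos : forall v, (0 < delta v)%N.
Local Notation Fneg := (@Fneg Q F delta).
Local Notation semist := (@semist Q F delta).
Local Notation stab := (@stab Q F delta).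
Variable i : qV Q.
Hypothesis src : forall a, qt a != i.
Hypothesis di : delta i = 1%N.
Variables (I X : rep Q F) (n : nat).
Hypothesis dI : is_I i I.
Hypothesis injI : injective_rep I.
Hypothesis n1 : (1 <= n)%N.
Hypothesis cX : c_form delta I n X.

(** I has defect 1 and cannot embed in a semistable summand. *)
Lemma c_form_noI (g : hom I X) : ~ hnz g.
Proof.
move=> nzg; have [_ [s [iX [Rs _]]]] := cX.
have [x [y [xy yx]]] := iso_homs iX.
have [u [p [_ _ up]]] := bigsum_proj s.
have [|j lt nj] := up _ (hcomp g x).
  by apply: mono_hnz; [apply: mono_comp | apply: hnz_dom nzg] => v;
     [exact: is_I_mono dI nzg v | apply/row_freeP; exists (y v)].
have [[IR dR] _] := Rs j lt.
have := proj2 (indec_reg rad IR dR) _ _ (is_I_mono dI nj).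
by rewrite (dfc_I src di dI).
Qed.

Lemma c_form_semist : semist X.
Proof.
have [_ [s [iX [Rs _]]]] := cX.
apply: semist_iso (iso_sym iX) _; apply: semist_bigsum; apply/allp_nth => j lt.
by have [[IR dR] _] := Rs j lt; exact: indec_reg.
Qed.

(* Inside an indecomposable regular module the stable submodule is unique, so a
   stable submodule of X lies in a single summand, where f is nonzero on it. *)
Lemma c_form_functional : exists f : hom X I,
  forall T (t : hom T X), stab T -> mono t -> hnz (hcomp t f).
Proof.
have [_ [s [iX [Rs dist]]]] := cX.
have [x [y [xy yx]]] := iso_homs iX.
have [u [p [_ _ up]]] := bigsum_proj s.
pose R (j : 'I_(size s)) := nth (zero_rep Q F) s j.
have [f fE] : exists f : forall j : 'I_(size s), hom (R j) I,
    forall j T (t : hom T (R j)), stab T -> mono t -> hnz (hcomp t (f j)).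
  apply: (@fin_all_exists _ (fun j => hom (R j) I) (fun j fj => forall T (t : hom T (R j)),
    stab T -> mono t -> hnz (hcomp t fj))) => j; have [[IR dR] [_ [S [[sS [q [hq eq']]] [b [hb mb]]]]]] := Rs j (ltn_ord j).
  have [e [he eE]] := injI hb mb hq; exists (Hom he) => T t sT mt.
  have [_ uR] := indec_unif rad pos IR dR.
  have sS' : stab S by apply/(stab_regular_simple rad).
  have [th thE] := fac_mono (g := t) (k := Hom hb) mb (uR _ _ t (Hom hb) sT sS' mt mb).
  have mth : mono th by move=> v; apply: (@free_mull _ _ _ _ _ (b v)); rewrite thE.
  have nT : nzero T by case: sT.
  have [_ eth] := stab_bij sT sS' (mono_hnz mth nT).
  apply: (epi_hnz (f := hcomp t (Hom he))); last by apply/nzeroP; exists i; rewrite dI eqxx.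
  move=> v; rewrite /= -thE -mulmxA (eE v).
  by apply: (epi_comp (f := th) (g := Hom hq)) eth eq' v.
have hg : is_hom (fun v => \sum_(j < size s) p j v *m f j v).
  move=> a; rewrite mulmx_sumr mulmx_suml; apply: eq_bigr => j _.
  by rewrite mulmxA homE -!mulmxA homE.
pose g := Hom hg; exists (hcomp x g) => T t sT mt.
have mtx : mono (hcomp t x) by apply: mono_comp mt _ => v; apply/row_freeP; exists (y v).
have nT : nzero T by case: sT.
have [j lt nj] := up _ _ (mono_hnz mtx nT).
pose tj l := hcomp (hcomp t x) (p l).
have sR l : (l < size s)%N -> semist (nth (zero_rep Q F) s l).
  by move=> ll; have [[IR dR] _] := Rs l ll; exact: indec_reg.
have mj l : (l < size s)%N -> hnz (tj l) -> mono (tj l) by move=> ll; apply: stab_mono sT (sR l ll).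
have njf := fE (Ordinal lt) T (tj j) sT (mj j lt nj).
have spT : special_reg_simple delta I T.
  split; first by apply/(stab_regular_simple rad).
  exists (hcomp (tj j) (f (Ordinal lt))); split; first exact: homP.
  exact: is_I_epi dI njf.
have emb l : (l < size s)%N -> hnz (tj l) -> embeds T (nth (zero_rep Q F) s l).
  by move=> ll nl; exists (tj l); split; [exact: homP | exact: mj].
have z l : (l < size s)%N -> l != j -> forall v, tj l v = 0.
  move=> ll nlj; apply: hnzPn => nl; case: (ltngtP l j) nlj => // [lj|jl] _.
    by apply: (dist l j lj lt); exists T; split=> //; split; exact: emb.
  by apply: (dist j l jl ll); exists T; split=> //; split; exact: emb.
case: njf => v nv; exists v; congr (~~ _): nv; congr (_ == _).
rewrite [RHS]/= mulmxA mulmx_sumr (bigD1 (Ordinal lt)) //= big1 ?addr0; last first.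
  by move=> l nl; rewrite mulmxA [X in X *m _](z l (ltn_ord l)) ?mul0mx.
by rewrite mulmxA.
Qed.

Lemma c_form_ses : exists (K : rep Q F) (k : hom K X) (f : hom X I), ses k f /\ Fneg K.
Proof.
have [f fT] := c_form_functional; have sX := c_form_semist.
have nX : nzero X by apply/nzeroP; exists i; rewrite (proj1 cX) di muln1 -lt0n.
have [T [t [sT mt]]] := stab_ex sX nX.
have ef : epi f.
  apply: is_I_epi dI _; case: (fT _ _ sT mt) => v nv; exists v; apply: contra nv => /eqP f0.
  by rewrite /= f0 mulmx0.
have [K [k Sf]] := ses_epi ef; have [mk _ _] := Sf; exists K, k, f; split=> // N m mm nN.
have mmk := mono_comp mm mk.
rewrite lt_neqAle (proj2 sX _ _ mmk) andbT; apply/eqP => d0.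
have [T' [t' [sT' mt']]] := stab_ex (semist_sub sX mmk d0) nN.
case: (fT _ (hcomp t' (hcomp m k)) sT' (mono_comp mt' mmk)) => v /eqP[].
by rewrite /= -!mulmxA (ses0 Sf) !mulmx0.
Qed.

End ClaimB.

Lemma kermx_scale (F : fieldType) m n (A : 'M[F]_(m, n)) c : c != 0 -> (kermx (c *: A) :=: kermx A)%MS.
Proof.
move=> c0; apply/eqmxP/andP; split; apply/sub_kermxP; last by rewrite -scalemxAr mulmx_ker scaler0.
by apply: (scalerI c0); rewrite scaler0 scalemxAr mulmx_ker.
Qed.

(** * Hall numbers *)

Section Hall.
Variables (Q : quiver) (F : finFieldType).
Implicit Types (N X K C : rep Q F) (v : qV Q).

Lemma ses_rank K X C (k : hom K X) (c : hom X C) : mono k -> epi c ->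
  (forall v, k v *m c v = 0) -> (forall v, rdim X v = rdim K v + rdim C v)%N -> ses k c.
Proof.
move=> mk ec kc dX; split=> // v; apply/eqmx_sym/eqmxP.
have le : (k v <= kermx (c v))%MS by apply/sub_kermxP.
by rewrite -(geq_leqif (mxrank_leqif_eq le)) mxrank_ker (mono_rank mk) (epi_rank ec) dX addnK.
Qed.

Lemma ses_iso_l K K' X C (k : hom K X) (c : hom X C) (u : hom K' K) :
  mono u -> epi u -> ses k c -> ses (hcomp u k) c.
Proof.
move=> mu eu [mk ec kc]; split=> // [|v]; first exact: mono_comp.
by apply: eqmx_trans (kc v) _; apply/eqmx_sym/eqmxMfull.
Qed.

Lemma hall_mem C K X (U : C0 X X) :
  reflect (exists k : hom K X, exists c : hom X C, ses k c /\ forall v, U v = <<k v>>%MS)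
  [&& [forall v, U v == <<U v>>%MS],
      [exists phi : C0 K X, homb phi && [forall v, row_free (phi v) && (phi v == U v)%MS]] &
      [exists psi : C0 X C, homb psi && [forall v, row_full (psi v) && (kermx (psi v) == U v)%MS]]].
Proof.
apply: (iffP and3P) => [[/forallP gU /existsP[phi /andP[hp /forallP mp]] /existsP[psi /andP[hq /forallP eq]]]|].
  exists (hm (Sub phi hp : Hm K X)), (hm (Sub psi hq : Hm X C)); split.
    split=> v /=; first by case/andP: (mp v).
      by case/andP: (eq v).
    have /andP[_ /eqmxP e1] := mp v; have /andP[_ /eqmxP e2] := eq v.
    by apply: eqmx_trans e2 (eqmx_sym e1).
  move=> v; rewrite (eqP (gU v)); apply/eq_genmx/eqmx_sym/eqmxP.
  by have /andP[_] := mp v.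
case=> k [c [[mk ec kc] UE]]; split.
- by apply/forallP => v; rewrite UE genmx_id.
- apply/existsP; exists (val (mh k)); rewrite (valP (mh k)); apply/forallP => v.
  rewrite UE (_ : (val (mh k)) v = k v); last exact: hmK.
  by rewrite mk; apply/eqmxP/eqmx_sym/genmxE.
- apply/existsP; exists (val (mh c)); rewrite (valP (mh c)); apply/forallP => v.
  rewrite UE (_ : (val (mh c)) v = c v); last exact: hmK.
  rewrite [row_full _]ec; apply/eqmxP; apply: eqmx_trans (kc v) _.
  exact/eqmx_sym/genmxE.
Qed.

Lemma autE X : aut_number X = #|[set g : Hm X X | [forall v, hm g v \in unitmx]]|.
Proof.
rewrite -(card_imset _ val_inj); apply: eq_card => g; rewrite inE; apply/andP/imsetP => [[hg ug]|[g' ug ->]].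
  by exists (Sub g hg : Hm X X) => //; rewrite inE.
by rewrite inE in ug; split=> //; exact: (valP g').
Qed.

Definition epis P X I := [set g : Hm X I |
  [forall v, row_full (hm g v)] &&
  [exists phi : Hm P X, [forall v, row_free (hm phi v) && (kermx (hm g v) == hm phi v)%MS]]].

Lemma episP P X I (g : Hm X I) : reflect (exists k : hom P X, ses k (hm g)) (g \in epis P X I).
Proof.
rewrite inE; apply: (iffP andP) => [[/forallP eg /existsP[phi /forallP mp]]|[k [mk eg gk]]].
  by exists (hm phi); split=> // v; have /andP[? /eqmxP] := mp v.
split; first exact/forallP.
apply/existsP; exists (mh k); apply/forallP => v; rewrite hmK [row_free _]mk; exact/eqmxP/gk.
Qed.

Lemma epis_mh P X I (k : hom P X) (f : hom X I) : ses k f -> mh f \in epis P X I.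
Proof.
case=> mk ef kf; apply/episP; exists k; split=> // v; rewrite hmK //.
Qed.

Variables (i : qV Q) (I P X : rep Q F).
Hypothesis dI : is_I i I.

(** [f'] factors through [f] by an endomorphism of I, and these are scalars. *)
Lemma ses_scalar (k k' : hom P X) (f f' : hom X I) : ses k f -> ses k' f' ->
  (forall v, k v :=: k' v)%MS -> exists2 c : F, c != 0 & forall v, f' v = c *: f v.
Proof.
move=> S S' kk'; have [|t tE] := ses_cofac (g := f') S.
  move=> v; apply/sub_kermxP; rewrite kk'; apply/sub_kermxP; exact: ses0 S' v.
have [z0 zE] : exists z : 'I_(rdim I i), forall z', z' = z.
  have e : rdim I i = 1%N by rewrite dI eqxx.
  have lt : (0 < rdim I i)%N by rewrite e.
  exists (Ordinal lt) => z; apply: val_inj => /=; have := ltn_ord z.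
  by rewrite {2}e ltnS leqn0 => /eqP.
have tc v : f' v = t i z0 z0 *: f v.
  rewrite -tE; case: (eqVneq v i) => [->|ni].
    by apply/matrixP => x y; rewrite !mxE (bigD1 z0) //= big1 ?addr0 ?(zE y) 1?mulrC // => z /eqP[].
  by rewrite (mx_cols0 (f v)) ?scaler0 ?mul0mx // dI (negPf ni).
exists (t i z0 z0) => //; apply/eqP => t0.
have [_ ef _] := S'; have := epi_rank ef i; rewrite tc t0 scale0r mxrank0 dI eqxx.
by [].
Qed.

Lemma hall_epis : ((#|F| - 1) * hall_number I P X = #|epis P X I|)%N.
Proof.
pose kf (g : Hm X I) : C0 X X := [ffun v => <<kermx (hm g v)>>%MS].
rewrite /hall_number; set H := [set U | _].
have HP (U : C0 X X) : reflect (exists k : hom P X, exists c : hom X I, ses k c /\ forall v, U v = <<k v>>%MS) (U \in H).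
  by rewrite inE; exact: hall_mem.
have kfH g : g \in epis P X I -> kf g \in H.
  case/episP => k S; apply/HP; exists k, (hm g); split=> // v; rewrite ffunE.
  by case: S => _ _ kg; exact: eq_genmx.
rewrite -[RHS]sum1_card (partition_big kf (mem H)) //= mulnC -sum_nat_const; apply: eq_bigr => U /HP[k [f [S UE]]].
rewrite sum1dep_card subn1 -(cardC1 (0 : F)).
have inj : {in predC1 (0 : F) &, injective (fun c => mh (hscale c f))}.
  move=> c d _ _ /mh_eq/(_ i)/=/eqP; rewrite -subr_eq0 -scalerBl scaler_eq0 subr_eq0 => /orP[/eqP //|/eqP f0].
  have [_ ef _] := S; have := epi_rank ef i; by rewrite f0 mxrank0 dI eqxx.
rewrite -(card_in_imset inj); apply: eq_card => g; apply/imsetP/idP => [[c c0 ->]|].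
  rewrite !inE in c0; rewrite inE.
  have Sc : ses k (hscale c f).
    case: S => mk ef kf'; split=> // v /=; first by rewrite /row_full mxrank_scale_nz //; exact: ef.
    exact: eqmx_trans (kermx_scale _ c0) (kf' v).
  rewrite (epis_mh Sc); apply/eqP/ffunP => v; rewrite ffunE UE; apply: eq_genmx.
  by rewrite hmK; case: Sc.
rewrite inE => /andP[/episP[k' S'] /eqP kfg].
have [|c c0 cE] := ses_scalar S S'.
  move=> v; have [_ _ kg] := S'; apply: eqmx_trans (kg v); apply: eqmx_trans (genmxE _).
  by apply: eqmx_trans (eqmx_sym (genmxE _)) _; rewrite -UE -kfg ffunE.
exists c => //; apply: hm_inj => v; by rewrite hmK cE.
Qed.

End Hall.

(** * Hall numbers of P and I *)

Section Numbers.
Variables (Q : quiver) (F : finFieldType) (delta : qV Q -> nat).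
Implicit Types (N Y : rep Q F) (v : qV Q) (a : qA Q).
Hypothesis rad : forall v, cartan (ivec delta) (evec v) = 0.
Hypothesis pos : forall v, (0 < delta v)%N.
Hypothesis conn : connected_quiver Q.
Local Notation Fneg := (@Fneg Q F delta).
Variable i : qV Q.
Hypothesis src : forall a, qt a != i.
Hypothesis di : delta i = 1%N.
Variables (X I P : rep Q F) (n : nat).
Hypothesis dI : is_I i I.
Hypothesis injI : injective_rep I.
Hypothesis dP : dim_src delta i n P.
Hypothesis FP : Fneg P.

Lemma hall_ex C K Y : (0 < hall_number C K Y)%N ->
  exists k : hom K Y, exists c : hom Y C, ses k c.
Proof. by rewrite card_gt0 => /set0Pn[U]; rewrite inE => /hall_mem[k [c [S _]]]; exists k, c. Qed.

Lemma ses_dX (k : hom P X) (f : hom X I) : ses k f -> forall v, rdim X v = (n * delta v)%N.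
Proof. by move=> S v; rewrite (ses_dim S) dI dP. Qed.

Lemma dX_i : (forall v, rdim X v = (n * delta v)%N) -> forall v, rdim X v = (rdim X i * delta v)%N.
Proof. by move=> dX v; rewrite !dX di muln1. Qed.

Lemma epis_aut (k : hom P X) (f : hom X I) : ses k f -> (forall g : hom I X, ~ hnz g) ->
  #|epis P X I| = aut_number X.
Proof.
move=> S noI; have dX := dX_i (ses_dX S).
have onto k' f' (S' : ses k' f') g := endo_onto rad pos conn src di dI S' FP noI dX g.
have uniq (k' : hom P X) (f' : hom X I) (S' : ses k' f') (g g' : hom X X) :
    (forall v, g v *m f' v = g' v *m f' v) -> forall v, g v = g' v.
  exact: (endo_eq rad src di dI S' FP noI dX).
rewrite autE; have inj : injective (fun g : Hm X X => mh (hcomp (hm g) f)).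
  by move=> g g' /mh_eq e; apply: hm_inj; exact: (uniq _ _ S _ _ e).
rewrite -(card_imset _ inj); apply/esym/eq_card => g; apply/imsetP/idP => [[g' ug ->]|].
  rewrite inE in ug; have ug' v : hm g' v \in unitmx by exact: (forallP ug).
  have [|| w [gw wg]] := bij_inv (f := hm g').
  - by move=> v; rewrite row_free_unit.
  - by move=> v; rewrite row_full_unit.
  have [mk ef kf] := S.
  apply: (epis_mh (k := hcomp k w)); apply: ses_rank (ses_dim S).
  - by apply: mono_comp => // v; apply/row_freeP; exists (hm g' v).
  - by apply: epi_comp => // v; rewrite row_full_unit.
  - by move=> v; apply: etrans (mul_mid _ _ _ _) _; rewrite wg mulmx1 (ses0 S).
case/episP => k' S'.
(* Here u f = g and w g = f, so u w fixes [g], and uniqueness makes u w the identity. *)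
have [u uE] := onto _ _ S (hm g); have [w wE] := onto _ _ S' f.
exists (mh u); last by apply: hm_inj => v; rewrite hmK -uE -[in LHS](hmK u v).
rewrite inE; apply/forallP => v; rewrite hmK.
apply: proj1 (@mulmx1_unit _ _ _ (w v) _).
apply: (uniq _ _ S' (hcomp u w) (hid X)) => z.
by apply: etrans (esym (mulmxA _ _ _)) _; rewrite wE uE mul1mx.
Qed.

Lemma P_noI (g : hom I P) : ~ hnz g.
Proof.
move=> ng; have nI : nzero I by exact: hnz_dom ng.
by have := FP (is_I_mono dI ng) nI; rewrite (dfc_I src di dI).
Qed.

Lemma injective_card Y : h Y I = (#|F| ^ rdim Y i)%N.
Proof.
apply/eqP; rewrite -(eqr_nat rat) euler_rat (injective_z1 Y injI) mul1r.
by rewrite (eu_I_r src Y dI) natrX.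
Qed.

(** Since Hom(I, P) = 0, the copy of I is not inside P and maps isomorphically onto the quotient; so
    X splits, and the projection to P has kernel I. *)
Lemma ses_swap (k : hom P X) (f : hom X I) (g : hom I X) : ses k f -> hnz g ->
  exists c : hom X P, ses g c.
Proof.
move=> S ng; have [mk ef kf] := S; have mg := is_I_mono dI ng.
have nf : hnz (hcomp g f).
  apply: NNPP => /hnzPn gf0; have [w wE] := ses_fac S gf0.
  apply: (@P_noI w); case: ng => v nv; exists v; apply: contra nv => /eqP w0.
  by rewrite -wE w0 mul0mx.
have [t [gt tg]] := bij_inv (is_I_mono dI nf) (is_I_epi dI nf).
have [|r kr sr] := sec_ret (s := hcomp t g) S; first by move=> v; rewrite /= -mulmxA; exact: tg.
exists r; apply: ses_rank => //.
- by move=> v; apply/row_fullP; exists (k v).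
- move=> v; have := congr1 (mulmx (hcomp g f v)) (sr v); rewrite mulmx0 => <-.
  by rewrite [RHS]mulmxA [X in _ = X *m _]mulmxA gt mul1mx.
- by move=> v; rewrite (ses_dim S) addnC.
Qed.

(** [f] restricts to an automorphism of I on its copy in X; correcting a section of [c] by it moves
    the image into the kernel of [f]. *)
Lemma ses_unswap (g : hom I X) (c : hom X P) (f : hom X I) : ses g c -> hnz (hcomp g f) ->
  exists k : hom P X, ses k f.
Proof.
move=> S nf; have [mg ec gc] := S.
have [t [gt tg]] := bij_inv (is_I_mono dI nf) (is_I_epi dI nf).
have [s' sE] := ret_sec (r := hcomp f t) S (fun v => etrans (mulmxA _ _ _) (gt v)).
have [r rE] : exists r : hom P X, forall v, r v = s' v - s' v *m f v *m t v *m g v.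
  exists (hsub s' (hcomp (hcomp (hcomp s' f) t) g)) => v; exact: hsubE.
exists r; apply: ses_rank.
- move=> v; apply/row_freeP; exists (c v).
  by rewrite rE mulmxBl sE -(mulmxA _ (g v)) (ses0 S) mulmx0 subr0.
- by move=> v; apply/row_fullP; exists (t v *m g v); rewrite -mulmxA; exact: tg.
- move=> v; rewrite rE mulmxBl -!mulmxA.
  by have /= e := tg v; rewrite e mulmx1 subrr.
by move=> v; rewrite (ses_dim S) addnC.
Qed.

(** Hom(I, P) = 0 forces every copy of I in X into the given one. *)
Lemma hall_split_PI (g : hom I X) (c : hom X P) : ses g c -> hall_number P I X = 1%N.
Proof.
move=> S; have [mg ec gc] := S.
have -> : hall_number P I X = #|[set ([ffun v => <<g v>>%MS] : C0 X X)]|; last exact: cards1.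
apply: eq_card => U; rewrite inE; apply/hall_mem/set1P => [[g' [c' [S' UE]]]|->]; last first.
  by exists g, c; split=> // v; rewrite ffunE.
apply/ffunP => v; rewrite ffunE UE; apply: eq_genmx; apply/eqmxP.
have [mg' _ _] := S'; have le : (g' v <= g v)%MS.
  by rewrite -gc; apply/sub_kermxP; exact: (hnzPn (P_noI (g := hcomp g' c)) v).
by rewrite -(geq_leqif (mxrank_leqif_eq le)) (mono_rank mg) (mono_rank mg').
Qed.

(** The maps X -> I with kernel P are those not vanishing on the copy of I. There are q^n - q^(n-1)
    of them, the subtracted ones being the maps P -> I, and each kernel arises q - 1 times. *)
Lemma hall_split_IP (g : hom I X) (c : hom X P) : ses g c -> (0 < n)%N ->
  hall_number I P X = (#|F| ^ n.-1)%N.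
Proof.
move=> S n0; have [mg ec gc] := S.
have q1 : (1 < #|F|)%N by have := q_gt1 F; rewrite ltr1n.
have rP : rdim P i = n.-1 by have := src_i di dP; lia.
have rX : rdim X i = n by rewrite (ses_dim S) dI eqxx rP; lia.
apply/eqP; rewrite -(eqn_pmul2l (m := #|F| - 1)) ?subn_gt0 // (hall_epis P X dI).
pose Z := [set f : Hm X I | [forall v, g v *m hm f v == 0]].
have -> : epis P X I = ~: Z.
  apply/setP => f; rewrite in_setC [f \in Z]inE; apply/idP/idP => [/episP[k Sk]|].
    apply/negP => /forallP f0; have [t tE] := ses_fac (g := g) Sk (fun v => eqP (f0 v)).
    apply: (@P_noI t); apply: mono_hnz => [v|]; last by apply/nzeroP; exists i; rewrite dI eqxx.
    by apply: (@free_mull _ _ _ _ _ (k v)); rewrite tE; exact: mg.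
  rewrite negb_forall => /existsP[v nv]; apply/episP; apply: (ses_unswap S).
  by exists v.
have cZ : #|Z| = (#|F| ^ n.-1)%N.
  rewrite -rP -injective_card /h.
  have inj : injective (fun f : Hm P I => mh (hcomp c (hm f))).
    by move=> f f' /mh_eq e; apply: hm_inj => v; exact: (full_inj (ec v) (e v)).
  rewrite -cardsT -(card_imset _ inj); apply: eq_card => f; apply/idP/imsetP => [|[f' _ ->]].
    rewrite inE => /forallP f0; have [t tE] := ses_cofac (g := hm f) S (fun v => eqP (f0 v)).
    by exists (mh t) => //; apply: hm_inj => v; rewrite hmK -tE -[in LHS](hmK t v).
  by rewrite inE; apply/forallP => v; rewrite hmK /= mulmxA (ses0 S) mul0mx.
have := cardsC Z; rewrite cZ; have := injective_card X; rewrite /h rX => ->.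
by rewrite -{2}(prednK n0) expnS mulnBl mul1n => e; rewrite -e addKn.
Qed.

End Numbers.

Theorem theorem5p1 (Q : quiver) (F : finFieldType) (delta : qV Q -> nat)
    (I P : rep Q F) (n : nat) :
  affine_quiver Q -> acyclic Q -> min_pos_imag_root delta ->
  simple_rep I -> injective_rep I -> defect delta I = 1 ->
  (1 <= n)%N ->
  preprojective delta P ->
  (forall v, (rdim P v)%:Z = (n * delta v)%:Z - (rdim I v)%:Z) ->
  forall X : rep Q F,
    (c_form delta I n X ->
       (hall_number I P X)%:R
       = (#|F|%:R) ^+ (n.-1) * (hall_number P I X)%:R
         + (aut_number X)%:R / (#|F|%:R - 1) :> rat) /\
    (~ c_form delta I n X ->
       (hall_number I P X)%:R
       = (#|F|%:R) ^+ (n.-1) * (hall_number P I X)%:R :> rat).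
Proof.
move=> [conn _] acyc [pos [rad _]] sI injI dfI n1 [IP dfP] dimP X.
have [i dI] := simple_vertex acyc sI.
have src := injective_source acyc injI dI.
have di := defect_source src dI dfI.
have dP : dim_src delta i n P by move=> v; have := dimP v; rewrite dI; lia.
have FP := indec_neg rad IP dfP.
have hq := hall_epis P X dI; have q1 := q_gt1 F.
have q1' : (#|F| - 1 != 0)%N by move: q1; rewrite ltr1n subn_eq0 -ltnNge.
case: (classic (exists g : hom I X, hnz g)) => [[g ng]|noI'].
  split=> [cX|_]; first by case: (c_form_noI rad src di dI cX (g := g)).
  case: (classic (exists (g : hom I X) (c : hom X P), ses g c)) => [[g' [c S]]|ns].
    by rewrite (hall_split_IP src di dI injI dP FP S n1) (hall_split_PI src di dI FP S) mulr1 natrX.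
  case: (posnP (hall_number I P X)) => [->|/hall_ex[k [f S]]]; last first.
    by case: ns; exists g; exact: (ses_swap src di dI FP S ng).
  case: (posnP (hall_number P I X)) => [->|/hall_ex[k [f S]]]; first by rewrite mulr0.
  by case: ns; exists k, f.
have noI (g : hom I X) : ~ hnz g by move=> ng; apply: noI'; exists g.
have -> : hall_number P I X = 0%N.
  case: (posnP (hall_number P I X)) => // /hall_ex[k [f [mk _ _]]].
  by case: (noI k); apply: mono_hnz mk _; apply/nzeroP; exists i; rewrite dI eqxx.
rewrite mulr0 add0r; split=> [cX|ncX].
  have [K [k [f [S FK]]]] := c_form_ses rad pos di dI injI n1 cX.
  have dK : dim_src delta i n K by move=> v; rewrite -dI -(proj1 cX) (ses_dim S).
  have dPK v : rdim P v = rdim K v by have := dP v; have := dK v; lia.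
  have /iso_bij[u [mu eu]] := fneg_iso FP (src_dfc rad src di dP) FK dPK (src_eu rad src di dP).
  rewrite -(epis_aut rad pos conn src di dI dP FP (ses_iso_l mu eu S) noI) -hq natrM natrB 1?ltnW -1?(ltr1n rat) //.
  by rewrite mulrC mulKf // subr_eq0 gt_eqF.
case: (posnP #|epis P X I|) => [e0|/card_gt0P[f /episP[k S]]].
  by move: hq => /eqP; rewrite e0 muln_eq0 (negPf q1') => /eqP ->.
case: ncX; have dX := ses_dX dI dP S; have := cyc_c_form rad pos conn src di dI S FP noI (dX_i di dX) injI.
by rewrite dX di muln1.
Qed.
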